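(* Let $M$ be the 5-manifold with coordinates $(\psi,\theta,\phi,x,q)$ on the domain $\sin\theta\neq0$, $\cos(3x)\neq0$. With $\sigma_i,E^i$ the left-invariant 1-forms and dual vector fields of $SU(2)$ in Euler angles $(\psi,\theta,\phi)$ (see context), let $D_{\mathbb{R}}$ be the real rank 2 distribution spanned by $$X^1=\partial_x+E^2,\qquad X^2=\partial_q+\cos(3x)E^1-3\sin(3x)E^3 .$$ Let $o_4=-dx$, $o_5=\cos(3x)\,dq$ and $$\tilde o_1=\sigma_1+\cos(3x)\,dq,\quad \tilde o_2=\sigma_2+dx,\quad \tilde o_3=\sigma_3+3\sin(3x)\,dq,$$ where $\tilde o_1,\tilde o_2,\tilde o_3$ span the annihilator of the sign-reversed distribution $\tilde D_{\mathbb{R}}$. Then $D_{\mathbb{R}}$ is a maximally symmetric $(2,3,5)$-distribution and a representative metric of Nurowski's conformal class associated to $D_{\mathbb{R}}$ is $$g_{\mathbb{R}}=-2(o_4 o_4+o_5o_5)+\tfrac{1}{2}\tilde{o}_1\tilde{o}_1+\tfrac{1}{2}\tilde{o}_2\tilde{o}_2-\tfrac{1}{6}\tilde{o}_3 \tilde{o}_3$$ $$=\chi_1^2+\chi_2^2-(\chi_3^2+\chi_4^2)-\tfrac{1}{2}(\omega_1^2+\omega_2^2)-\tfrac{1}{6}\omega_3^2 .$$ The conformal structure $[g_{\mathbb{R}}]$ is conformally flat and $D_{\mathbb{R}}$ has the split real form of $G_2$ as its group of (local) symmetries.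
   Context: Products of 1-forms are symmetric products, and $\omega^2=\omega\omega$. Left-invariant forms and vector fields on $SU(2)\cong S^3$ in Euler angles $(\psi,\theta,\phi)$: $$\sigma_1=\sin\psi\,d\theta-\cos\psi\sin\theta\,d\phi,\quad \sigma_2=\cos\psi\,d\theta+\sin\psi\sin\theta\,d\phi,\quad \sigma_3=-d\psi-\cos\theta\,d\phi,$$ with dual vector fields $$E^1=\sin\psi\,\partial_\theta+\cos\psi\left(\cot\theta\,\partial_\psi-\tfrac{1}{\sin\theta}\partial_\phi\right),\quad E^2=\cos\psi\,\partial_\theta-\sin\psi\left(\cot\theta\,\partial_\psi-\tfrac{1}{\sin\theta}\partial_\phi\right),\quad E^3=-\partial_\psi .$$ The annihilator of $D_{\mathbb{R}}$ is spanned by $o_1=\sigma_1-\cos(3x)dq$, $o_2=\sigma_2-dx$, $o_3=\sigma_3+3\sin(3x)dq$; the sign-reversed distribution $\tilde D_{\mathbb{R}}$ is the kernel of the forms $\tilde o_1,\tilde o_2,\tilde o_3$, obtained by reversing the signs of the second terms in $o_1$ and $o_2$ and setting $\tilde o_3=o_3$. Rolling forms: with $f(\theta)=-\sin\theta$ and $h(x)=\cos(3x)$, $$\chi_1=d\theta,\quad \chi_2=f\,d\phi,\quad \chi_3=dx,\quad \chi_4=h\,dq,$$ $$\omega_1=\chi_1-\cos\psi\,\chi_3-\sin\psi\,\chi_4,\quad \omega_2=\chi_2+\sin\psi\,\chi_3-\cos\psi\,\chi_4,\quad \omega_3=d\psi+\tfrac{h_x}{h}\chi_4-\tfrac{f_\theta}{f}\chi_2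 .$$ A $(2,3,5)$-distribution on a 5-manifold $M$ is a rank 2 distribution $D\subset TM$ with $[D,D]$ of rank 3 and $[[D,D],D]=TM$. Nurowski's conformal class of $D$: locally there exist a coframe $(\theta_1,\dots,\theta_5)$ with $D=\ker(\theta_1,\theta_2,\theta_3)$ and 1-forms $\Omega_1,\dots,\Omega_7$ satisfying Cartan's structure equations $$d\theta_1=\theta_1\wedge(2\Omega_1+\Omega_4)+\theta_2\wedge\Omega_2+\theta_3\wedge\theta_4,$$ $$d\theta_2=\theta_1\wedge\Omega_3+\theta_2\wedge(\Omega_1+2\Omega_4)+\theta_3\wedge\theta_5,$$ $$d\theta_3=\theta_1\wedge\Omega_5+\theta_2\wedge\Omega_6+\theta_3\wedge(\Omega_1+\Omega_4)+\theta_4\wedge\theta_5,$$ $$d\theta_4=\theta_1\wedge\Omega_7+\tfrac43\theta_3\wedge\Omega_6+\theta_4\wedge\Omega_1+\theta_5\wedge\Omega_2,$$ $$d\theta_5=\theta_2\wedge\Omega_7-\tfrac43\theta_3\wedge\Omega_5+\theta_4\wedge\Omega_3+\theta_5\wedge\Omega_4,$$ and the class is that of $g=2\theta_1\theta_5-2\theta_2\theta_4+\frac43\theta_3\theta_3$ (signature $(2,3)$), which depends only on $D$ up to conformal rescaling (rescaling by a nonzero function of either sign is allowed). $D$ is called maximally symmetric when $g$ has vanishing Weyl tensor; its local infinitesimal symmetries then form the split real form of $\mathfrak{g}_2$. *)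

(* Defs.v *)
From HB Require Import structures.
From mathcomp Require Import all_boot all_order all_algebra.
From mathcomp Require Import all_classical all_reals all_analysis.

Set Implicit Arguments.
Unset Strict Implicit.
Unset Printing Implicit Defensive.

Import Order.TTheory GRing.Theory Num.Theory.
Import numFieldNormedType.Exports.

Local Open Scope classical_set_scope.
Local Open Scope ring_scope.

Notation ix k := (@Ordinal 5 k isT) (only parsing).

(* Points and tangent vectors are rows,
   covectors are columns, 2-forms and metrics are 5 x 5 matrices of
   components. *)

Definition vfield (R : realType) : Type := 'rV[R]_5 -> 'rV[R]_5.
Definition form1 (R : realType) : Type := 'rV[R]_5 -> 'cV[R]_5.
Definition metric (R : realType) : Type := 'rV[R]_5 -> 'M[R]_5.
Definition dist (R : realType) : Type := 'rV[R]_5 -> set 'rV[R]_5.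

Section Calculus.
Variable R : realType.
Implicit Types (U M : set 'rV[R]_5) (f : 'rV[R]_5 -> R) (p q : 'rV[R]_5).
Implicit Types (X Y : vfield R) (a b : form1 R) (g : metric R) (D E : dist R).

Definition pder (i : 'I_5) f : 'rV[R]_5 -> R := fun p => 'D_(delta_mx 0 i) f p.

Definition iter_pder (s : seq 'I_5) f : 'rV[R]_5 -> R := foldr pder f s.

Definition smooth_on U f : Prop :=
  forall (s : seq 'I_5) p, U p ->
    {for p, continuous (iter_pder s f)} /\
    forall i : 'I_5, derivable (iter_pder s f) p (delta_mx 0 i).

Definition smooth_vfield U X : Prop :=
  forall j : 'I_5, smooth_on U (fun p => X p 0 j).
Definition smooth_form U a : Prop :=
  forall i : 'I_5, smooth_on U (fun p => a p i 0).

Definition pairing (a : 'cV[R]_5) (v : 'rV[R]_5) : R := (v *m a) 0 0.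

Definition lie X Y : vfield R := fun p =>
  \row_j \sum_(i < 5) (X p 0 i * pder i (fun q => Y q 0 j) p
                       - Y p 0 i * pder i (fun q => X q 0 j) p).

Definition ext_d a : 'rV[R]_5 -> 'M[R]_5 := fun p =>
  \matrix_(i, j) (pder i (fun q => a q j 0) p - pder j (fun q => a q i 0) p).

Definition wedge (a b : 'cV[R]_5) : 'M[R]_5 := a *m b^T - b *m a^T.

Definition sprod (a b : 'cV[R]_5) : 'M[R]_5 := 2^-1 *: (a *m b^T + b *m a^T).

Definition vspan (S : set 'rV[R]_5) : set 'rV[R]_5 :=
  [set v | exists2 s : seq 'rV[R]_5,
             (forall w, w \in s -> S w) & v \in << s >>%VS].

Definition smooth_distribution M (k : nat) D : Prop :=
  forall p, M p -> exists U (B : seq (vfield R)),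
    [/\ open U, U p & U `<=` M] /\
    [/\ size B = k,
        forall n, (n < size B)%N -> smooth_vfield U (nth (fun=> 0) B n) &
        forall q, U q -> free [seq b q | b : vfield R <- B] /\
          D q = [set v | v \in <<[seq b q | b : vfield R <- B]>>%VS]].

Definition section_of U D X : Prop :=
  smooth_vfield U X /\ forall q, U q -> D q (X q).

Definition bracket_dist E D : dist R := fun p =>
  vspan [set w | exists U X Y,
           [/\ open U, U p, section_of U E X, section_of U D Y
             & w = lie X Y p]].

Definition is_235 M D : Prop :=
  [/\ smooth_distribution M 2 D,
      smooth_distribution M 3 (bracket_dist D D) &
      forall p, M p -> bracket_dist (bracket_dist D D) D p = setT].

Definition annihilator D p : set 'cV[R]_5 :=
  [set a | forall v, D p v -> pairing a v = 0].

Definition pseudo_metric U g : Prop :=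
  (forall i j : 'I_5, smooth_on U (fun p => g p i j)) /\
  forall p, U p -> (g p)^T = g p /\ g p \in unitmx.

Definition christoffel g (k i j : 'I_5) : 'rV[R]_5 -> R := fun p =>
  2^-1 * \sum_(l < 5) invmx (g p) k l *
    (pder i (fun q => g q l j) p + pder j (fun q => g q l i) p
     - pder l (fun q => g q i j) p).

(* riemann_up g l k i j is R^l_{kij}, i.e. the d_l-component of
   R(d_i, d_j) d_k. *)
Definition riemann_up g (l k i j : 'I_5) : 'rV[R]_5 -> R := fun p =>
  pder i (christoffel g l j k) p - pder j (christoffel g l i k) p
  + \sum_(m < 5) (christoffel g l i m p * christoffel g m j k p
                  - christoffel g l j m p * christoffel g m i k p).

Definition riemann g (l k i j : 'I_5) : 'rV[R]_5 -> R := fun p =>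
  \sum_(m < 5) g p l m * riemann_up g m k i j p.

Definition ricci g (k j : 'I_5) : 'rV[R]_5 -> R := fun p =>
  \sum_(i < 5) riemann_up g i k i j p.

Definition scalar_curv g : 'rV[R]_5 -> R := fun p =>
  \sum_(k < 5) \sum_(j < 5) invmx (g p) k j * ricci g k j p.

(* The coefficients are 1 / (n - 2) and 1 / ((n - 1) (n - 2)) for n = 5. *)
Definition weyl g (l k i j : 'I_5) : 'rV[R]_5 -> R := fun p =>
  riemann g l k i j p
  - 3^-1 * (g p l i * ricci g k j p - g p l j * ricci g k i p
            - g p k i * ricci g l j p + g p k j * ricci g l i p)
  + 12^-1 * scalar_curv g p * (g p l i * g p k j - g p l j * g p k i).

Definition flat_on U g : Prop :=
  forall q, U q -> forall l k i j, riemann g l k i j q = 0.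

Definition weyl_zero_on U g : Prop :=
  forall q, U q -> forall l k i j, weyl g l k i j q = 0.

Definition conformally_flat M g : Prop :=
  pseudo_metric M g /\
  forall p, M p -> exists U (lam : 'rV[R]_5 -> R),
    [/\ open U, U p & U `<=` M] /\
    [/\ smooth_on U lam,
        forall q, U q -> 0 < lam q &
        flat_on U (fun q => lam q *: g q)].

Definition cartan_structure U (t1 t2 t3 t4 t5 O1 O2 O3 O4 O5 O6 O7 : form1 R)
  : Prop :=
  forall q, U q ->
  [/\ ext_d t1 q = wedge (t1 q) (2 *: O1 q + O4 q) + wedge (t2 q) (O2 q)
                   + wedge (t3 q) (t4 q),
      ext_d t2 q = wedge (t1 q) (O3 q) + wedge (t2 q) (O1 q + 2 *: O4 q)
                   + wedge (t3 q) (t5 q),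
      ext_d t3 q = wedge (t1 q) (O5 q) + wedge (t2 q) (O6 q)
                   + wedge (t3 q) (O1 q + O4 q) + wedge (t4 q) (t5 q),
      ext_d t4 q = wedge (t1 q) (O7 q) + (4 / 3) *: wedge (t3 q) (O6 q)
                   + wedge (t4 q) (O1 q) + wedge (t5 q) (O2 q) &
      ext_d t5 q = wedge (t2 q) (O7 q) - (4 / 3) *: wedge (t3 q) (O5 q)
                   + wedge (t4 q) (O3 q) + wedge (t5 q) (O4 q)].

Definition nurowski_metric (t1 t2 t3 t4 t5 : form1 R) : metric R := fun q =>
  2 *: sprod (t1 q) (t5 q) - 2 *: sprod (t2 q) (t4 q)
  + (4 / 3) *: sprod (t3 q) (t3 q).

(* The rescaling factor lam may have either sign. *)
Definition nurowski_representative M D g : Prop :=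
  forall p, M p -> exists U (t1 t2 t3 t4 t5 : form1 R)
                          (O1 O2 O3 O4 O5 O6 O7 : form1 R)
                          (lam : 'rV[R]_5 -> R),
    [/\ open U, U p & U `<=` M] /\
    [/\ smooth_form U t1, smooth_form U t2, smooth_form U t3,
        smooth_form U t4 & smooth_form U t5] /\
    [/\ smooth_form U O1, smooth_form U O2, smooth_form U O3
      & smooth_form U O4] /\
    [/\ smooth_form U O5, smooth_form U O6 & smooth_form U O7] /\
    (forall q, U q -> free [:: t1 q; t2 q; t3 q; t4 q; t5 q]) /\
    (forall q, U q ->
       D q = [set v | [/\ pairing (t1 q) v = 0, pairing (t2 q) v = 0
                        & pairing (t3 q) v = 0]]) /\
    cartan_structure U t1 t2 t3 t4 t5 O1 O2 O3 O4 O5 O6 O7 /\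
    [/\ smooth_on U lam,
        forall q, U q -> lam q != 0 &
        forall q, U q -> g q = lam q *: nurowski_metric t1 t2 t3 t4 t5 q].

(* Weyl = 0 is conformally invariant and the class depends only on D, so one
   local representative is enough. *)
Definition maximally_symmetric M D : Prop :=
  forall p, M p -> exists U g,
    [/\ open U, U p & U `<=` M] /\
    nurowski_representative U D g /\ weyl_zero_on U g.

Definition inf_symmetry U D X : Prop :=
  smooth_vfield U X /\
  forall W Y, open W -> W `<=` U -> section_of W D Y ->
    forall q, W q -> D q (lie X Y q).

End Calculus.

(* The split octonions, as the Cayley-Dickson double of the split quaternions
   'M[R]_2, whose conjugation is the adjugate; split g_2 is their derivation
   algebra. *)

Section SplitG2.
Variable R : realType.

Local Notation soct := ('M[R]_2 * 'M[R]_2)%type.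

Definition soct_mul (x y : soct) : soct :=
  (x.1 *m y.1 + \adj y.2 *m x.2, y.2 *m x.1 + x.2 *m \adj y.1).

Definition split_g2 : set 'End(soct) :=
  [set d | forall x y,
     d (soct_mul x y) = soct_mul (d x) y + soct_mul x (d y)].

Definition lie_end (d e : 'End(soct)) : 'End(soct) :=
  ((d \o e) - (e \o d))%VF.

(* Phi restricts to a Lie algebra isomorphism from split g_2 onto the
   infinitesimal symmetries of D on U, vector fields being identified when
   they agree on U. *)
Definition g2_symmetry_iso (U : set 'rV[R]_5) (D : dist R)
    (Phi : 'End(soct) -> vfield R) : Prop :=
  [/\ forall d, split_g2 d -> inf_symmetry U D (Phi d),
      forall (c : R) d e, split_g2 d -> split_g2 e ->
        forall q, U q -> Phi (c *: d + e) q = c *: Phi d q + Phi e q,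
      forall d e, split_g2 d -> split_g2 e ->
        forall q, U q -> Phi (lie_end d e) q = lie (Phi d) (Phi e) q,
      forall d, split_g2 d -> (forall q, U q -> Phi d q = 0) -> d = 0 &
      forall X, inf_symmetry U D X ->
        exists2 d, split_g2 d & forall q, U q -> X q = Phi d q].

Definition local_symmetries_split_g2 (M : set 'rV[R]_5) (D : dist R) : Prop :=
  forall p (V : set 'rV[R]_5), M p -> open V -> V p -> V `<=` M ->
    exists U, [/\ open U, U p & U `<=` V] /\
      exists Phi, g2_symmetry_iso U D Phi.

End SplitG2.

(* The coordinates on R^5 are ordered (psi, theta, phi, x, q). *)

Section Rolling.
Variable R : realType.
Implicit Type p : 'rV[R]_5.

Definition psi_ p : R := p 0 (ix 0).
Definition theta_ p : R := p 0 (ix 1).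
Definition x_ p : R := p 0 (ix 3).

Definition d_psi : 'cV[R]_5 := delta_mx (ix 0) 0.
Definition d_theta : 'cV[R]_5 := delta_mx (ix 1) 0.
Definition d_phi : 'cV[R]_5 := delta_mx (ix 2) 0.
Definition d_x : 'cV[R]_5 := delta_mx (ix 3) 0.
Definition d_q : 'cV[R]_5 := delta_mx (ix 4) 0.

Definition dd_psi : 'rV[R]_5 := delta_mx 0 (ix 0).
Definition dd_theta : 'rV[R]_5 := delta_mx 0 (ix 1).
Definition dd_phi : 'rV[R]_5 := delta_mx 0 (ix 2).
Definition dd_x : 'rV[R]_5 := delta_mx 0 (ix 3).
Definition dd_q : 'rV[R]_5 := delta_mx 0 (ix 4).

Definition M5 : set 'rV[R]_5 :=
  [set p | sin (theta_ p) != 0 /\ cos (3 * x_ p) != 0].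

Definition sigma1 : form1 R := fun p =>
  sin (psi_ p) *: d_theta - (cos (psi_ p) * sin (theta_ p)) *: d_phi.
Definition sigma2 : form1 R := fun p =>
  cos (psi_ p) *: d_theta + (sin (psi_ p) * sin (theta_ p)) *: d_phi.
Definition sigma3 : form1 R := fun p =>
  - d_psi - cos (theta_ p) *: d_phi.

Definition E1 : vfield R := fun p =>
  sin (psi_ p) *: dd_theta
  + cos (psi_ p) *: ((cos (theta_ p) / sin (theta_ p)) *: dd_psi
                     - (sin (theta_ p))^-1 *: dd_phi).
Definition E2 : vfield R := fun p =>
  cos (psi_ p) *: dd_theta
  - sin (psi_ p) *: ((cos (theta_ p) / sin (theta_ p)) *: dd_psi
                     - (sin (theta_ p))^-1 *: dd_phi).
Definition E3 : vfield R := fun=> - dd_psi.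

Definition X1 : vfield R := fun p => dd_x + E2 p.
Definition X2 : vfield R := fun p =>
  dd_q + cos (3 * x_ p) *: E1 p - (3 * sin (3 * x_ p)) *: E3 p.

Definition D_R : dist R := fun p => [set v | v \in <<[:: X1 p; X2 p]>>%VS].

Definition o4 : form1 R := fun=> - d_x.
Definition o5 : form1 R := fun p => cos (3 * x_ p) *: d_q.
Definition ot1 : form1 R := fun p => sigma1 p + cos (3 * x_ p) *: d_q.
Definition ot2 : form1 R := fun p => sigma2 p + d_x.
Definition ot3 : form1 R := fun p => sigma3 p + (3 * sin (3 * x_ p)) *: d_q.

Definition Dtilde_R : dist R := fun p =>
  [set v | [/\ pairing (ot1 p) v = 0, pairing (ot2 p) v = 0
             & pairing (ot3 p) v = 0]].

Definition g_R : metric R := fun p =>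
  - 2 *: (sprod (o4 p) (o4 p) + sprod (o5 p) (o5 p))
  + 2^-1 *: sprod (ot1 p) (ot1 p) + 2^-1 *: sprod (ot2 p) (ot2 p)
  - 6^-1 *: sprod (ot3 p) (ot3 p).

Definition f_roll (t : R) : R := - sin t.
Definition h_roll (x : R) : R := cos (3 * x).

Definition chi1 : form1 R := fun=> d_theta.
Definition chi2 : form1 R := fun p => f_roll (theta_ p) *: d_phi.
Definition chi3 : form1 R := fun=> d_x.
Definition chi4 : form1 R := fun p => h_roll (x_ p) *: d_q.

Definition omega1 : form1 R := fun p =>
  chi1 p - cos (psi_ p) *: chi3 p - sin (psi_ p) *: chi4 p.
Definition omega2 : form1 R := fun p =>
  chi2 p + sin (psi_ p) *: chi3 p - cos (psi_ p) *: chi4 p.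
Definition omega3 : form1 R := fun p =>
  d_psi + (derive1 h_roll (x_ p) / h_roll (x_ p)) *: chi4 p
  - (derive1 f_roll (theta_ p) / f_roll (theta_ p)) *: chi2 p.

Definition g_roll : metric R := fun p =>
  sprod (chi1 p) (chi1 p) + sprod (chi2 p) (chi2 p)
  - (sprod (chi3 p) (chi3 p) + sprod (chi4 p) (chi4 p))
  - 2^-1 *: (sprod (omega1 p) (omega1 p) + sprod (omega2 p) (omega2 p))
  - 6^-1 *: sprod (omega3 p) (omega3 p).

End Rolling.

(* Main.v *)
(** Write A = exp(phi k / 2) exp(theta j / 2) exp(psi k / 2) and
    B = exp(3 q i / 2) exp(3 x j / 2) for unit quaternions. Their left-invariant
    forms alpha = A^-1 dA and beta = B^-1 dB satisfy 2 alpha = (sigma1, sigma2, - sigma3)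
    and 2 beta = (3 cos(3x) dq, 3 dx, 3 sin(3x) dq), so that D_R is the rolling
    distribution beta1 = 3 alpha1, beta2 = 3 alpha2, beta3 = alpha3. The map
    (A k A^-1, B A^-1) takes values in the cone of null vectors of the norm
    |a|^2 - |b|^2 on imaginary split octonions. In the affine chart (u, w, p, t, v)
    of the projectivised cone, g_R becomes proportional to the constant metric
    - dp^2 - dt dw + du dv, and D_R becomes the distribution spanned by
    Z1 = d_u - w d_p + (p + u w) d_t + w^2 d_v and
    Z2 = d_w + u d_p - u^2 d_t + (p - u w) d_v, for which Cartan's structure
    equations hold with all Omega_i = 0.

    A derivation of the split octonions acts on the projectivised cone by a symmetry.
    Conversely a symmetry X is determined by its components f and g along
    Z4 = [Z1, [Z1, Z2]] and Z5 = [Z2, [Z1, Z2]], which satisfy Z2 f = 0, Z1 g = 0 and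
    Z1 f = Z2 g. The Serre relations of the nilpotent algebra generated by Z1 and Z2
    close this system at finite order: on a box its solutions depend on 14 constants,
    and these are the coefficients of a derivation. *)

(* The ratio 3 enters through one computation. Put a = A k A^-1, b = B A^-1 and xi = A (l1 i + l2 j)
   A^-1 with l = 2 alpha. Always da = xi a, while db = b xi holds exactly when beta1 = 3 alpha1,
   beta2 = 3 alpha2, beta3 = alpha3. Modulo (a, b) itself, the vectors (xi a, b xi) are the tangent
   vectors that multiply to zero with the null octonion (a, b), so D_R is described by octonion
   multiplication alone, which every derivation preserves. Conformal flatness has its own source:
   rescaling a null vector multiplies the induced quadratic form by a square, and on the section r =
   1 of the cone that form has constant coefficients. Completing squares in |da|^2 - |db|^2 produces
   the sign-reversed forms in g_R. The chart exists only where r does not vanish, so B is adjusted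
   near each point by a constant left factor. Everything after that takes place on a small box and
   uses only the Jacobian, the three contact equations and the conformal factor. That the Jacobian
   is invertible is read off from the invertibility of g_R. *)
Require Import Defs.
From HB Require Import structures.
From mathcomp Require Import all_boot all_order all_algebra.
From mathcomp Require Import all_classical all_reals all_analysis.
From mathcomp Require Import ring lra.

Set Implicit Arguments.
Unset Strict Implicit.
Unset Printing Implicit Defensive.

Import Order.TTheory GRing.Theory Num.Theory.
Import numFieldNormedType.Exports.

Local Open Scope classical_set_scope.
Local Open Scope ring_scope.

(** * Smooth functions *)

Section SmoothFunctions.
Variable R : realType.
Implicit Types (U : set 'rV[R]_5) (f g : 'rV[R]_5 -> R) (p q : 'rV[R]_5).
Local Notation basis i := (delta_mx 0 i : 'rV[R]_5).

Definition regular_at f p :=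
  {for p, continuous f} /\ forall i, derivable f p (basis i).

Lemma open_near U p (P : 'rV[R]_5 -> Prop) :
  open U -> U p -> (forall q, U q -> P q) -> \forall q \near p, P q.
Proof. by move=> oU Up UP; apply: (filterS UP); exact: open_nbhs_nbhs. Qed.

Lemma eq_on_pder U f g i : open U -> (forall q, U q -> f q = g q) ->
  forall q, U q -> pder i f q = pder i g q.
Proof.
move=> oU fg q Uq; apply: near_eq_derive.
exact: (@open_near U q (fun q => f q = g q)).
Qed.

Lemma eq_on_regular U f g p : open U -> (forall q, U q -> f q = g q) ->
  U p -> regular_at f p -> regular_at g p.
Proof.
move=> oU fg Up [cf df].
have nfg : \forall q \near p, f q = g q by exact: (@open_near U).
split=> [|i]; last exact: (near_eq_derivable nfg (df i)).
rewrite /prop_for /continuous_at -(fg p Up).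
by apply: (cvg_trans _ cf) => P; apply: filterS2 nfg => x /= ->.
Qed.

Lemma eq_on_iter_pder U f g s : open U -> (forall q, U q -> f q = g q) ->
  forall q, U q -> iter_pder s f q = iter_pder s g q.
Proof. by move=> oU fg; elim: s => //= i s; apply: eq_on_pder. Qed.

(** Smoothness concerns all iterated derivatives at once, so it is proved for a whole class of
    functions that is regular and stable under partial derivatives. The list of indices is taken
    apart at its right end, whose derivative [foldr] applies first. *)
Lemma smooth_coind U (P : ('rV[R]_5 -> R) -> Prop) : open U ->
  (forall f p, P f -> U p -> regular_at f p) ->
  (forall f i, P f ->
     exists2 g, P g & forall p, U p -> pder i f p = g p) ->
  forall f, P f -> smooth_on U f.
Proof.
move=> oU Preg Pder f Pf s; elim/last_ind: s f Pf => [|s i IHs] f Pf p Up.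
  exact: Preg.
have [g Pg fg] := Pder f i Pf; rewrite /iter_pder foldr_rcons.
apply: (@eq_on_regular U (iter_pder s g)) => // [q Uq|]; last exact: IHs.
by apply/esym/(eq_on_iter_pder s oU fg).
Qed.

Lemma pderE i f p : pder i f p = 'D_(basis i) f p. Proof. by []. Qed.

Lemma smooth_regular U f p : smooth_on U f -> U p -> regular_at f p.
Proof. by move=> sf; apply: (sf [::]). Qed.

Lemma smooth_derivable U f p i : smooth_on U f -> U p -> derivable f p (basis i).
Proof. by move=> sf /(smooth_regular sf) []. Qed.

Lemma smooth_pder U f i : smooth_on U f -> smooth_on U (pder i f).
Proof. by move=> sf s p Up; have := sf (rcons s i) p Up; rewrite /iter_pder foldr_rcons. Qed.

Lemma smooth_eq_on U f g : open U -> (forall q, U q -> f q = g q) ->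
  smooth_on U f -> smooth_on U g.
Proof.
move=> oU fg sf s p Up; apply: (eq_on_regular oU _ Up (sf s p Up)).
exact: eq_on_iter_pder.
Qed.

Lemma smooth_subset U W f : W `<=` U -> smooth_on U f -> smooth_on W f.
Proof. by move=> WU sf s p /WU; apply: sf. Qed.

(** On a line parallel to an axis the function is [h] composed with an affine map. The factor [c]
    covers the angles 3 x and theta / 2 that occur later. *)
Lemma is_derive_coord (h h' : R -> R) (c : R) (i j : 'I_5) p :
  (forall x : R, is_derive x 1 h (h' x)) ->
  is_derive p (basis i) (fun q => h (c * q 0 j)) ((i == j)%:R * c * h' (c * p 0 j)).
Proof.
move=> dh.
have E : (fun t : R => h (c * (t *: basis i + p) 0 j)) =
         h \o (fun t => c * (i == j)%:R * t + c * p 0 j).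
  by apply/funext => t /=; rewrite !mxE eq_sym eqxx/=; congr h; ring.
have D : is_derive (0 : R) 1 (fun t : R => h (c * (t *: basis i + p) 0 j))
          ((i == j)%:R * c * h' (c * p 0 j)).
  rewrite E; set l := (X in h \o X).
  have dl : is_derive (0 : R) 1 l (c * (i == j)%:R).
    rewrite /l (_ : (fun _ => _) = (c * (i == j)%:R) *: id + cst (c * p 0 j)) //.
    by apply: is_derive_eq; rewrite addr0 /GRing.scale /= mulr1.
  have l0 : l 0 = c * p 0 j by rewrite /l mulr0 add0r.
  have dh0 : is_derive (l 0) 1 h (h' (c * p 0 j)) by rewrite l0.
  apply: is_derive_eq; rewrite /GRing.scale/=; ring.
have [D1 D2] := D.
have D1' : derivable (fun q => h (c * q 0 j)) p (basis i) by exact/derivable1P.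
split => //; rewrite -D2 /derive.
set F := (X in lim (X @ _)); set G := (X in _ = lim (X @ _)).
suff -> : F = G by [].
by apply/funext => t; rewrite /F /G /shift /= addr0 scale0r add0r [_%:A]mulr1.
Qed.

Lemma continuous_coord (h : R -> R) (c : R) (j : 'I_5) p :
  continuous h -> {for p, continuous (fun q : 'rV[R]_5 => h (c * q 0 j))}.
Proof.
move=> ch.
apply: (@continuous_comp _ _ _ (fun q : 'rV[R]_5 => c * q 0 j) h); last exact: ch.
apply: (@continuous_comp _ _ _ (fun q : 'rV[R]_5 => q 0 j) ( *%R c)).
  exact: coord_continuous.
exact: mulrl_continuous.
Qed.

Opaque smooth_on pder.

(* Closing the smooth functions syntactically under the operations makes this
   class stable under partial derivatives, so that [smooth_coind] applies. *)
Inductive elementary U : ('rV[R]_5 -> R) -> Prop :=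
| elem_smooth f of smooth_on U f : elementary U f
| elem_cst c : elementary U (fun=> c)
| elem_add f g of elementary U f & elementary U g : elementary U (f + g)
| elem_mul f g of elementary U f & elementary U g : elementary U (f * g)
| elem_inv f of elementary U f & (forall q, U q -> f q != 0) :
    elementary U (fun q => (f q)^-1)
| elem_coord j : elementary U (fun q => q 0 j)
| elem_sin c j : elementary U (fun q => sin (c * q 0 j))
| elem_cos c j : elementary U (fun q => cos (c * q 0 j)).

Lemma elementary_regular U f p : elementary U f -> U p -> regular_at f p.
Proof.
move=> ef Up; elim: ef => {f} [f sf|c|f g _ [cf df] _ [cg dg]
  |f g _ [cf df] _ [cg dg]|f _ [cf df] f0|j|c j|c j].
- exact: smooth_regular sf Up.
- by split=> [|i]; [exact: cst_continuous|exact: derivable_cst].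
- by split=> [|i]; [exact: continuousD|exact: derivableD].
- by split=> [|i]; [exact: continuousM|exact: derivableM].
- by split=> [|i]; [apply: continuousV|apply: derivableV]; rewrite ?f0.
- split=> [|i]; first exact: coord_continuous.
  exact/diff_derivable/differentiable_coord.
- split=> [|i]; first by apply: continuous_coord => x; exact: continuous_sin.
  by apply: (@ex_derive _ _ _ _ _ _ _ (is_derive_coord c i j p (@is_derive_sin R))).
- split=> [|i]; first by apply: continuous_coord => x; exact: continuous_cos.
  by apply: (@ex_derive _ _ _ _ _ _ _ (is_derive_coord c i j p (@is_derive_cos R))).
Qed.

Lemma pder_cst i (c : R) p : pder i (fun=> c) p = 0.
Proof. by rewrite pderE derive_cst. Qed.

Lemma pder_coord i j p : pder i (fun q : 'rV[R]_5 => q 0 j) p = (i == j)%:R.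
Proof.
have [_] := @is_derive_coord id (fun=> 1) 1 i j p (fun x => is_derive_id x 1).
have -> : (fun q : 'rV[R]_5 => id (1 * q 0 j)) = (fun q => q 0 j).
  by apply/funext => q; rewrite mul1r.
by rewrite -pderE => ->; rewrite !mulr1.
Qed.

Lemma pder_sin i j c p :
  pder i (fun q => sin (c * q 0 j)) p = (i == j)%:R * c * cos (c * p 0 j).
Proof. by have [_ <-] := is_derive_coord c i j p (@is_derive_sin R); rewrite pderE. Qed.

Lemma pder_cos i j c p :
  pder i (fun q => cos (c * q 0 j)) p = - ((i == j)%:R * c * sin (c * p 0 j)).
Proof.
have [_ E] := is_derive_coord c i j p (@is_derive_cos R).
by rewrite pderE E mulrN.
Qed.

Lemma elementary_pder U f i : open U -> elementary U f ->
  exists2 g, elementary U g & forall p, U p -> pder i f p = g p.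
Proof.
move=> oU; elim => {f} [f sf|c|f g ef [f' ef' ff'] eg [g' eg' gg']
  |f g ef [f' ef' ff'] eg [g' eg' gg']|f ef [f' ef' ff'] f0|j|c j|c j].
- by exists (pder i f) => //; apply/elem_smooth/smooth_pder.
- by exists (fun=> 0) => [|p _]; [exact: elem_cst|rewrite pder_cst].
- exists (f' + g') => [|p Up]; first exact: elem_add.
  have [_ df] := elementary_regular ef Up; have [_ dg] := elementary_regular eg Up.
  by rewrite pderE deriveD // -!pderE ff' // gg'.
- exists (f * g' + g * f') => [|p Up].
    by apply: elem_add; apply: elem_mul.
  have [_ df] := elementary_regular ef Up; have [_ dg] := elementary_regular eg Up.
  by rewrite pderE deriveM // -!pderE ff' // gg'.
- exists ((fun=> -1) * ((fun q => (f q)^-1) * (fun q => (f q)^-1)) * f').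
    by do !apply: elem_mul => //; [exact: elem_cst|exact: elem_inv|exact: elem_inv].
  move=> p Up; have [_ df] := elementary_regular ef Up.
  rewrite pderE deriveV ?f0 // -!pderE ff' // !fctE /GRing.scale /=.
  by rewrite expr2 invfM; ring.
- by exists (fun=> (i == j)%:R) => [|p _]; [exact: elem_cst|rewrite pder_coord].
- exists ((fun=> (i == j)%:R * c) * (fun q => cos (c * q 0 j))) => [|p _].
    by apply: elem_mul; [exact: elem_cst|exact: elem_cos].
  by rewrite pder_sin.
- exists ((fun=> - ((i == j)%:R * c)) * (fun q => sin (c * q 0 j))) => [|p _].
    by apply: elem_mul; [exact: elem_cst|exact: elem_sin].
  by rewrite pder_cos !fctE mulNr.
Qed.

Lemma elementary_smooth U f : open U -> elementary U f -> smooth_on U f.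
Proof.
move=> oU; apply: smooth_coind => // [g p|g i].
- exact: elementary_regular.
- exact: elementary_pder.
Qed.

Section Closure.
Variables (U : set 'rV[R]_5) (oU : open U).

Lemma smooth_cst c : smooth_on U (fun=> c).
Proof. exact/elementary_smooth/elem_cst. Qed.
Lemma smoothD f g : smooth_on U f -> smooth_on U g -> smooth_on U (fun q => f q + g q).
Proof. by move=> sf sg; apply/elementary_smooth => //; apply: elem_add; exact: elem_smooth. Qed.
Lemma smoothM f g : smooth_on U f -> smooth_on U g -> smooth_on U (fun q => f q * g q).
Proof. by move=> sf sg; apply/elementary_smooth => //; apply: elem_mul; exact: elem_smooth. Qed.
Lemma smoothN f : smooth_on U f -> smooth_on U (fun q => - f q).
Proof.
move=> sf; apply: (smooth_eq_on oU _ (smoothM (smooth_cst (-1)) sf)) => q _.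
by rewrite mulN1r.
Qed.
Lemma smoothB f g : smooth_on U f -> smooth_on U g -> smooth_on U (fun q => f q - g q).
Proof. by move=> sf sg; exact: (smoothD sf (smoothN sg)). Qed.
Lemma smoothX f n : smooth_on U f -> smooth_on U (fun q => f q ^+ n).
Proof.
move=> sf; elim: n => [|n IHn]; first exact: smooth_cst.
by apply: (smooth_eq_on oU _ (smoothM sf IHn)) => q _; rewrite exprS.
Qed.
Lemma smoothV f : smooth_on U f -> (forall q, U q -> f q != 0) ->
  smooth_on U (fun q => (f q)^-1).
Proof.
by move=> sf f0; apply/elementary_smooth => //; apply: elem_inv => //; exact: elem_smooth.
Qed.
Lemma smooth_sin c j : smooth_on U (fun q => sin (c * q 0 j)).
Proof. exact/elementary_smooth/elem_sin. Qed.
Lemma smooth_cos c j : smooth_on U (fun q => cos (c * q 0 j)).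
Proof. exact/elementary_smooth/elem_cos. Qed.
Lemma smooth_sum (I : Type) (r : seq I) (P : pred I) (F : I -> 'rV[R]_5 -> R) :
  (forall k, smooth_on U (F k)) -> smooth_on U (fun q => \sum_(k <- r | P k) F k q).
Proof.
move=> sF; elim: r => [|k r IHr].
  by apply: (smooth_eq_on oU _ (smooth_cst 0)) => q _; rewrite big_nil.
case Pk: (P k); last by apply: (smooth_eq_on oU _ IHr) => q _; rewrite big_cons Pk.
by apply: (smooth_eq_on oU _ (smoothD (sF k) IHr)) => q _; rewrite big_cons Pk.
Qed.
Lemma smooth_prod (I : Type) (r : seq I) (P : pred I) (F : I -> 'rV[R]_5 -> R) :
  (forall k, smooth_on U (F k)) -> smooth_on U (fun q => \prod_(k <- r | P k) F k q).
Proof.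
move=> sF; elim: r => [|k r IHr].
  by apply: (smooth_eq_on oU _ (smooth_cst 1)) => q _; rewrite big_nil.
case Pk: (P k); last by apply: (smooth_eq_on oU _ IHr) => q _; rewrite big_cons Pk.
by apply: (smooth_eq_on oU _ (smoothM (sF k) IHr)) => q _; rewrite big_cons Pk.
Qed.

Lemma pderD i f g p : smooth_on U f -> smooth_on U g -> U p ->
  pder i (fun q => f q + g q) p = pder i f p + pder i g p.
Proof. by move=> sf sg Up; rewrite !pderE; apply: deriveD; [exact: smooth_derivable sf Up|exact: smooth_derivable sg Up]. Qed.
Lemma pderM i f g p : smooth_on U f -> smooth_on U g -> U p ->
  pder i (fun q => f q * g q) p = f p * pder i g p + g p * pder i f p.
Proof. by move=> sf sg Up; rewrite !pderE; apply: deriveM; [exact: smooth_derivable sf Up|exact: smooth_derivable sg Up]. Qed.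

Lemma pder_sum i (I : Type) (r : seq I) (F : I -> 'rV[R]_5 -> R) p :
  (forall k, smooth_on U (F k)) -> U p ->
  pder i (fun q => \sum_(k <- r) F k q) p = \sum_(k <- r) pder i (F k) p.
Proof.
move=> sF Up; elim: r => [|k r IHr].
  rewrite (@eq_on_pder U _ (fun=> 0)) ?pder_cst ?big_nil // => q _.
  by rewrite big_nil.
rewrite big_cons -IHr -pderD //; last exact: smooth_sum.
by apply: (@eq_on_pder U) => // q _; rewrite big_cons.
Qed.

End Closure.

(** Cramer's rule: determinant and cofactors are polynomials in the entries, and the determinant has
    no zero on [U]. *)
Lemma smooth_invmx n U (A : 'rV[R]_5 -> 'M[R]_n) : open U ->
  (forall i j, smooth_on U (fun q => A q i j)) ->
  (forall q, U q -> A q \in unitmx) ->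
  forall i j, smooth_on U (fun q => invmx (A q) i j).
Proof.
move=> oU sA uA.
have sdet m (B : 'rV[R]_5 -> 'M[R]_m) : (forall i j, smooth_on U (fun q => B q i j)) ->
    smooth_on U (fun q => \det (B q)).
  move=> sB; apply: smooth_sum => // s; apply: smoothM => //; first exact: smooth_cst.
  by apply: smooth_prod => // i; exact: sB.
move=> i j.
have sadj : smooth_on U (fun q => (\adj (A q)) i j).
  case: n A sA uA i j => [|n] A sA uA i j; first by case: i.
  apply: (smooth_eq_on oU (f := fun q => cofactor (A q) j i)).
    by move=> q _; rewrite !mxE.
  apply: smoothM => //; first exact: smooth_cst.
  by apply: sdet => k l; apply: (smooth_eq_on oU _ (sA (lift j k) (lift i l))) => q _; rewrite !mxE.
have sd : smooth_on U (fun q => (\det (A q))^-1).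
  apply: (smoothV oU (sdet _ _ sA)) => q Uq.
  by rewrite -unitfE -unitmxE uA.
apply: (smooth_eq_on oU _ (smoothM oU sd sadj)) => q Uq.
by rewrite /invmx uA // !mxE.
Qed.

End SmoothFunctions.

(** * Constancy on boxes and symmetry of second derivatives *)

Section SecondDerivatives.
Variable R : realType.
Implicit Types (U : set 'rV[R]_5) (f g : 'rV[R]_5 -> R) (p q : 'rV[R]_5).
Local Notation basis i := (delta_mx 0 i : 'rV[R]_5).

Lemma boxP p e q : ball p e q <-> 0 < e /\ forall j, `|q 0 j - p 0 j| < e.
Proof.
split=> -[e0 H]; split=> //.
- by move=> j; rewrite distrC; exact: H.
- by move=> i j; rewrite ord1 /ball /= distrC; exact: H.
Qed.

Lemma open_box U p : open U -> U p ->
  exists2 e : R, 0 < e & forall q, (forall j, `|q 0 j - p 0 j| < e) -> U q.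
Proof.
move=> oU Up; have /nbhs_ballP[e /= e0 eU] : nbhs p U by exact: open_nbhs_nbhs.
by exists e => // q qe; apply: eU; apply/boxP.
Qed.

Lemma is_derive_line f p i (s : R) : derivable f (s *: basis i + p) (basis i) ->
  is_derive s 1 (fun t : R => f (t *: basis i + p)) (pder i f (s *: basis i + p)).
Proof.
move=> df.
have E : (fun h : R => h^-1 *: (((fun t : R => f (t *: basis i + p)) \o shift s) (h *: 1)
            - f (s *: basis i + p))) =
         (fun h : R => h^-1 *: ((f \o shift (s *: basis i + p)) (h *: basis i)
            - f (s *: basis i + p))).
  apply/funext => h; rewrite /shift /=; congr (_ *: (f _ - _)).
  by rewrite [h%:A]mulr1 scalerDl addrA.
by split; [rewrite /derivable E|rewrite /derive E].
Qed.

Lemma MVT_closed (g g' : R -> R) (h : R) : 0 < h ->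
  (forall s : R, 0 <= s <= h -> is_derive s 1 g (g' s)) ->
  exists2 s, 0 < s < h & g h - g 0 = g' s * h.
Proof.
move=> h0 dg.
have dl (s : R) : s \in `[0, h] -> is_derive s 1 g (g' s).
  by rewrite in_itv /= => sh; exact: dg.
have dl' (s : R) : s \in `]0, h[ -> is_derive s 1 g (g' s).
  by move=> /subset_itv_oo_cc; exact: dl.
have cg : {within `[0, h], continuous g}.
  apply: derivable_within_continuous => x xh.
  by apply: (@ex_derive _ _ _ _ _ _ _ (dl x xh)).
have [s sh E] := MVT h0 dl' cg.
by exists s; [rewrite in_itv in sh|rewrite E subr0].
Qed.

Lemma line_MVT f p i (h : R) : 0 < h ->
  (forall s, 0 <= s <= h -> derivable f (s *: basis i + p) (basis i)) ->
  exists2 s, 0 < s < h & f (h *: basis i + p) - f p = pder i f (s *: basis i + p) * h.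
Proof.
move=> h0 df.
have := @MVT_closed (fun t => f (t *: basis i + p)) (fun t => pder i f (t *: basis i + p)) h h0.
case=> [s sh|s sh E]; first exact/is_derive_line/df.
by exists s; rewrite // -E scale0r add0r.
Qed.

(** The mean value theorem applies along segments parallel to the axes. Changing the coordinates one
    at a time leads from [p] to [q] without leaving the box, which is why symmetries are later
    integrated on boxes. *)
Lemma box_const f p (e : R) :
  (forall q, (forall j, `|q 0 j - p 0 j| < e) ->
     forall i, derivable f q (basis i) /\ pder i f q = 0) ->
  forall q : 'rV[R]_5, (forall j, `|q 0 j - p 0 j| < e) -> f q = f p.
Proof.
move=> df.
have step i (h : R) q : 0 <= h -> (forall j, `|q 0 j - p 0 j| < e) ->
    (forall j, `|(h *: basis i + q) 0 j - p 0 j| < e) -> f (h *: basis i + q) = f q.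
  rewrite le_eqVlt => /predU1P[<-|h0] qe q'e; first by rewrite scale0r add0r.
  have box s : 0 <= s <= h -> forall j, `|(s *: basis i + q) 0 j - p 0 j| < e.
    move=> /andP[s0 sh] j; have := q'e j; have := qe j; rewrite !mxE eqxx /=.
    case: (j == i) => /=; rewrite ?mulr0 ?mulr1 ?add0r // !ltr_norml => /andP[a b] /andP[c d].
    by apply/andP; split; lra.
  have [s /andP[s0 sh]] := line_MVT h0 (fun s sh => (df _ (box s sh) i).1).
  have s0h : 0 <= s <= h by rewrite !ltW.
  by rewrite (df _ (box s s0h) i).2 mul0r => /eqP; rewrite subr_eq0 => /eqP.
(* A negative increment is the positive case read from the other endpoint. *)
have set1 i (c : R) q : (forall j, `|q 0 j - p 0 j| < e) ->
    (forall j, `|(c *: basis i + q) 0 j - p 0 j| < e) -> f (c *: basis i + q) = f q.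
  move=> qe q'e; have [c0|c0] := lerP 0 c; first exact: step.
  have E : q = - c *: basis i + (c *: basis i + q) by rewrite scaleNr addKr.
  rewrite [in RHS]E; apply/esym/step; [by rewrite oppr_ge0 ltW|exact: q'e|].
  by rewrite -E.
move=> q qe.
pose path (n : nat) := \row_j (if (j < n)%N then q 0 j else p 0 j) : 'rV[R]_5.
have e0 : 0 < e by apply: le_lt_trans (qe 0); exact: normr_ge0.
have pathe n j : `|path n 0 j - p 0 j| < e.
  by rewrite mxE; case: ifP => // _; rewrite subrr normr0.
have -> : q = path 5 by apply/rowP => j; rewrite mxE ltn_ord.
have -> : f p = f (path 0) by congr f; apply/rowP => j; rewrite mxE.
suff H n : (n <= 5)%N -> f (path n) = f (path 0) by exact: H.
elim: n => // n IHn n5.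
rewrite -(IHn (ltnW n5)).
have E : path n.+1 = (q 0 (Ordinal n5) - p 0 (Ordinal n5)) *: basis (Ordinal n5) + path n.
  apply/rowP => j; rewrite !mxE eqxx /= ltnS leq_eqVlt -val_eqE /=.
  case: eqP => [jn|_] /=; last by rewrite mulr0 add0r.
  have -> : j = Ordinal n5 by exact: val_inj.
  by rewrite ltnn mulr1 subrK.
by rewrite E set1 // => j; rewrite -E.
Qed.

(** The mean value theorem is applied twice, first in direction [i] and then in direction [j]. The
    box of size 3 h leaves room for [i = j], where both increments fall on the same coordinate. *)
Lemma second_difference U f p i j (h : R) : open U -> smooth_on U f -> 0 < h ->
  (forall q : 'rV[R]_5, (forall k, `|q 0 k - p 0 k| < 3 * h) -> U q) ->
  exists2 q : 'rV[R]_5, (forall k, `|q 0 k - p 0 k| < 3 * h) &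
    f (h *: basis j + (h *: basis i + p)) - f (h *: basis i + p)
      - f (h *: basis j + p) + f p = pder j (pder i f) q * h ^+ 2.
Proof.
move=> oU sf h0 hU.
have box (s t : R) : 0 <= s <= h -> 0 <= t <= h ->
    forall k, `|(t *: basis j + (s *: basis i + p)) 0 k - p 0 k| < 3 * h.
  move=> /andP[s0 sh] /andP[t0 th] k; rewrite !mxE eqxx /=.
  by case: (k == j); case: (k == i); rewrite /= ?mulr0 ?mulr1 ltr_norml; apply/andP; split; lra.
have h00 : 0 <= (0 : R) <= h by rewrite lexx ltW.
have hh : 0 <= h <= h by rewrite lexx ltW.
pose g q := f (h *: basis j + q) + - f q.
have Us s : 0 <= s <= h -> U (s *: basis i + p).
  move=> sh; apply: hU => k; have := box s 0 sh h00 k; by rewrite scale0r add0r.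
have dg s : 0 <= s <= h -> is_derive (s *: basis i + p) (basis i) g
    (pder i f (h *: basis j + (s *: basis i + p)) - pder i f (s *: basis i + p)).
  move=> sh.
  have d1 := smooth_derivable sf (hU _ (box s h sh hh)).
  have d2 := smooth_derivable sf (Us _ sh).
  have d1' : is_derive (s *: basis i + p) (basis i) (fun q => f (h *: basis j + q))
      (pder i f (h *: basis j + (s *: basis i + p))).
    have E : (fun t : R => t^-1 *: (((fun q => f (h *: basis j + q)) \o shift (s *: basis i + p))
        (t *: basis i) - f (h *: basis j + (s *: basis i + p)))) =
      (fun t : R => t^-1 *: ((f \o shift (h *: basis j + (s *: basis i + p))) (t *: basis i)
        - f (h *: basis j + (s *: basis i + p)))).
      by apply/funext => t; rewrite /shift /=; congr (_ *: (f _ - _)); rewrite addrCA.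
    by split; [rewrite /derivable E; exact: d1|rewrite /derive E].
  have d2' : is_derive (s *: basis i + p) (basis i) f (pder i f (s *: basis i + p)).
    by apply: derivableP; exact: d2.
  exact: (is_deriveB d1' d2').
have [s /andP[s0 sh] E] := line_MVT h0 (fun s sh => @ex_derive _ _ _ _ _ _ _ (dg s sh)).
have s0h : 0 <= s <= h by rewrite !ltW.
rewrite /pder (@derive_val _ _ _ _ _ _ _ (dg s s0h)) in E.
have [t /andP[t0 th] E'] := line_MVT (f := pder i f) (p := s *: basis i + p) (i := j) h0
  (fun t th => smooth_derivable (smooth_pder i sf) (hU _ (box s t s0h th)) (i := j)).
exists (t *: basis j + (s *: basis i + p)).
  by apply: box => //; rewrite !ltW.
rewrite E' in E; rewrite expr2 mulrA -E /g; ring.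
Qed.

Lemma continuous_box f p (d : R) : {for p, continuous f} -> 0 < d ->
  exists2 e : R, 0 < e & forall q : 'rV[R]_5, (forall k, `|q 0 k - p 0 k| < e) -> `|f q - f p| < d.
Proof.
move=> /cvgrPdist_lt cf d0; have /nbhs_ballP[e /= e0 ed] := cf d d0.
by exists e => // q qe; rewrite distrC; apply: ed; apply/boxP.
Qed.

Lemma dist_le_halves (a b c d : R) :
  `|a - c| < d / 2 -> `|a - b| < d / 2 -> `|b - c| <= d.
Proof.
rewrite !ltr_norml ler_norml => /andP[? ?] /andP[? ?].
by apply/andP; split; lra.
Qed.

(** The second difference is symmetric in the two directions, so the two mixed derivatives take a
    common value at two points close to [p]. Continuity of both carries the equality to [p]. *)
Lemma pder_comm U f i j p : open U -> smooth_on U f -> U p ->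
  pder i (pder j f) p = pder j (pder i f) p.
Proof.
move=> oU sf Up; apply/eqP; rewrite -subr_eq0 -normr_le0; apply/ler_addgt0Pl => d d0.
rewrite addr0.
have d2 : 0 < d / 2 by lra.
have [eU eU0 HU] := open_box oU Up.
have cont k l : {for p, continuous (pder k (pder l f))}.
  by have [] := smooth_regular (smooth_pder k (smooth_pder l sf)) Up.
have [e1 e10 H1] := continuous_box (cont i j) d2.
have [e2 e20 H2] := continuous_box (cont j i) d2.
pose h := Num.min eU (Num.min e1 e2) / 3.
have h0 : 0 < h by rewrite divr_gt0 // !lt_min eU0 e10 e20.
have h3 : 3 * h = Num.min eU (Num.min e1 e2) by rewrite mulrC divfK.
have hU (q : 'rV[R]_5) : (forall k, `|q 0 k - p 0 k| < 3 * h) -> U q.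
  by move=> H; apply: HU => k; have := H k; rewrite h3 !lt_min => /andP[].
have [q1 B1 E1] := second_difference i j oU sf h0 hU.
have [q2 B2 E2] := second_difference j i oU sf h0 hU.
have E : pder j (pder i f) q1 = pder i (pder j f) q2.
  apply: (@mulIf _ (h ^+ 2)); first by rewrite expf_neq0 // gt_eqF.
  apply: (etrans (esym E1)); apply: (etrans _ E2).
  by rewrite (addrCA (h *: basis j) (h *: basis i) p); congr +%R; exact: addrAC.
have K1 : `|pder j (pder i f) q1 - pder j (pder i f) p| < d / 2.
  by apply: H2 => k; have := B1 k; rewrite h3 !lt_min => /and3P[].
have K2 : `|pder i (pder j f) q2 - pder i (pder j f) p| < d / 2.
  by apply: H1 => k; have := B2 k; rewrite h3 !lt_min => /and3P[].
by rewrite E in K1; exact: dist_le_halves K1 K2.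
Qed.

End SecondDerivatives.

(** * Vector fields and charts *)

Opaque smooth_on pder.

Section VectorFields.
Variable R : realType.
Implicit Types (f g : 'rV[R]_5 -> R) (p q w : 'rV[R]_5) (X Y : vfield R).

Definition grad f p : 'cV[R]_5 := \col_i pder i f p.
Definition vder X f p : R := pairing (grad f p) (X p).

Lemma pairingE (a : 'cV[R]_5) w : pairing a w = \sum_i w 0 i * a i 0.
Proof. by rewrite /pairing mxE. Qed.

Lemma pairingD a b w : pairing (a + b) w = pairing a w + pairing b w.
Proof. by rewrite /pairing mulmxDr mxE. Qed.
Lemma pairingN a w : pairing (- a) w = - pairing a w.
Proof. by rewrite /pairing mulmxN mxE. Qed.
Lemma pairingZ c a w : pairing (c *: a) w = c * pairing a w.
Proof. by rewrite /pairing -scalemxAr mxE. Qed.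
Lemma pairingDr a v w : pairing a (v + w) = pairing a v + pairing a w.
Proof. by rewrite /pairing mulmxDl mxE. Qed.
Lemma pairingZr a c w : pairing a (c *: w) = c * pairing a w.
Proof. by rewrite /pairing -scalemxAl mxE. Qed.
Lemma pairing_sumr a (I : Type) (r : seq I) (F : I -> 'rV[R]_5) :
  pairing a (\sum_(k <- r) F k) = \sum_(k <- r) pairing a (F k).
Proof. by rewrite /pairing mulmx_suml summxE. Qed.
Lemma vder_pair X f p : vder X f p = pairing (grad f p) (X p). Proof. by []. Qed.

Lemma vderE X f p : vder X f p = \sum_i X p 0 i * pder i f p.
Proof. by rewrite /vder pairingE; apply: eq_bigr => i _; rewrite mxE. Qed.

Section OnOpen.
Variables (U : set 'rV[R]_5) (oU : open U).

Lemma eq_on_vder X f g : (forall q, U q -> f q = g q) ->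
  forall q, U q -> vder X f q = vder X g q.
Proof.
move=> fg q Uq; rewrite !vderE; apply: eq_bigr => i _.
by rewrite (eq_on_pder i oU fg Uq).
Qed.

Lemma smooth_vder X f : smooth_vfield U X -> smooth_on U f ->
  smooth_on U (fun q => vder X f q).
Proof.
move=> sX sf; apply: (smooth_eq_on oU
  (f := fun q => \sum_i X q 0 i * pder i f q)) => [q _|]; first by rewrite vderE.
by apply: (smooth_sum oU) => i; exact: (smoothM oU (sX i) (smooth_pder i sf)).
Qed.

(** The second-order terms cancel because partial derivatives commute; the first-order terms are
    those in the definition of [lie]. *)
Lemma vder_lie X Y f p : smooth_vfield U X -> smooth_vfield U Y -> smooth_on U f ->
  U p -> vder (lie X Y) f p = vder X (vder Y f) p - vder Y (vder X f) p.
Proof.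
move=> sX sY sf Up.
have dd (A B : vfield R) : smooth_vfield U A -> smooth_vfield U B ->
    vder A (vder B f) p = \sum_i \sum_j
      (A p 0 i * pder i (fun q => B q 0 j) p * pder j f p
       + A p 0 i * B p 0 j * pder i (pder j f) p).
  move=> sA sB; rewrite vderE; apply: eq_bigr => i _.
  have -> : pder i (vder B f) p = pder i (fun q => \sum_j B q 0 j * pder j f q) p.
    by apply: (eq_on_pder i oU) => // q _; rewrite vderE.
  rewrite (pder_sum oU i _ (fun j => smoothM oU (sB j) (smooth_pder j sf)) Up).
  rewrite mulr_sumr; apply: eq_bigr => j _.
  rewrite (pderM i (sB j) (smooth_pder j sf) Up).
  by rewrite mulrDr addrC -!mulrA [pder j f p * _]mulrC.
rewrite (dd X Y sX sY) (dd Y X sY sX).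
have split2 (A B : 'I_5 -> 'I_5 -> R) : \sum_i \sum_j (A i j + B i j)
    = \sum_i \sum_j A i j + \sum_i \sum_j B i j.
  by rewrite -big_split; apply: eq_bigr => i _; rewrite -big_split.
rewrite !split2.
have -> : \sum_i \sum_j (Y p 0 i * X p 0 j * pder i (pder j f) p)
        = \sum_i \sum_j (X p 0 i * Y p 0 j * pder i (pder j f) p).
  rewrite exchange_big /=; apply: eq_bigr => i _; apply: eq_bigr => j _.
  by rewrite (pder_comm j i oU sf Up) [Y p 0 j * _]mulrC.
rewrite opprD addrACA subrr addr0 -sumrB vderE.
under [RHS]eq_bigr do rewrite -sumrB.
rewrite exchange_big /=; apply: eq_bigr => j _.
by rewrite mxE mulr_suml; apply: eq_bigr => i _; rewrite mulrBl.
Qed.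

(** Smoothness travels with the value, so the sum and product rules compose without side conditions
    and [f'] can be left to unification. *)
Definition has_vder X f f' :=
  smooth_on U f /\ forall q, U q -> vder X f q = f' q.

Lemma has_vder_val X f f' q : has_vder X f f' -> U q -> vder X f q = f' q.
Proof. by move=> [] _; apply. Qed.

Lemma has_vder_smooth X f : smooth_on U f -> has_vder X f (vder X f).
Proof. by []. Qed.

Lemma has_vder_cst X c : has_vder X (fun=> c) (fun=> 0).
Proof.
split=> [|q _]; first exact: smooth_cst.
by rewrite vderE big1 // => i _; rewrite pder_cst mulr0.
Qed.

Lemma has_vderD X f f' g g' : has_vder X f f' -> has_vder X g g' ->
  has_vder X (fun q => f q + g q) (fun q => f' q + g' q).
Proof.
move=> [sf ff'] [sg gg']; split=> [|q Uq]; first exact: (smoothD oU sf sg).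
rewrite -(ff' q Uq) -(gg' q Uq) !vderE -big_split /=; apply: eq_bigr => i _.
by rewrite (pderD i sf sg Uq) mulrDr.
Qed.

Lemma has_vderM X f f' g g' : has_vder X f f' -> has_vder X g g' ->
  has_vder X (fun q => f q * g q) (fun q => f' q * g q + f q * g' q).
Proof.
move=> [sf ff'] [sg gg']; split=> [|q Uq]; first exact: (smoothM oU sf sg).
rewrite -(ff' q Uq) -(gg' q Uq) !vderE mulr_suml mulr_sumr -big_split /=.
have K (x a a' b b' : R) : x * (a * b' + b * a') = x * a' * b + a * (x * b') by ring.
by apply: eq_bigr => i _; rewrite (pderM i sf sg Uq) K.
Qed.

Lemma has_vderN X f f' : has_vder X f f' -> has_vder X (fun q => - f q) (fun q => - f' q).
Proof.
move=> Hf; have [s H] := has_vderM (has_vder_cst X (-1)) Hf; split=> [|q Uq].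
  by apply: (smooth_eq_on oU _ s) => q _; rewrite mulN1r.
rewrite (@eq_on_vder X _ (fun q => -1 * f q)) ?H //; first by rewrite mul0r add0r mulN1r.
by move=> r _; rewrite mulN1r.
Qed.

Lemma has_vderB X f f' g g' : has_vder X f f' -> has_vder X g g' ->
  has_vder X (fun q => f q - g q) (fun q => f' q - g' q).
Proof. by move=> Hf Hg; exact: (has_vderD Hf (has_vderN Hg)). Qed.

Lemma has_vderX X f f' n : has_vder X f f' ->
  has_vder X (fun q => f q ^+ n) (fun q => n%:R * f q ^+ n.-1 * f' q).
Proof.
move=> Hf; elim: n => [|n IHn].
  have [s H] := has_vder_cst X 1; split=> [|q Uq]; first exact: s.
  by rewrite mul0r mul0r -(H q Uq).
have [s H] := has_vderM Hf IHn; split=> [|q Uq].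
  by apply: (smooth_eq_on oU _ s) => q _; rewrite exprS.
rewrite (@eq_on_vder X _ (fun q => f q * f q ^+ n)) ?H //; last by move=> r _; rewrite exprS.
case: n {IHn s H} => [|n] /=; first by rewrite expr0; ring.
by rewrite -!natr1 exprS; ring.
Qed.

End OnOpen.

End VectorFields.

(* Syntactic dispatch: applying the closure lemmas up to unification would try
   to unfold the operations of [R]. *)
Ltac smooth_leaf oU g :=
  first
  [ match goal with H : smooth_on _ g |- _ => exact H end
  | lazymatch g with
    | ?y ?i => match goal with H : forall a, smooth_on _ (y a) |- _ => exact (H i) end
    end ].

Ltac smooth_tac oU :=
  let rec go :=
    lazymatch goal with
    | |- smooth_on _ (fun q => @?f q + @?g q) => refine (@smoothD _ _ oU f g _ _); go
    | |- smooth_on _ (fun q => @?f q * @?g q) => refine (@smoothM _ _ oU f g _ _); go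
    | |- smooth_on _ (fun q => - @?f q) => refine (@smoothN _ _ oU f _); go
    | |- smooth_on _ (fun q => @?f q ^+ ?n) => refine (@smoothX _ _ oU f n _); go
    | |- smooth_on _ (fun q => ?g q) => smooth_leaf oU g
    | |- smooth_on _ (fun q => ?c) => exact (smooth_cst oU c)
    | |- smooth_on _ ?g => smooth_leaf oU g
    end in
  cbv beta; go.

Ltac has_vder_leaf oU X g :=
  first
  [ match goal with H : has_vder _ X g _ |- _ => exact H end
  | lazymatch g with
    | ?y ?i =>
      match goal with
      | H : forall a, has_vder _ X (y a) _ |- _ => exact (H i)
      | H : forall Y a, has_vder _ Y (y a) _ |- _ => exact (H X i)
      end
    end ].

Ltac has_vder_tac oU :=
  let rec go :=
    lazymatch goal with
    | |- has_vder _ ?X (fun q => @?f q + @?g q) _ => refine (@has_vderD _ _ oU X f _ g _ _ _); go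
    | |- has_vder _ ?X (fun q => @?f q * @?g q) _ => refine (@has_vderM _ _ oU X f _ g _ _ _); go
    | |- has_vder _ ?X (fun q => - @?f q) _ => refine (@has_vderN _ _ oU X f _ _); go
    | |- has_vder _ ?X (fun q => @?f q ^+ ?n) _ => refine (@has_vderX _ _ oU X f _ n _); go
    | |- has_vder _ ?X (fun q => ?g q) _ => has_vder_leaf oU X g
    | |- has_vder _ ?X (fun q => ?c) _ => exact (has_vder_cst oU X c)
    | |- has_vder _ ?X ?g _ => has_vder_leaf oU X g
    end in
  cbv beta; go.

Ltac vder_calc oU Uq :=
  lazymatch goal with
  | |- vder ?X ?f ?q = _ =>
    refine (etrans (@has_vder_val _ _ X f _ q _ Uq) _);
    [has_vder_tac oU | cbv beta; try reflexivity]
  end.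

Section Chart.
Variable R : realType.
Variables (U : set 'rV[R]_5) (y : 'I_5 -> 'rV[R]_5 -> R).
Implicit Types (f g : 'rV[R]_5 -> R) (p q w : 'rV[R]_5) (X Y : vfield R).

(** Rows are indexed by the coordinates of R^5 and columns by the chart functions, so that a tangent
    row vector is pushed forward by multiplication on the right. *)
Definition jac p : 'M[R]_5 := \matrix_(i, a) pder i (y a) p.

Hypotheses (oU : open U) (sy : forall a, smooth_on U (y a))
  (uJ : forall p, U p -> jac p \in unitmx).

Lemma jac_row p w : w *m jac p = \row_a pairing (grad (y a) p) w.
Proof.
apply/rowP => a; rewrite [RHS]mxE pairingE mxE.
by apply: eq_bigr => i _; rewrite !mxE.
Qed.

(** The reduction behind most identities between vectors: where the Jacobian is invertible, the five
    differentials of the chart functions separate tangent vectors. *)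
Lemma chart_inj p v w : U p ->
  (forall a, pairing (grad (y a) p) v = pairing (grad (y a) p) w) -> v = w.
Proof.
move=> Up H; rewrite -[v](mulmxK (uJ Up)) -[w](mulmxK (uJ Up)) !jac_row.
by congr (_ *m _); apply/rowP => a; rewrite !mxE H.
Qed.

Definition chart_field (c : 'I_5 -> 'rV[R]_5 -> R) : vfield R :=
  fun p => (\row_a c a p) *m invmx (jac p).

Lemma chart_fieldP c a p : U p -> pairing (grad (y a) p) (chart_field c p) = c a p.
Proof.
move=> Up; have := mulmxKV (uJ Up) (\row_a c a p); rewrite jac_row.
by move=> /rowP/(_ a); rewrite !mxE.
Qed.

Lemma smooth_chart_field c : (forall a, smooth_on U (c a)) ->
  smooth_vfield U (chart_field c).
Proof.
move=> sc j; apply: (smooth_eq_on oU (f := fun q => \sum_a c a q * invmx (jac q) a j)).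
  by move=> q _; rewrite mxE; apply: eq_bigr => a _; rewrite mxE.
apply: (smooth_sum oU) => a; apply: (smoothM oU (sc a)).
apply: (smooth_invmx oU) => [i b|]; last exact: uJ.
by apply: (smooth_eq_on oU _ (smooth_pder i (sy b))) => q _; rewrite mxE.
Qed.

Definition chart_basis (a : 'I_5) : vfield R := chart_field (fun b _ => (b == a)%:R).

(** The second derivatives of the chart functions are symmetric and drop out, which leaves d (c dy)
    = dc wedge dy. *)
Lemma ext_d_chart (c : 'I_5 -> 'rV[R]_5 -> R) p :
  U p -> (forall a, smooth_on U (c a)) ->
  ext_d (fun q => \sum_a c a q *: grad (y a) q) p
  = \sum_a wedge (grad (c a) p) (grad (y a) p).
Proof.
move=> Up sc.
have P i j : pder i (fun q => (\sum_a c a q *: grad (y a) q) j 0) p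
   = \sum_a (c a p * pder i (pder j (y a)) p + pder j (y a) p * pder i (c a) p).
  have -> : (fun q => (\sum_a c a q *: grad (y a) q) j 0)
            = (fun q => \sum_a c a q * pder j (y a) q).
    by apply/funext => q; rewrite summxE; apply: eq_bigr => a _; rewrite !mxE.
  rewrite (pder_sum oU i _ (fun a => smoothM oU (sc a) (smooth_pder j (sy a))) Up).
  by apply: eq_bigr => a _; exact: (pderM i (sc a) (smooth_pder j (sy a)) Up).
apply/matrixP => i j; rewrite mxE !P summxE -sumrB; apply: eq_bigr => a _.
rewrite !mxE !big_ord1 !mxE (pder_comm i j oU (sy a) Up).
by rewrite opprD addrACA subrr add0r [pder j _ _ * _]mulrC [pder i (y a) p * _]mulrC.
Qed.

End Chart.

(** * Metrics with a closed coframe *)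

Section FlatMetric.
Variable R : realType.
Variables (U : set 'rV[R]_5) (y : 'I_5 -> 'rV[R]_5 -> R).
Hypotheses (oU : open U) (sy : forall a, smooth_on U (y a))
  (uJ : forall p, U p -> jac y p \in unitmx).
Variables (eta : 'M[R]_5) (g : metric R).
Hypotheses (eta_sym : eta^T = eta) (eta_unit : eta \in unitmx)
  (gE : forall q, U q -> g q = jac y q *m eta *m (jac y q)^T).

Let hess (a i j : 'I_5) := pder i (pder j (y a)).

(** With [P] the first and [H] the second derivatives of the chart, the left side is twice the
    Christoffel symbol of the first kind of J eta J^T. Of its six sums four cancel by the symmetry
    of [eta] and [H], and the other two are equal. *)
Lemma first_kind_sum (P : 'I_5 -> 'I_5 -> R) (H : 'I_5 -> 'I_5 -> 'I_5 -> R) :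
  (forall a c d, H a c d = H a d c) -> forall i j l,
  (\sum_a \sum_b eta a b * (H a i l * P b j + P a l * H b i j))
  + (\sum_a \sum_b eta a b * (H a j l * P b i + P a l * H b j i))
  - (\sum_a \sum_b eta a b * (H a l i * P b j + P a i * H b l j))
  = 2 * \sum_b (\sum_a P a l * eta a b) * H b i j.
Proof.
move=> comm i j l.
have split2 (A B : 'I_5 -> 'I_5 -> R) : \sum_a \sum_b eta a b * (A a b + B a b)
    = \sum_a \sum_b eta a b * A a b + \sum_a \sum_b eta a b * B a b.
  rewrite -big_split; apply: eq_bigr => a _; rewrite -big_split; apply: eq_bigr => b _.
  exact: mulrDr.
rewrite !split2.
have -> : \sum_a \sum_b eta a b * (P a i * H b l j)
    = \sum_a \sum_b eta a b * (H a j l * P b i).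
  rewrite exchange_big /=; apply: eq_bigr => a _; apply: eq_bigr => b _.
  by rewrite -[in LHS]eta_sym mxE (comm a l j) [P b i * _]mulrC.
have -> : \sum_a \sum_b eta a b * (H a l i * P b j)
    = \sum_a \sum_b eta a b * (H a i l * P b j).
  by apply: eq_bigr => a _; apply: eq_bigr => b _; rewrite (comm a l i).
have -> : \sum_a \sum_b eta a b * (P a l * H b j i)
    = \sum_a \sum_b eta a b * (P a l * H b i j).
  by apply: eq_bigr => a _; apply: eq_bigr => b _; rewrite (comm b j i).
have -> : \sum_b (\sum_a P a l * eta a b) * H b i j
    = \sum_a \sum_b eta a b * (P a l * H b i j).
  rewrite exchange_big /=; apply: eq_bigr => b _; rewrite mulr_suml.
  by apply: eq_bigr => a _; rewrite mulrA [eta a b * _]mulrC.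
move: (\sum_a _) (\sum_a _) (\sum_a _) => A B C.
ring.
Qed.

Lemma flat_entry q i j : U q ->
  g q i j = \sum_a \sum_b eta a b * (pder i (y a) q * pder j (y b) q).
Proof.
have K (x e z : R) : x * e * z = e * (x * z) by ring.
move=> Uq; rewrite gE // mxE [RHS]exchange_big /=; apply: eq_bigr => b _.
rewrite !mxE mulr_suml; apply: eq_bigr => a _.
by rewrite !mxE K.
Qed.

Lemma pder_flat_entry q i j k : U q ->
  pder k (fun q => g q i j) q = \sum_a \sum_b eta a b *
    (hess a k i q * pder j (y b) q + pder i (y a) q * hess b k j q).
Proof.
move=> Uq; rewrite (eq_on_pder k oU (fun r Ur => flat_entry i j Ur) Uq).
have sP a b : smooth_on U (fun q => pder i (y a) q * pder j (y b) q).
  exact: (smoothM oU (smooth_pder i (sy a)) (smooth_pder j (sy b))).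
have sT a b : smooth_on U (fun q => eta a b * (pder i (y a) q * pder j (y b) q)).
  exact: (smoothM oU (smooth_cst oU _) (sP a b)).
rewrite (pder_sum oU k _ (fun a => smooth_sum oU _ _ (sT a)) Uq).
apply: eq_bigr => a _; rewrite (pder_sum oU k _ (sT a) Uq).
apply: eq_bigr => b _; rewrite (pderM k (smooth_cst oU _) (sP a b) Uq).
rewrite (pderM k (smooth_pder i (sy a)) (smooth_pder j (sy b)) Uq) pder_cst mulr0 addr0.
by rewrite addrC [hess a k i q * _]mulrC.
Qed.

(** In its own flat coordinates the metric has vanishing symbols, so only the second derivatives of
    the coordinate change remain and [eta] drops out. *)
Lemma christoffel_flat q k i j : U q ->
  christoffel g k i j q = \sum_b invmx (jac y q) b k * hess b i j q.
Proof.
move=> Uq; rewrite /christoffel.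
have first_kind l : pder i (fun q => g q l j) q + pder j (fun q => g q l i) q
    - pder l (fun q => g q i j) q
    = 2 * \sum_b (jac y q *m eta) l b * hess b i j q.
  rewrite (pder_flat_entry l j i Uq) (pder_flat_entry l i j Uq) (pder_flat_entry i j l Uq).
  have comm a c d : hess a c d q = hess a d c q by exact: (pder_comm c d oU (sy a) Uq).
  rewrite (@first_kind_sum (fun a c => pder c (y a) q) (fun a c d => hess a c d q) comm i j l).
  congr (2 * _); apply: eq_bigr => b _; congr (_ * _).
  by rewrite mxE; apply: eq_bigr => a _; rewrite mxE.
under eq_bigr => l _ do rewrite first_kind mulrCA.
rewrite -mulr_sumr mulrA mulVf ?mul1r; last by rewrite pnatr_eq0.
transitivity (\sum_b (invmx (g q) *m (jac y q *m eta)) k b * hess b i j q).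
  under [RHS]eq_bigr => b _ do rewrite mxE mulr_suml.
  rewrite [RHS]exchange_big /=; apply: eq_bigr => l _; rewrite mulr_sumr.
  by apply: eq_bigr => b _; rewrite mulrA.
apply: eq_bigr => b _; congr (_ * _).
have uJq := uJ Uq; have uJT : (jac y q)^T \in unitmx by rewrite unitmx_tr.
have ug : g q \in unitmx by rewrite gE // !unitmx_mul uJq eta_unit.
suff -> : invmx (g q) *m (jac y q *m eta) = (invmx (jac y q))^T by rewrite mxE.
by rewrite trmx_inv -[LHS](mulmxK uJT) -[_ *m _ *m (jac y q)^T]mulmxA -gE // mulVmx // mul1mx.
Qed.

Lemma riemann_up_flat q l k i j : U q -> riemann_up g l k i j q = 0.
Proof.
move=> Uq.
have sK b m : smooth_on U (fun q => invmx (jac y q) b m).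
  apply: (smooth_invmx oU) => [c d|]; last exact: uJ.
  by apply: (smooth_eq_on oU _ (smooth_pder c (sy d))) => r _; rewrite mxE.
have sH b c d : smooth_on U (hess b c d) by exact: smooth_pder (smooth_pder d (sy b)).
have sG m c d : smooth_on U (christoffel g m c d).
  apply: (smooth_eq_on oU (fun r Ur => esym (christoffel_flat m c d Ur))).
  by apply: (smooth_sum oU) => b; exact: (smoothM oU (sK b m) (sH b c d)).
(* Contracted with the Jacobian, the symbols become the second derivatives of the chart. *)
have lower r a c d : U r ->
    \sum_m christoffel g m c d r * pder m (y a) r = hess a c d r.
  move=> Ur; under eq_bigr => m _ do rewrite christoffel_flat // mulr_suml.
  rewrite exchange_big /=.
  transitivity (\sum_b (invmx (jac y r) *m jac y r) b a * hess b c d r).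
    apply: eq_bigr => b _; rewrite mxE mulr_suml; apply: eq_bigr => m _.
    by rewrite mxE mulrAC.
  rewrite mulVmx ?uJ // (bigD1 a) //= big1 => [|b ba]; first by rewrite mxE eqxx mul1r addr0.
  by rewrite mxE (negPf ba) mul0r.
(* The derivative of that contraction. The curvature thereby combines third derivatives of the
   chart, which are symmetric, with products that cancel in pairs. *)
have dlower a b c d : \sum_m pder b (christoffel g m c d) q * pder m (y a) q
    = pder b (hess a c d) q - \sum_m christoffel g m c d q * hess a b m q.
  have S m : smooth_on U (fun r => christoffel g m c d r * pder m (y a) r).
    exact: (smoothM oU (sG m c d) (smooth_pder m (sy a))).
  rewrite -(eq_on_pder b oU (fun r Ur => lower r a c d Ur) Uq).
  rewrite (pder_sum oU b _ S Uq) -sumrB; apply: eq_bigr => m _.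
  rewrite (pderM b (sG m c d) (smooth_pder m (sy a)) Uq).
  have K (A B C : R) : A * C = B + C * A - B by ring.
  exact: K.
suff : (\row_m riemann_up g m k i j q) *m jac y q = 0.
  move=> E; have : (\row_m riemann_up g m k i j q) = 0.
    by rewrite -[LHS](mulmxK (uJ Uq)) E mul0mx.
  by move/rowP/(_ l); rewrite !mxE.
apply/rowP => a; rewrite !mxE.
transitivity (\sum_m pder i (christoffel g m j k) q * pder m (y a) q
  - \sum_m pder j (christoffel g m i k) q * pder m (y a) q
  + (\sum_n (\sum_m christoffel g m i n q * pder m (y a) q) * christoffel g n j k q
     - \sum_n (\sum_m christoffel g m j n q * pder m (y a) q) * christoffel g n i k q)).
  under [X in _ = _ + (X - _)]eq_bigr => n _ do rewrite mulr_suml.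
  under [X in _ = _ + (_ - X)]eq_bigr => n _ do rewrite mulr_suml.
  rewrite [X in _ = _ + (X - _)]exchange_big [X in _ = _ + (_ - X)]exchange_big /=.
  rewrite -!sumrB -big_split /=; apply: eq_bigr => m _.
  rewrite !mxE mulrDl mulrBl; congr (_ + _).
  rewrite mulr_suml -sumrB; apply: eq_bigr => n _.
  by rewrite mulrBl; congr (_ - _); rewrite mulrAC.
have L c d e : \sum_n (\sum_m christoffel g m c n q * pder m (y a) q) * christoffel g n d e q
    = \sum_n christoffel g n d e q * hess a c n q.
  by apply: eq_bigr => n _; rewrite (lower q a c n Uq); exact: mulrC.
have sub2 (A A' B B' : R) : A = A' -> B = B' -> A - B = A' - B' by move=> -> ->.
apply: (etrans (congr2 +%R (sub2 _ _ _ _ (dlower a i j k) (dlower a j i k))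
                           (sub2 _ _ _ _ (L i j k) (L j i k)))).
have E : pder i (hess a j k) q = pder j (hess a i k) q.
  exact (pder_comm i j oU (smooth_pder k (sy a)) Uq).
rewrite E.
have K (A B C : R) : A - B - (A - C) + (B - C) = 0 by ring.
exact: K.
Qed.

Lemma flat_on_chart : flat_on U g.
Proof.
move=> q Uq l k i j; rewrite /riemann big1 // => m _.
by rewrite riemann_up_flat // mulr0.
Qed.

Lemma weyl_zero_on_chart : weyl_zero_on U g.
Proof.
move=> q Uq l k i j; rewrite /weyl flat_on_chart //.
have ric a b : ricci g a b q = 0.
  by rewrite /ricci big1 // => c _; exact: riemann_up_flat.
have -> : scalar_curv g q = 0.
  by rewrite /scalar_curv big1 // => a _; rewrite big1 // => b _; rewrite ric mulr0.
by rewrite !ric !mulr0 !subr0 !addr0 mulr0 mul0r subr0 addr0.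
Qed.

End FlatMetric.

(** * The flat (2,3,5)-distribution *)

Definition row5 T (a b c d e : T) (i : 'I_5) : T := nth a [:: a; b; c; d; e] i.

Lemma forall_I5 (P : 'I_5 -> Prop) :
  P (ix 0) -> P (ix 1) -> P (ix 2) -> P (ix 3) -> P (ix 4) -> forall i, P i.
Proof.
move=> P0 P1 P2 P3 P4 [i hi].
have Q j (hj : (j < 5)%N) : P (Ordinal hj) -> j = i -> P (Ordinal hi).
  by move=> Pj ji; rewrite (_ : Ordinal hi = Ordinal hj) //; exact/val_inj.
by case: i hi Q => [|[|[|[|[|i]]]]] hi Q; [exact: Q P0 _|exact: Q P1 _|exact: Q P2 _
  |exact: Q P3 _|exact: Q P4 _|].
Qed.

Lemma sum_I5 (V : nmodType) (F : 'I_5 -> V) :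
  \sum_i F i = F (ix 0) + F (ix 1) + F (ix 2) + F (ix 3) + F (ix 4).
Proof.
rewrite !big_ord_recl big_ord0 addr0 !addrA.
by congr (_ + _ + _ + _ + _); congr F; exact: val_inj.
Qed.

Section Spans.
Variables (K : fieldType) (V : vectType K).

Lemma mem_span2 (a b v : V) :
  reflect (exists x y, v = x *: a + y *: b) (v \in <<[:: a; b]>>%VS).
Proof.
rewrite !span_cons span_nil addv0.
apply: (iffP memv_addP) => [[_ /vlineP[x ->] [_ /vlineP[y ->] ->]]|[x [y ->]]].
  by exists x, y.
by exists (x *: a); [exact: memvZ (memv_line a)|exists (y *: b); [exact: memvZ (memv_line b)|]].
Qed.

Lemma mem_span3 (a b c v : V) :
  reflect (exists x y z, v = x *: a + y *: b + z *: c) (v \in <<[:: a; b; c]>>%VS).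
Proof.
rewrite span_cons; apply: (iffP memv_addP).
  move=> [_ /vlineP[x ->] [w /mem_span2[y [z ->]] ->]].
  by exists x, y, z; rewrite addrA.
move=> [x [y [z ->]]]; exists (x *: a); first exact: memvZ (memv_line a).
by exists (y *: b + z *: c); [apply/mem_span2; exists y, z|rewrite addrA].
Qed.

(** The functionals [d j] are only known to respect sums of [n] terms, so [d j 0 = 0] is extracted
    from the combination whose vectors and coefficients are all zero. *)
Lemma free_dual n (X : n.-tuple V) (d : 'I_n -> V -> K) :
  (forall j (F : 'I_n -> V) (k : 'I_n -> K),
     d j (\sum_i k i *: F i) = \sum_i k i * d j (F i)) ->
  (forall i j : 'I_n, d j X`_i = (i == j)%:R) -> free X.
Proof.
move=> lin dual; apply/freeP => k /(congr1 (fun v : V => v)) E j.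
have := lin j (fun i => X`_i) k; rewrite E.
have := lin j (fun=> 0) (fun=> 0).
rewrite big1 => [-> |i _]; last by rewrite scaler0.
rewrite big1 => [|i _]; last by rewrite mul0r.
rewrite (bigD1 j) //= big1 => [|i ij]; last by rewrite dual (negPf ij) mulr0.
by rewrite dual eqxx mulr1 addr0.
Qed.

End Spans.

Section FlatModel.
Variable R : realType.
Variables (U : set 'rV[R]_5) (y : 'I_5 -> 'rV[R]_5 -> R).
Hypotheses (oU : open U) (sy : forall a, smooth_on U (y a))
  (uJ : forall p, U p -> jac y p \in unitmx).

Local Notation yu := (y (ix 0)).
Local Notation yw := (y (ix 1)).
Local Notation yp := (y (ix 2)).

(** Components are listed in the order (u, w, p, t, v) of the chart functions. *)
Definition Z1c : 'I_5 -> 'rV[R]_5 -> R := row5 (fun=> 1) (fun=> 0)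
  (fun q => - yw q) (fun q => yp q + yu q * yw q) (fun q => yw q ^+ 2).
Definition Z2c : 'I_5 -> 'rV[R]_5 -> R := row5 (fun=> 0) (fun=> 1)
  yu (fun q => - yu q ^+ 2) (fun q => yp q - yu q * yw q).
(** This and the next two are [Z1, Z2], [Z1, Z3] and [Z2, Z3]; see [brackets]. *)
Definition Z3c : 'I_5 -> 'rV[R]_5 -> R := row5 (fun=> 0) (fun=> 0)
  (fun=> 2) (fun q => - (4 * yu q)) (fun q => - (4 * yw q)).
Definition Z4c : 'I_5 -> 'rV[R]_5 -> R :=
  row5 (fun=> 0) (fun=> 0) (fun=> 0) (fun=> -6) (fun=> 0).
Definition Z5c : 'I_5 -> 'rV[R]_5 -> R :=
  row5 (fun=> 0) (fun=> 0) (fun=> 0) (fun=> 0) (fun=> -6).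

Definition Z1 := chart_field y Z1c.
Definition Z2 := chart_field y Z2c.
Definition Z3 := chart_field y Z3c.
Definition Z4 := chart_field y Z4c.
Definition Z5 := chart_field y Z5c.

Definition chart_form (c : 'I_5 -> 'rV[R]_5 -> R) : form1 R :=
  fun q => \sum_a c a q *: grad (y a) q.

(** The coframe dual to (- Z4, - Z5, - Z3, Z1, Z2). On frame vectors d theta (X, Y) = - theta
    [X, Y], so these signs give the terms theta_3 wedge theta_4, theta_3 wedge theta_5 and theta_4
    wedge theta_5 of Cartan's equations the coefficient 1. *)
Definition th1c : 'I_5 -> 'rV[R]_5 -> R := row5
  (fun q => 6^-1 * (yu q * yw q - yp q)) (fun q => 6^-1 * - yu q ^+ 2)
  (fun q => 6^-1 * (2 * yu q)) (fun=> 6^-1) (fun=> 0).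
Definition th2c : 'I_5 -> 'rV[R]_5 -> R := row5
  (fun q => 6^-1 * yw q ^+ 2) (fun q => 6^-1 * - (yp q + yu q * yw q))
  (fun q => 6^-1 * (2 * yw q)) (fun=> 0) (fun=> 6^-1).
Definition th3c : 'I_5 -> 'rV[R]_5 -> R := row5
  (fun q => - 2^-1 * yw q) (fun q => 2^-1 * yu q) (fun=> - 2^-1) (fun=> 0) (fun=> 0).
Definition th4c : 'I_5 -> 'rV[R]_5 -> R :=
  row5 (fun=> 1) (fun=> 0) (fun=> 0) (fun=> 0) (fun=> 0).
Definition th5c : 'I_5 -> 'rV[R]_5 -> R :=
  row5 (fun=> 0) (fun=> 1) (fun=> 0) (fun=> 0) (fun=> 0).

Definition th1 := chart_form th1c.
Definition th2 := chart_form th2c.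
Definition th3 := chart_form th3c.
Definition th4 := chart_form th4c.
Definition th5 := chart_form th5c.

(* The metric - dp^2 - dt dw + du dv. *)
Definition flat_eta : 'M[R]_5 := \matrix_(a, b)
  row5 (row5 0 0 0 0 2^-1) (row5 0 0 0 (- 2^-1) 0) (row5 0 0 (-1) 0 0)
       (row5 0 (- 2^-1) 0 0 0) (row5 2^-1 0 0 0 0) a b.

Lemma flat_eta_sym : flat_eta^T = flat_eta.
Proof.
by apply/matrixP; apply: forall_I5; apply: forall_I5; rewrite !mxE.
Qed.

Lemma flat_eta_unit : flat_eta \in unitmx.
Proof.
have [] // := @mulmx1_unit _ _ flat_eta (\matrix_(a, b)
  row5 (row5 0 0 0 0 2) (row5 0 0 0 (- 2) 0) (row5 0 0 (-1) 0 0)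
       (row5 0 (- 2) 0 0 0) (row5 2 0 0 0 0) a b).
apply/matrixP; apply: forall_I5; apply: forall_I5;
  rewrite !mxE sum_I5 !mxE /row5 /=; by field.
Qed.

Lemma smooth_Z : [/\ smooth_vfield U Z1, smooth_vfield U Z2, smooth_vfield U Z3,
  smooth_vfield U Z4 & smooth_vfield U Z5].
Proof.
by split; apply: (smooth_chart_field oU sy uJ); apply: forall_I5;
  rewrite /Z1c /Z2c /Z3c /Z4c /Z5c /th1c /th2c /th3c /th4c /th5c /row5 /=; smooth_tac oU.
Qed.

Lemma smooth_chart_form c : (forall a, smooth_on U (c a)) -> smooth_form U (chart_form c).
Proof.
move=> sc i; apply: (smooth_eq_on oU (f := fun q => \sum_a c a q * pder i (y a) q)).
  by move=> q _; rewrite summxE; apply: eq_bigr => a _; rewrite !mxE.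
apply: (smooth_sum oU) => a; exact: (smoothM oU (sc a) (smooth_pder i (sy a))).
Qed.

Lemma smooth_thc : [/\ forall a, smooth_on U (th1c a), forall a, smooth_on U (th2c a),
  forall a, smooth_on U (th3c a), forall a, smooth_on U (th4c a) &
  forall a, smooth_on U (th5c a)].
Proof. by split; apply: forall_I5;
  rewrite /Z1c /Z2c /Z3c /Z4c /Z5c /th1c /th2c /th3c /th4c /th5c /row5 /=; smooth_tac oU. Qed.

Lemma pairing_chart_form c q v :
  pairing (chart_form c q) v = \sum_a c a q * pairing (grad (y a) q) v.
Proof.
rewrite /chart_form pairingE; under eq_bigr do rewrite summxE mulr_sumr.
rewrite exchange_big /=; apply: eq_bigr => a _; rewrite pairingE mulr_sumr.
by apply: eq_bigr => i _; rewrite !mxE mulrCA.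
Qed.

End FlatModel.

Section FlatModelGeometry.
Variable R : realType.
Variables (U : set 'rV[R]_5) (y : 'I_5 -> 'rV[R]_5 -> R).
Hypotheses (oU : open U) (sy : forall a, smooth_on U (y a))
  (uJ : forall p, U p -> jac y p \in unitmx).

Local Notation yu := (y (ix 0)).
Local Notation yw := (y (ix 1)).
Local Notation yp := (y (ix 2)).
Local Notation yt := (y (ix 3)).
Local Notation yv := (y (ix 4)).
Local Notation dy a v q := (pairing (grad (y a) q) v).

Lemma th_pairing q v :
  [/\ pairing (th1 y q) v = 6^-1 * (yu q * yw q - yp q) * dy (ix 0) v q
        - 6^-1 * yu q ^+ 2 * dy (ix 1) v q + 6^-1 * (2 * yu q) * dy (ix 2) v q
        + 6^-1 * dy (ix 3) v q,
      pairing (th2 y q) v = 6^-1 * yw q ^+ 2 * dy (ix 0) v q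
        - 6^-1 * (yp q + yu q * yw q) * dy (ix 1) v q + 6^-1 * (2 * yw q) * dy (ix 2) v q
        + 6^-1 * dy (ix 4) v q,
      pairing (th3 y q) v = 2^-1 * (yu q * dy (ix 1) v q - yw q * dy (ix 0) v q - dy (ix 2) v q),
      pairing (th4 y q) v = dy (ix 0) v q &
      pairing (th5 y q) v = dy (ix 1) v q].
Proof.
rewrite !pairing_chart_form !sum_I5 /th1c /th2c /th3c /th4c /th5c /row5 /=.
generalize (yu q) (yw q) (yp q) (dy (ix 0) v q) (dy (ix 1) v q) (dy (ix 2) v q)
    (dy (ix 3) v q) (dy (ix 4) v q); move=> u w p du dw dp dt dv; split; ring.
Qed.

Lemma dy_Z q : U q -> forall a, [/\ dy a (Z1 y q) q = Z1c y a q, dy a (Z2 y q) q = Z2c y a q,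
  dy a (Z3 y q) q = Z3c y a q, dy a (Z4 y q) q = Z4c a q & dy a (Z5 y q) q = Z5c a q].
Proof. by move=> Uq a; rewrite !(chart_fieldP uJ _ _ Uq). Qed.

Lemma dy_Z_comb q (x1 x2 x3 x4 x5 : R) a : U q ->
  dy a (x4 *: Z1 y q + x5 *: Z2 y q - x3 *: Z3 y q - x1 *: Z4 y q - x2 *: Z5 y q) q
  = x4 * Z1c y a q + x5 * Z2c y a q - x3 * Z3c y a q - x1 * Z4c a q - x2 * Z5c a q.
Proof.
have N c (v : 'rV[R]_5) : dy a (- (c *: v)) q = - (c * dy a v q).
  by rewrite -scaleNr pairingZr mulNr.
by move=> Uq; rewrite !pairingDr !N !pairingZr !(chart_fieldP uJ _ _ Uq).
Qed.

Lemma th_Z q v : U q ->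
  v = pairing (th4 y q) v *: Z1 y q + pairing (th5 y q) v *: Z2 y q
      - pairing (th3 y q) v *: Z3 y q - pairing (th1 y q) v *: Z4 y q
      - pairing (th2 y q) v *: Z5 y q.
Proof.
move=> Uq; have [-> -> -> -> ->] := th_pairing q v.
apply: (chart_inj uJ Uq) => a; rewrite (dy_Z_comb _ _ _ _ _ a Uq); move: a.
apply: forall_I5; rewrite /Z1c /Z2c /Z3c /Z4c /Z5c /row5 /=;
  generalize (yu q) (yw q) (yp q) (dy (ix 0) v q) (dy (ix 1) v q) (dy (ix 2) v q)
    (dy (ix 3) v q) (dy (ix 4) v q); move=> u w p du dw dp dt dv; by field.
Qed.

Lemma th_dual q : U q -> forall i j : 'I_5,
  pairing (row5 (th1 y q) (th2 y q) (th3 y q) (th4 y q) (th5 y q) i)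
    (row5 (- Z4 y q) (- Z5 y q) (- Z3 y q) (Z1 y q) (Z2 y q) j) = (i == j)%:R.
Proof.
have pairingNr a (v : 'rV[R]_5) : pairing a (- v) = - pairing a v.
  by rewrite -scaleN1r pairingZr mulN1r.
pose V j := row5 (- Z4 y q) (- Z5 y q) (- Z3 y q) (Z1 y q) (Z2 y q) j.
move=> Uq i j; rewrite -/(V j).
have : [/\ pairing (th1 y q) (V j) = (ix 0 == j)%:R, pairing (th2 y q) (V j) = (ix 1 == j)%:R,
    pairing (th3 y q) (V j) = (ix 2 == j)%:R, pairing (th4 y q) (V j) = (ix 3 == j)%:R
    & pairing (th5 y q) (V j) = (ix 4 == j)%:R].
  have D a : dy a (V j) q
      = row5 (- Z4c a q) (- Z5c a q) (- Z3c y a q) (Z1c y a q) (Z2c y a q) j.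
    by have [e1 e2 e3 e4 e5] := dy_Z Uq a; move: j; apply: forall_I5;
      rewrite /V /row5 /= ?pairingNr ?e1 ?e2 ?e3 ?e4 ?e5.
  have [-> -> -> -> ->] := th_pairing q (V j).
  move: (D (ix 0)) (D (ix 1)) (D (ix 2)) (D (ix 3)) (D (ix 4)).
  generalize (dy (ix 0) (V j) q) (dy (ix 1) (V j) q) (dy (ix 2) (V j) q) (dy (ix 3) (V j) q)
    (dy (ix 4) (V j) q).
  move=> d0 d1 d2 d3 d4 -> -> -> -> -> {D}; move: j.
  apply: forall_I5; rewrite /row5 /= /Z1c /Z2c /Z3c /Z4c /Z5c /row5 /=;
    generalize (yu q) (yw q) (yp q); move=> u w p; split; by field.
by move=> [e1 e2 e3 e4 e5]; move: i; apply: forall_I5; rewrite /row5 /=.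
Qed.

Lemma grad_vder (f : 'rV[R]_5 -> R) q i : grad f q i 0 = vder (fun=> delta_mx 0 i) f q.
Proof.
rewrite mxE vderE (bigD1 i) //= big1 => [|j ji]; first by rewrite mxE !eqxx mul1r addr0.
by rewrite mxE (negPf ji) andbF mul0r.
Qed.

Lemma wedgeE (a b : 'cV[R]_5) i j : wedge a b i j = a i 0 * b j 0 - b i 0 * a j 0.
Proof. by rewrite !mxE !big_ord1 !mxE. Qed.

Lemma sprodE (a b : 'cV[R]_5) i j : sprod a b i j = 2^-1 * (a i 0 * b j 0 + b i 0 * a j 0).
Proof. by rewrite !mxE !big_ord1 !mxE. Qed.

Local Notation dv i := (vder (fun=> delta_mx 0 i)).

Lemma chart_formE c q i : chart_form y c q i 0 = \sum_a c a q * dv i (y a) q.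
Proof. by rewrite summxE; apply: eq_bigr => a _; rewrite -grad_vder mxE. Qed.

Lemma wedge_chart_form c d q i j : wedge (chart_form y c q) (chart_form y d q) i j =
  (\sum_a c a q * dv i (y a) q) * (\sum_a d a q * dv j (y a) q)
  - (\sum_a d a q * dv i (y a) q) * (\sum_a c a q * dv j (y a) q).
Proof. by rewrite wedgeE !chart_formE. Qed.

Lemma ext_d_chart_form c q i j : (forall a, smooth_on U (c a)) -> U q ->
  ext_d (chart_form y c) q i j
  = \sum_a (dv i (c a) q * dv j (y a) q - dv i (y a) q * dv j (c a) q).
Proof.
move=> sc Uq; rewrite (ext_d_chart oU sy Uq sc) summxE; apply: eq_bigr => a _.
by rewrite wedgeE !grad_vder.
Qed.

Lemma ext_d_th :
  forall q, U q -> [/\ ext_d (th1 y) q = wedge (th3 y q) (th4 y q),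
    ext_d (th2 y) q = wedge (th3 y q) (th5 y q), ext_d (th3 y) q = wedge (th4 y q) (th5 y q),
    ext_d (th4 y) q = 0 & ext_d (th5 y) q = 0].
Proof.
move=> q Uq; have [s1 s2 s3 s4 s5] := smooth_thc oU sy.
have hv X a : has_vder U X (y a) (vder X (y a)) by exact: has_vder_smooth.
have c1 X : vder X (fun q => 6^-1 * (yu q * yw q - yp q)) q
    = 6^-1 * (vder X yu q * yw q + yu q * vder X yw q - vder X yp q).
  by vder_calc oU Uq; ring.
have c2 X : vder X (fun q => 6^-1 * - yu q ^+ 2) q = 6^-1 * - (2 * yu q * vder X yu q).
  by vder_calc oU Uq; ring.
have c3 X : vder X (fun q => 6^-1 * (2 * yu q)) q = 6^-1 * (2 * vder X yu q).
  by vder_calc oU Uq; ring.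
have c4 X : vder X (fun q => 6^-1 * yw q ^+ 2) q = 6^-1 * (2 * yw q * vder X yw q).
  by vder_calc oU Uq; ring.
have c5 X : vder X (fun q => 6^-1 * - (yp q + yu q * yw q)) q
    = 6^-1 * - (vder X yp q + vder X yu q * yw q + yu q * vder X yw q).
  by vder_calc oU Uq; ring.
have c6 X : vder X (fun q => 6^-1 * (2 * yw q)) q = 6^-1 * (2 * vder X yw q).
  by vder_calc oU Uq; ring.
have c7 X : vder X (fun q => - 2^-1 * yw q) q = - 2^-1 * vder X yw q.
  by vder_calc oU Uq; ring.
have c8 X : vder X (fun q => 2^-1 * yu q) q = 2^-1 * vder X yu q.
  by vder_calc oU Uq; ring.
have c0 X c : vder X (fun=> c) q = 0 by exact (has_vder_val (has_vder_cst oU X c) Uq).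
(* The two indices of a matrix entry are replaced by arbitrary fields, so that one polynomial
   identity in the derivatives of u, w, p, t, v covers all entries. *)
have gen (Xi Xj : vfield R) : [/\
  \sum_a (vder Xi (th1c y a) q * vder Xj (y a) q - vder Xi (y a) q * vder Xj (th1c y a) q)
  = (\sum_a th3c y a q * vder Xi (y a) q) * (\sum_a th4c a q * vder Xj (y a) q)
    - (\sum_a th4c a q * vder Xi (y a) q) * (\sum_a th3c y a q * vder Xj (y a) q),
  \sum_a (vder Xi (th2c y a) q * vder Xj (y a) q - vder Xi (y a) q * vder Xj (th2c y a) q)
  = (\sum_a th3c y a q * vder Xi (y a) q) * (\sum_a th5c a q * vder Xj (y a) q)
    - (\sum_a th5c a q * vder Xi (y a) q) * (\sum_a th3c y a q * vder Xj (y a) q),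
  \sum_a (vder Xi (th3c y a) q * vder Xj (y a) q - vder Xi (y a) q * vder Xj (th3c y a) q)
  = (\sum_a th4c a q * vder Xi (y a) q) * (\sum_a th5c a q * vder Xj (y a) q)
    - (\sum_a th5c a q * vder Xi (y a) q) * (\sum_a th4c a q * vder Xj (y a) q),
  \sum_a (vder Xi (th4c a) q * vder Xj (y a) q - vder Xi (y a) q * vder Xj (th4c a) q) = 0 &
  \sum_a (vder Xi (th5c a) q * vder Xj (y a) q - vder Xi (y a) q * vder Xj (th5c a) q) = 0].
  split; rewrite !sum_I5 /th1c /th2c /th3c /th4c /th5c /row5 /=
    ?(c1, c2, c3, c4, c5, c6, c7, c8, c0);
    generalize (yu q) (yw q) (yp q) (vder Xi yu q) (vder Xj yu q) (vder Xi yw q) (vder Xj yw q)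
      (vder Xi yp q) (vder Xj yp q) (vder Xi yt q) (vder Xj yt q) (vder Xi yv q) (vder Xj yv q);
    move=> u w p iu ju iw jw ip jp it jt iv jv; by field.
have gij i j := gen (fun=> delta_mx 0 i) (fun=> delta_mx 0 j).
split; apply/matrixP => i j; rewrite ?wedge_chart_form ?[RHS]mxE;
  case: (gij i j) => g1 g2 g3 g4 g5.
- by rewrite (ext_d_chart_form i j s1 Uq).
- by rewrite (ext_d_chart_form i j s2 Uq).
- by rewrite (ext_d_chart_form i j s3 Uq).
- by rewrite (ext_d_chart_form i j s4 Uq).
- by rewrite (ext_d_chart_form i j s5 Uq).
Qed.

End FlatModelGeometry.

(** * Brackets and the growth of the distribution *)

Section LieBracket.
Variable R : realType.
Variables (U : set 'rV[R]_5) (oU : open U).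
Implicit Types (X Y : vfield R) (f : 'rV[R]_5 -> R).

Lemma lie_self X p : lie X X p = 0.
Proof. by apply/rowP => j; rewrite !mxE big1 // => i _; rewrite subrr. Qed.

Lemma lie_anti X Y p : lie X Y p = - lie Y X p.
Proof.
apply/rowP => j; rewrite !mxE -sumrN; apply: eq_bigr => i _.
by rewrite opprB.
Qed.

Lemma lie_scaler X Y f p : smooth_vfield U Y -> smooth_on U f -> U p ->
  lie X (fun q => f q *: Y q) p = f p *: lie X Y p + vder X f p *: Y p.
Proof.
move=> sY sf Up; apply/rowP => j; rewrite !mxE vderE mulr_suml mulr_sumr -big_split /=.
apply: eq_bigr => i _.
have E : pder i (fun q => (f q *: Y q) 0 j) p = f p * pder i (fun q => Y q 0 j) p + Y p 0 j * pder i f p.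
  rewrite -(pderM i sf (sY j) Up); apply: (eq_on_pder i oU _ Up) => q _.
  by rewrite mxE.
rewrite E mxE.
have K (a b c d e g : R) : a * (b * c + d * e) - b * g = b * (a * c - g) + a * e * d by ring.
by rewrite -mulrA K.
Qed.

Lemma smooth_scale_vfield X f : smooth_on U f -> smooth_vfield U X ->
  smooth_vfield U (fun q => f q *: X q).
Proof.
move=> sf sX j; apply: (smooth_eq_on oU _ (smoothM oU sf (sX j))) => q _.
by rewrite mxE.
Qed.

End LieBracket.

Section VSpan.
Variable R : realType.
Implicit Types (S : set 'rV[R]_5) (v w : 'rV[R]_5).

Lemma vspan_in S v : S v -> vspan S v.
Proof.
move=> Sv; exists [:: v] => [w|]; first by rewrite inE => /eqP ->.
by rewrite memv_span // mem_head.
Qed.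

Lemma vspan_comb S v w (a b : R) : vspan S v -> vspan S w -> vspan S (a *: v + b *: w).
Proof.
move=> [s sS vs] [t tS wt]; exists (s ++ t) => [z|].
  by rewrite mem_cat => /orP[/sS|/tS].
rewrite span_cat; apply: memv_add; exact: memvZ.
Qed.

Lemma vspanZ S v (a : R) : vspan S v -> vspan S (a *: v).
Proof. by move=> Sv; have := vspan_comb a 0 Sv Sv; rewrite scale0r addr0. Qed.

Lemma vspanD S v w : vspan S v -> vspan S w -> vspan S (v + w).
Proof. by move=> Sv Sw; have := vspan_comb 1 1 Sv Sw; rewrite !scale1r. Qed.

Lemma vspan_sub S (V : {vspace 'rV[R]_5}) : (forall w, S w -> w \in V) ->
  forall v, vspan S v -> v \in V.
Proof. by move=> SV v [s sS]; apply: subvP; apply/span_subvP => w /sS /SV. Qed.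

End VSpan.

Section FlatModelBrackets.
Variable R : realType.
Variables (U : set 'rV[R]_5) (y : 'I_5 -> 'rV[R]_5 -> R).
Hypotheses (oU : open U) (sy : forall a, smooth_on U (y a))
  (uJ : forall p, U p -> jac y p \in unitmx).

Local Notation yu := (y (ix 0)).
Local Notation yw := (y (ix 1)).
Local Notation yp := (y (ix 2)).

Lemma has_vder_chart c : forall a, has_vder U (chart_field y c) (y a) (c a).
Proof. by move=> a; split=> [|q Uq]; [exact: sy|exact: (chart_fieldP uJ c a Uq)]. Qed.

Lemma has_vder_eq X f f' f'' : has_vder U X f f' -> (forall q, f' q = f'' q) ->
  has_vder U X f f''.
Proof. by move=> [sf H] E; split=> // q Uq; rewrite H. Qed.

(** The differential of y_a takes the value X (Y y_a) - Y (X y_a) on [X, Y], and Y y_a, X y_a are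
    the chart components of the two fields. *)
Lemma lie_chart_field c c' d d' e q :
  (forall a, has_vder U (chart_field y d) (c a) (c' a)) ->
  (forall a, has_vder U (chart_field y c) (d a) (d' a)) -> U q ->
  (forall a, d' a q - c' a q = e a q) ->
  lie (chart_field y c) (chart_field y d) q = chart_field y e q.
Proof.
move=> hc hd Uq E; apply: (chart_inj uJ Uq) => a.
rewrite (chart_fieldP uJ e a Uq) -E.
have := vder_lie oU (smooth_chart_field oU sy uJ (fun a => (hc a).1))
  (smooth_chart_field oU sy uJ (fun a => (hd a).1)) (sy a) Uq.
rewrite {1}/vder => ->; congr (_ - _).
  rewrite -((hd a).2 q Uq); apply: (eq_on_vder oU _ _ Uq) => r Ur.
  exact: (chart_fieldP uJ d a Ur).
rewrite -((hc a).2 q Uq); apply: (eq_on_vder oU _ _ Uq) => r Ur.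
exact: (chart_fieldP uJ c a Ur).
Qed.

Lemma has_vder_Zc X f g h : has_vder U X yu f -> has_vder U X yw g -> has_vder U X yp h ->
  [/\ forall a, has_vder U X (Z1c y a) (row5 (fun=> 0) (fun=> 0) (fun q => - g q)
        (fun q => h q + (f q * yw q + yu q * g q)) (fun q => 2 * yw q * g q) a),
      forall a, has_vder U X (Z2c y a) (row5 (fun=> 0) (fun=> 0) f
        (fun q => - (2 * yu q * f q)) (fun q => h q - (f q * yw q + yu q * g q)) a),
      forall a, has_vder U X (Z3c y a) (row5 (fun=> 0) (fun=> 0) (fun=> 0)
        (fun q => - (4 * f q)) (fun q => - (4 * g q)) a),
      forall a, has_vder U X (@Z4c R a) (fun=> 0) &
      forall a, has_vder U X (@Z5c R a) (fun=> 0)].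
Proof.
move=> Hf Hg Hh; split; apply: forall_I5; rewrite /Z1c /Z2c /Z3c /Z4c /Z5c /row5 /=;
  (apply: has_vder_eq; [has_vder_tac oU|]) => q /=;
  move: (yu q) (yw q) (yp q) (f q) (g q) (h q) => *; ring.
Qed.

(** The frame spans a graded nilpotent Lie algebra with layers of dimension 2, 1, 2. The vanishing
    brackets of the generators with Z4 and Z5 are the source of the Serre relations. *)
Lemma brackets q : U q ->
  [/\ lie (Z1 y) (Z2 y) q = Z3 y q, lie (Z1 y) (Z3 y) q = Z4 y q &
      lie (Z2 y) (Z3 y) q = Z5 y q] /\
  [/\ lie (Z1 y) (Z4 y) q = 0, lie (Z2 y) (Z4 y) q = 0, lie (Z1 y) (Z5 y) q = 0 &
      lie (Z2 y) (Z5 y) q = 0].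
Proof.
move=> Uq.
have h c := has_vder_Zc (has_vder_chart c (ix 0)) (has_vder_chart c (ix 1))
  (has_vder_chart c (ix 2)).
have [h11 h12 h13 h14 h15] := h (Z1c y).
have [h21 h22 h23 h24 h25] := h (Z2c y).
have [h31 h32 h33 h34 h35] := h (Z3c y).
have [h41 h42 h43 h44 h45] := h (@Z4c R).
have [h51 h52 h53 h54 h55] := h (@Z5c R).
have zero : chart_field y (fun _ _ => 0) q = 0.
  apply: (chart_inj uJ Uq) => a; rewrite (chart_fieldP uJ _ a Uq).
  by rewrite /pairing mul0mx mxE.
split; split; rewrite -?zero.
- apply: (lie_chart_field h21 h12 Uq); apply: forall_I5; rewrite /Z1c /Z2c /Z3c /row5 /=; ring.
- apply: (lie_chart_field h31 h13 Uq); apply: forall_I5; rewrite /Z1c /Z3c /Z4c /row5 /=; ring.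
- apply: (lie_chart_field h32 h23 Uq); apply: forall_I5; rewrite /Z2c /Z3c /Z5c /row5 /=; ring.
- apply: (lie_chart_field h41 h14 Uq); apply: forall_I5; rewrite /Z1c /Z4c /row5 /=; ring.
- apply: (lie_chart_field h42 h24 Uq); apply: forall_I5; rewrite /Z2c /Z4c /row5 /=; ring.
- apply: (lie_chart_field h51 h15 Uq); apply: forall_I5; rewrite /Z1c /Z5c /row5 /=; ring.
- apply: (lie_chart_field h52 h25 Uq); apply: forall_I5; rewrite /Z2c /Z5c /row5 /=; ring.
Qed.

End FlatModelBrackets.

Opaque lie.

Section FlatDistribution.
Variable R : realType.
Variables (U : set 'rV[R]_5) (y : 'I_5 -> 'rV[R]_5 -> R) (D : dist R).
Hypotheses (oU : open U) (sy : forall a, smooth_on U (y a))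
  (uJ : forall p, U p -> jac y p \in unitmx)
  (HD : forall q, U q -> D q = [set v | [/\ pairing (th1 y q) v = 0,
     pairing (th2 y q) v = 0 & pairing (th3 y q) v = 0]]).

Local Notation yu := (y (ix 0)).
Local Notation yw := (y (ix 1)).
Local Notation yp := (y (ix 2)).
Local Notation yt := (y (ix 3)).
Local Notation yv := (y (ix 4)).
Local Notation dy a v q := (pairing (grad (y a) q) v).

Lemma th_kernel q v : [/\ pairing (th1 y q) v = 0,
    pairing (th2 y q) v = 0 & pairing (th3 y q) v = 0] <->
  [/\ dy (ix 2) v q = yu q * dy (ix 1) v q - yw q * dy (ix 0) v q,
      dy (ix 3) v q = (yp q + yu q * yw q) * dy (ix 0) v q - yu q ^+ 2 * dy (ix 1) v q &
      dy (ix 4) v q = yw q ^+ 2 * dy (ix 0) v q + (yp q - yu q * yw q) * dy (ix 1) v q].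
Proof.
have [-> -> -> _ _] := th_pairing y q v.
generalize (yu q) (yw q) (yp q) (dy (ix 0) v q) (dy (ix 1) v q) (dy (ix 2) v q)
  (dy (ix 3) v q) (dy (ix 4) v q); move=> u w p du dw dp dt dv.
split=> [[e1 e2 e3]|[-> -> ->]]; last by split; field.
have e3' : dp = u * dw - w * du by lra.
by split=> //; move: e1 e2; rewrite e3'; lra.
Qed.

Lemma DP q v : U q -> D q v <->
  [/\ dy (ix 2) v q = yu q * dy (ix 1) v q - yw q * dy (ix 0) v q,
      dy (ix 3) v q = (yp q + yu q * yw q) * dy (ix 0) v q - yu q ^+ 2 * dy (ix 1) v q &
      dy (ix 4) v q = yw q ^+ 2 * dy (ix 0) v q + (yp q - yu q * yw q) * dy (ix 1) v q].
Proof. by move=> Uq; rewrite HD //; exact: th_kernel. Qed.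

Lemma dy_span k q a b : U q ->
  dy k (a *: Z1 y q + b *: Z2 y q) q = a * Z1c y k q + b * Z2c y k q.
Proof.
move=> Uq; rewrite pairingDr !pairingZr.
by congr (_ * _ + _ * _); exact: (chart_fieldP uJ _ _ Uq).
Qed.

Lemma D_span q v : U q -> D q v <-> v \in <<[:: Z1 y q; Z2 y q]>>%VS.
Proof.
move=> Uq; rewrite (DP v Uq); split=> [[e2 e3 e4]|/mem_span2[a [b ->]]].
  apply/mem_span2; exists (dy (ix 0) v q), (dy (ix 1) v q).
  apply: (chart_inj uJ Uq); apply: forall_I5;
    rewrite (dy_span _ _ _ Uq) /Z1c /Z2c /row5 /= ?e2 ?e3 ?e4;
    generalize (yu q) (yw q) (yp q) (dy (ix 0) v q) (dy (ix 1) v q); move=> u w p du dw; ring.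
rewrite !(dy_span _ a b Uq) /Z1c /Z2c /row5 /=.
by move: (yu q) (yw q) (yp q) => u w p; split; ring.
Qed.

Lemma section_Z1 : section_of U D (Z1 y).
Proof.
have [s1 _ _ _ _] := smooth_Z oU sy uJ; split=> // q Uq.
by apply/(D_span _ Uq)/mem_span2; exists 1, 0; rewrite scale1r scale0r addr0.
Qed.

Lemma section_Z2 : section_of U D (Z2 y).
Proof.
have [_ s2 _ _ _] := smooth_Z oU sy uJ; split=> // q Uq.
by apply/(D_span _ Uq)/mem_span2; exists 0, 1; rewrite scale1r scale0r add0r.
Qed.

Lemma section_scale f X : smooth_on U f -> section_of U D X ->
  section_of U D (fun q => f q *: X q).
Proof.
move=> sf [sX DX]; split=> [|q Uq]; first exact: smooth_scale_vfield.
by apply/(D_span _ Uq); apply: memvZ; apply/(D_span _ Uq)/DX.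
Qed.

(** For a section [Y] of D the derivatives of p, t, v are determined by those of u and w. These
    three relations are differentiated along an arbitrary [X]. *)
Lemma vder2_section W X Y q : open W -> W `<=` U -> W q ->
  smooth_vfield W X -> section_of W D Y ->
  let d0 := vder Y yu in let d1 := vder Y yw in
  [/\ vder X (vder Y yp) q = vder X yu q * d1 q + yu q * vder X d1 q
        - (vder X yw q * d0 q + yw q * vder X d0 q),
      vder X (vder Y yt) q = (vder X yp q + (vder X yu q * yw q + yu q * vder X yw q)) * d0 q
        + (yp q + yu q * yw q) * vder X d0 q
        - (2 * yu q * vder X yu q * d1 q + yu q ^+ 2 * vder X d1 q) &
      vder X (vder Y yv) q = 2 * yw q * vder X yw q * d0 q + yw q ^+ 2 * vder X d0 q
        + ((vder X yp q - (vder X yu q * yw q + yu q * vder X yw q)) * d1 q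
           + (yp q - yu q * yw q) * vder X d1 q)].
Proof.
move=> oW WU Wq sX [sY DY] d0 d1.
have syW a : smooth_on W (y a) by exact: smooth_subset WU (sy a).
have hy a : has_vder W X (y a) (vder X (y a)) by exact: has_vder_smooth.
have h0 : has_vder W X d0 (vder X d0) by apply: has_vder_smooth; exact: (smooth_vder oW sY (syW _)).
have h1 : has_vder W X d1 (vder X d1) by apply: has_vder_smooth; exact: (smooth_vder oW sY (syW _)).
have rel r (Wr : W r) := (DP (Y r) (WU r Wr)).1 (DY r Wr).
have r2 r : W r -> vder Y yp r = yu r * d1 r - yw r * d0 r by move=> /rel[].
have r3 r : W r -> vder Y yt r = (yp r + yu r * yw r) * d0 r - yu r ^+ 2 * d1 r by move=> /rel[].
have r4 r : W r -> vder Y yv r = yw r ^+ 2 * d0 r + (yp r - yu r * yw r) * d1 r by move=> /rel[].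
split.
- rewrite (eq_on_vder oW X r2 Wq); vder_calc oW Wq.
- rewrite (eq_on_vder oW X r3 Wq); vder_calc oW Wq.
- rewrite (eq_on_vder oW X r4 Wq); vder_calc oW Wq.
Qed.

(** The exterior derivatives of theta_1 and theta_2 are multiples of theta_3, so both forms vanish
    on brackets of sections. The verification expands the bracket in chart components. *)
Lemma bracket_sections W X Y q : open W -> W q -> U q ->
  section_of W D X -> section_of W D Y ->
  pairing (th1 y q) (lie X Y q) = 0 /\ pairing (th2 y q) (lie X Y q) = 0.
Proof.
move=> oW Wq Uq [sX DX] [sY DY].
(* The sections bring their own open set [W], while the chart lives on [U]. *)
have oWU : open (W `&` U) by exact: openI.
have sub : W `&` U `<=` U by move=> r [].
have sXW : smooth_vfield (W `&` U) X by move=> j; apply: smooth_subset (sX j) => r [].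
have sYW : smooth_vfield (W `&` U) Y by move=> j; apply: smooth_subset (sY j) => r [].
have secX : section_of (W `&` U) D X by split=> // r [Wr _]; exact: DX.
have secY : section_of (W `&` U) D Y by split=> // r [Wr _]; exact: DY.
have WUq : (W `&` U) q by [].
have L a : dy a (lie X Y q) q = vder X (vder Y (y a)) q - vder Y (vder X (y a)) q.
  exact: (vder_lie oWU sXW sYW (smooth_subset sub (sy a)) WUq).
have [a2 a3 a4] := vder2_section oWU sub WUq sXW secY.
have [b2 b3 b4] := vder2_section oWU sub WUq sYW secX.
have [c2 _ _] := (DP (X q) Uq).1 (DX q Wq); have [d2 _ _] := (DP (Y q) Uq).1 (DY q Wq).
have c2' : vder X yp q = yu q * vder X yw q - yw q * vder X yu q by exact: c2.
have d2' : vder Y yp q = yu q * vder Y yw q - yw q * vder Y yu q by exact: d2.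
have [-> -> _ _ _] := th_pairing y q (lie X Y q).
have K (u w p X0 X1 X2 Y0 Y1 Y2 XY0 XY1 YX0 YX1 A2 A3 A4 B2 B3 B4 l0 l1 l2 l3 l4 : R) :
    X2 = u * X1 - w * X0 -> Y2 = u * Y1 - w * Y0 ->
    A2 = X0 * Y1 + u * XY1 - (X1 * Y0 + w * XY0) ->
    A3 = (X2 + (X0 * w + u * X1)) * Y0 + (p + u * w) * XY0
         - (2 * u * X0 * Y1 + u ^+ 2 * XY1) ->
    A4 = 2 * w * X1 * Y0 + w ^+ 2 * XY0
         + ((X2 - (X0 * w + u * X1)) * Y1 + (p - u * w) * XY1) ->
    B2 = Y0 * X1 + u * YX1 - (Y1 * X0 + w * YX0) ->
    B3 = (Y2 + (Y0 * w + u * Y1)) * X0 + (p + u * w) * YX0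
         - (2 * u * Y0 * X1 + u ^+ 2 * YX1) ->
    B4 = 2 * w * Y1 * X0 + w ^+ 2 * YX0
         + ((Y2 - (Y0 * w + u * Y1)) * X1 + (p - u * w) * YX1) ->
    l0 = XY0 - YX0 -> l1 = XY1 - YX1 -> l2 = A2 - B2 -> l3 = A3 - B3 -> l4 = A4 - B4 ->
    6^-1 * (u * w - p) * l0 - 6^-1 * u ^+ 2 * l1 + 6^-1 * (2 * u) * l2 + 6^-1 * l3 = 0
    /\ 6^-1 * w ^+ 2 * l0 - 6^-1 * (p + u * w) * l1 + 6^-1 * (2 * w) * l2 + 6^-1 * l4 = 0.
  move=> -> -> -> -> -> -> -> -> -> -> -> -> ->; split; ring.
exact (K _ _ _ _ _ _ _ _ _ _ _ _ _ _ _ _ _ _ _ _ _ _ _ _ c2' d2' a2 a3 a4 b2 b3 b4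
  (L (ix 0)) (L (ix 1)) (L (ix 2)) (L (ix 3)) (L (ix 4))).
Qed.

(** [bracket_dist] is spanned by brackets alone and does not contain D by definition. Since Z1 u =
    1, bracketing Z1 with u Z1 recovers Z1. *)
Lemma lie_Z1_uZ1 q : U q -> lie (Z1 y) (fun r => yu r *: Z1 y r) q = Z1 y q.
Proof.
move=> Uq; have [s1 _ _ _ _] := smooth_Z oU sy uJ.
rewrite (lie_scaler oU (Z1 y) s1 (sy _) Uq) lie_self scaler0 add0r.
by rewrite [vder _ _ _](chart_fieldP uJ _ _ Uq) scale1r.
Qed.

Lemma lie_Z2_wZ2 q : U q -> lie (Z2 y) (fun r => yw r *: Z2 y r) q = Z2 y q.
Proof.
move=> Uq; have [_ s2 _ _ _] := smooth_Z oU sy uJ.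
rewrite (lie_scaler oU (Z2 y) s2 (sy _) Uq) lie_self scaler0 add0r.
by rewrite [vder _ _ _](chart_fieldP uJ _ _ Uq) scale1r.
Qed.

Lemma bracket_distP q : U q ->
  bracket_dist D D q = [set v | v \in <<[:: Z1 y q; Z2 y q; Z3 y q]>>%VS].
Proof.
move=> Uq; apply/seteqP; split=> [v|v /mem_span3[a [b [c ->]]]].
  apply: vspan_sub => _ [W [X [Y [oW Wq sX sY ->]]]].
  have [e1 e2] := bracket_sections oW Wq Uq sX sY.
  apply/mem_span3; exists (pairing (th4 y q) (lie X Y q)), (pairing (th5 y q) (lie X Y q)),
    (- pairing (th3 y q) (lie X Y q)).
  by rewrite {1}(th_Z uJ (lie X Y q) Uq) e1 e2 !scale0r !subr0 scaleNr.
have [[b12 _ _] _] := brackets oU sy uJ Uq.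
have i1 : bracket_dist D D q (Z1 y q).
  rewrite -(lie_Z1_uZ1 Uq); apply: vspan_in; exists U, (Z1 y), (fun r => yu r *: Z1 y r).
  exact (And5 oU Uq section_Z1 (section_scale (sy _) section_Z1) erefl).
have i2 : bracket_dist D D q (Z2 y q).
  rewrite -(lie_Z2_wZ2 Uq); apply: vspan_in; exists U, (Z2 y), (fun r => yw r *: Z2 y r).
  exact (And5 oU Uq section_Z2 (section_scale (sy _) section_Z2) erefl).
have i3 : bracket_dist D D q (Z3 y q).
  rewrite -b12; apply: vspan_in; exists U, (Z1 y), (Z2 y).
  exact (And5 oU Uq section_Z1 section_Z2 erefl).
by apply: vspanD; [exact: vspan_comb|exact: vspanZ].
Qed.

Lemma bracket_dist_full q : U q -> bracket_dist (bracket_dist D D) D q = setT.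
Proof.
move=> Uq; apply/seteqP; split=> // v _.
have [s1 s2 s3 _ _] := smooth_Z oU sy uJ.
have sec X : smooth_vfield U X ->
    (forall r, U r -> X r \in <<[:: Z1 y r; Z2 y r; Z3 y r]>>%VS) ->
    section_of U (bracket_dist D D) X.
  by move=> sX HX; split=> // r Ur; rewrite bracket_distP //; exact: HX.
have e1 : section_of U (bracket_dist D D) (Z1 y).
  by apply: sec => // r Ur; apply: memv_span; rewrite !inE eqxx.
have e2 : section_of U (bracket_dist D D) (Z2 y).
  by apply: sec => // r Ur; apply: memv_span; rewrite !inE eqxx orbT.
have e3 : section_of U (bracket_dist D D) (Z3 y).
  by apply: sec => // r Ur; apply: memv_span; rewrite !inE eqxx !orbT.
have [[b12 b13 b23] _] := brackets oU sy uJ Uq.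
have gen X Y : section_of U (bracket_dist D D) X -> section_of U D Y ->
    bracket_dist (bracket_dist D D) D q (lie X Y q).
  by move=> sX sY; apply: vspan_in; exists U, X, Y.
(* Every vector of the frame expansion is turned into a bracket. For Z4 and Z5 the order is then
   reversed, because the first argument must be the section of [D, D]. *)
rewrite (th_Z uJ v Uq) -{1}(lie_Z1_uZ1 Uq) -{1}(lie_Z2_wZ2 Uq) -{1}b12 -{1}b13 -{1}b23.
rewrite (lie_anti (Z1 y) (Z3 y)) (lie_anti (Z2 y) (Z3 y)) -!scaleNr.
have S1 := section_Z1; have S2 := section_Z2.
have S1' := section_scale (sy (ix 0)) S1; have S2' := section_scale (sy (ix 1)) S2.
have g1 := gen _ _ e1 S1'; have g2 := gen _ _ e2 S2'; have g3 := gen _ _ e1 S2.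
have g4 := gen _ _ e3 S1; have g5 := gen _ _ e3 S2.
rewrite !scalerN -!scaleNr.
exact (vspanD (vspanD (vspanD (vspan_comb _ _ g1 g2) (vspanZ _ g3)) (vspanZ _ g4)) (vspanZ _ g5)).
Qed.

Lemma free_Z q : U q -> free [:: Z1 y q; Z2 y q; Z3 y q].
Proof.
move=> Uq.
have dual := th_dual uJ Uq.
have H := @free_dual R 'rV[R]_5 3 [tuple Z1 y q; Z2 y q; Z3 y q]
  (fun j v => nth 0 [:: pairing (th4 y q) v; pairing (th5 y q) v; - pairing (th3 y q) v] j).
apply: H.
  move=> j F k; case: j => [[|[|[|j]]] hj] //=; rewrite pairing_sumr -?sumrN;
    by apply: eq_bigr => i _; rewrite pairingZr ?mulrN.
have PN a v : pairing a (- v) = - pairing a v :> R by rewrite -scaleN1r pairingZr mulN1r.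
have d33 := dual (ix 2) (ix 2); have d31 := dual (ix 2) (ix 3); have d32 := dual (ix 2) (ix 4).
have d43 := dual (ix 3) (ix 2); have d41 := dual (ix 3) (ix 3); have d42 := dual (ix 3) (ix 4).
have d53 := dual (ix 4) (ix 2); have d51 := dual (ix 4) (ix 3); have d52 := dual (ix 4) (ix 4).
rewrite /row5 /= ?PN in d33 d31 d32 d43 d41 d42 d53 d51 d52.
move=> [[|[|[|i]]] hi] [[|[|[|j]]] hj] //=; rewrite ?d41 ?d42 ?d51 ?d52 ?d31 ?d32 ?d33 ?oppr0 //.
- by apply/eqP; rewrite -oppr_eq0 d43.
- by apply/eqP; rewrite -oppr_eq0 d53.
Qed.

Lemma free_Z12 q : U q -> free [:: Z1 y q; Z2 y q].
Proof.
by move=> /free_Z; rewrite -[[:: _; _; _]]/([:: Z1 y q; Z2 y q] ++ [:: Z3 y q]) => /catl_free.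
Qed.

Lemma free_th q : U q -> free [:: th1 y q; th2 y q; th3 y q; th4 y q; th5 y q].
Proof.
move=> Uq; apply: (@free_dual _ _ 5 [tuple th1 y q; th2 y q; th3 y q; th4 y q; th5 y q]
  (fun j a => pairing a (row5 (- Z4 y q) (- Z5 y q) (- Z3 y q) (Z1 y q) (Z2 y q) j))).
  move=> j F k; elim/big_rec2: _ => [|i a b _ <-]; first by rewrite /pairing mulmx0 mxE.
  by rewrite pairingD pairingZ.
move=> i j; rewrite -(th_dual uJ Uq i j); congr (pairing _ _).
by case: i => [[|[|[|[|[|i]]]]] hi].
Qed.

Lemma cartan_flat : cartan_structure U (th1 y) (th2 y) (th3 y) (th4 y) (th5 y)
  (fun=> 0) (fun=> 0) (fun=> 0) (fun=> 0) (fun=> 0) (fun=> 0) (fun=> 0).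
Proof.
have w0 (a : 'cV[R]_5) : wedge a 0 = 0 by rewrite /wedge trmx0 mulmx0 mul0mx subr0.
move=> q Uq; have [-> -> -> -> ->] := ext_d_th oU sy Uq.
by split; rewrite /= ?scaler0 ?addr0 !w0 ?scaler0 ?subr0 ?addr0 ?add0r.
Qed.

(** All coefficients depending on u, w, p cancel, so the class contains a constant metric. The
    factor is negative, which is harmless since rescalings of either sign are allowed. *)
Lemma nurowski_flat q :
  nurowski_metric (th1 y) (th2 y) (th3 y) (th4 y) (th5 y) q
  = - 3^-1 *: (jac y q *m flat_eta R *m (jac y q)^T).
Proof.
apply/matrixP => i j.
have -> : (- 3^-1 *: (jac y q *m flat_eta R *m (jac y q)^T)) i j
  = - 3^-1 * \sum_b (\sum_a jac y q i a * flat_eta R a b) * jac y q j b.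
  rewrite !mxE; congr (_ * _); apply: eq_bigr => b _; rewrite !mxE.
  by congr (_ * _).
have J k a : jac y q k a = vder (fun=> delta_mx 0 k) (y a) q by rewrite -grad_vder !mxE.
have E (A B C : 'M[R]_5) : (2 *: A - 2 *: B + (4 / 3) *: C) i j
  = 2 * A i j - 2 * B i j + 4 / 3 * C i j by rewrite !mxE.
rewrite /nurowski_metric E !sprodE !chart_formE !sum_I5 !J.
rewrite !mxE /th1c /th2c /th3c /th4c /th5c /row5 /=.
move: (vder (fun=> delta_mx 0 i)) (vder (fun=> delta_mx 0 j)) => Vi Vj.
move: (yu q) (yw q) (yp q) (Vi yu q) (Vi yw q) (Vi yp q) (Vi yt q) (Vi yv q)
  (Vj yu q) (Vj yw q) (Vj yp q) (Vj yt q) (Vj yv q) => u w p iu iw ip it iv ju jw jp jt jv.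
by field.
Qed.

End FlatDistribution.

Opaque vder.

(** * The symmetry equations *)

Section Prolongation.
Variable R : realType.
Variables (U : set 'rV[R]_5) (y : 'I_5 -> 'rV[R]_5 -> R).
Hypotheses (oU : open U) (sy : forall a, smooth_on U (y a))
  (uJ : forall p, U p -> jac y p \in unitmx).

Local Notation o1 := (vder (Z1 y)).
Local Notation o2 := (vder (Z2 y)).
Implicit Types (S F G : 'rV[R]_5 -> R).

Lemma smooth_o1 S : smooth_on U S -> smooth_on U (o1 S).
Proof. by move=> sS; have [s1 _ _ _ _] := smooth_Z oU sy uJ; exact: smooth_vder. Qed.

Lemma smooth_o2 S : smooth_on U S -> smooth_on U (o2 S).
Proof. by move=> sS; have [_ s2 _ _ _] := smooth_Z oU sy uJ; exact: smooth_vder. Qed.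

Lemma vder_comb3 X (a b c : R) A B C q : smooth_on U A -> smooth_on U B -> smooth_on U C ->
  U q -> vder X (fun r => a * A r + b * B r + c * C r) q
         = a * vder X A q + b * vder X B q + c * vder X C q.
Proof.
move=> sA sB sC Uq.
have hA := has_vder_smooth X sA; have hB := has_vder_smooth X sB.
have hC := has_vder_smooth X sC.
by vder_calc oU Uq; rewrite !mul0r !add0r.
Qed.

Lemma vder_Z3 S q : smooth_on U S -> U q -> vder (Z3 y) S q = o1 (o2 S) q - o2 (o1 S) q.
Proof.
move=> sS Uq; have [s1 s2 _ _ _] := smooth_Z oU sy uJ.
have [[b12 _ _] _] := brackets oU sy uJ Uq.
by rewrite -(vder_lie oU s1 s2 sS Uq) !vder_pair b12.
Qed.

Lemma vder_Z4 S q : smooth_on U S -> U q ->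
  vder (Z4 y) S q = 1 * o1 (o1 (o2 S)) q + -2 * o1 (o2 (o1 S)) q + 1 * o2 (o1 (o1 S)) q.
Proof.
move=> sS Uq; have [s1 _ s3 _ _] := smooth_Z oU sy uJ.
have [[_ b13 _] _] := brackets oU sy uJ Uq.
have -> : vder (Z4 y) S q = o1 (vder (Z3 y) S) q - vder (Z3 y) (o1 S) q.
  by rewrite -(vder_lie oU s1 s3 sS Uq) !vder_pair b13.
have sS1 := smooth_o1 sS; have sS2 := smooth_o2 sS.
rewrite (vder_Z3 sS1 Uq).
have E r : U r -> vder (Z3 y) S r = 1 * o1 (o2 S) r + -1 * o2 (o1 S) r + 0 * S r.
  by move=> Ur; rewrite (vder_Z3 sS Ur) mul1r mulN1r mul0r addr0.
rewrite (eq_on_vder oU (Z1 y) E Uq).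
rewrite (vder_comb3 (Z1 y) 1 (-1) 0 (smooth_o1 sS2) (smooth_o2 sS1) sS Uq).
have K (A B C e : R) : 1 * A + -1 * B + 0 * e - (B - C) = 1 * A + -2 * B + 1 * C by ring.
exact: (K _ _ _ _).
Qed.

Lemma vder_Z5 S q : smooth_on U S -> U q ->
  vder (Z5 y) S q = 2 * o2 (o1 (o2 S)) q + -1 * o2 (o2 (o1 S)) q + -1 * o1 (o2 (o2 S)) q.
Proof.
move=> sS Uq; have [_ s2 s3 _ _] := smooth_Z oU sy uJ.
have [[_ _ b23] _] := brackets oU sy uJ Uq.
have -> : vder (Z5 y) S q = o2 (vder (Z3 y) S) q - vder (Z3 y) (o2 S) q.
  by rewrite -(vder_lie oU s2 s3 sS Uq) !vder_pair b23.
have sS1 := smooth_o1 sS; have sS2 := smooth_o2 sS.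
rewrite (vder_Z3 sS2 Uq).
have E r : U r -> vder (Z3 y) S r = 1 * o1 (o2 S) r + -1 * o2 (o1 S) r + 0 * S r.
  by move=> Ur; rewrite (vder_Z3 sS Ur) mul1r mulN1r mul0r addr0.
rewrite (eq_on_vder oU (Z2 y) E Uq).
rewrite (vder_comb3 (Z2 y) 1 (-1) 0 (smooth_o1 sS2) (smooth_o2 sS1) sS Uq).
have K (A B C e : R) : 1 * A + -1 * B + 0 * e - (C - A) = 2 * A + -1 * B + -1 * C by ring.
exact: (K _ _ _ _).
Qed.

(* The Serre relations of the negative part of g_2, as words in [o1], [o2]. *)
Lemma serre_relations S q : smooth_on U S -> U q ->
  [/\ o1 (o1 (o1 (o2 S))) q - 3 * o1 (o1 (o2 (o1 S))) q + 3 * o1 (o2 (o1 (o1 S))) q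
        - o2 (o1 (o1 (o1 S))) q = 0,
      - 2 * o2 (o1 (o2 (o1 S))) q + o2 (o2 (o1 (o1 S))) q - o1 (o1 (o2 (o2 S))) q
        + 2 * o1 (o2 (o1 (o2 S))) q = 0 &
      3 * o2 (o2 (o1 (o2 S))) q - o2 (o2 (o2 (o1 S))) q - 3 * o2 (o1 (o2 (o2 S))) q
        + o1 (o2 (o2 (o2 S))) q = 0].
Proof.
move=> sS Uq; have [s1 s2 _ s4 s5] := smooth_Z oU sy uJ.
have [_ [b14 b24 _ b25]] := brackets oU sy uJ Uq.
have p0 (a : 'cV[R]_5) : pairing a 0 = 0 by rewrite /pairing mul0mx mxE.
(* The brackets [Z1, Z4], [Z2, Z4] and [Z2, Z5] vanish; applied to [S] and expanded into words they
   give the three relations. *)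
have c14 := vder_lie oU s1 s4 sS Uq; rewrite vder_pair b14 p0 in c14.
have c24 := vder_lie oU s2 s4 sS Uq; rewrite vder_pair b24 p0 in c24.
have c25 := vder_lie oU s2 s5 sS Uq; rewrite vder_pair b25 p0 in c25.
have sS1 := smooth_o1 sS; have sS2 := smooth_o2 sS.
have sS11 := smooth_o1 sS1; have sS21 := smooth_o2 sS1.
have sS12 := smooth_o1 sS2; have sS22 := smooth_o2 sS2.
have E4 r (Ur : U r) := vder_Z4 sS Ur.
have E5 r (Ur : U r) := vder_Z5 sS Ur.
have comb4 X := vder_comb3 X 1 (-2) 1 (smooth_o1 sS12) (smooth_o1 sS21) (smooth_o2 sS11) Uq.
have comb5 X := vder_comb3 X 2 (-1) (-1) (smooth_o2 sS12) (smooth_o2 sS21) (smooth_o1 sS22) Uq.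
rewrite (eq_on_vder oU (Z1 y) E4 Uq) (comb4 (Z1 y)) (vder_Z4 sS1 Uq) in c14.
rewrite (eq_on_vder oU (Z2 y) E4 Uq) (comb4 (Z2 y)) (vder_Z4 sS2 Uq) in c24.
rewrite (eq_on_vder oU (Z2 y) E5 Uq) (comb5 (Z2 y)) (vder_Z5 sS2 Uq) in c25.
split.
- have K (A B C E : R) : 0 = 1 * A + -2 * B + 1 * C - (1 * B + -2 * C + 1 * E) ->
    A - 3 * B + 3 * C - E = 0 by move=> H; rewrite [RHS]H; ring.
  exact: K c14.
- have K (A B C E F : R) : 0 = 1 * F + -2 * A + 1 * B - (1 * C + -2 * E + 1 * F) ->
    - 2 * A + B - C + 2 * E = 0 by move=> H; rewrite [RHS]H; ring.
  exact: K c24.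
- have K (A B C E : R) : 0 = 2 * A + -1 * B + -1 * C - (2 * C + -1 * A + -1 * E) ->
    3 * A - B - 3 * C + E = 0 by move=> H; rewrite [RHS]H; ring.
  exact: K c25.
Qed.

Definition eqc F (c : R) G := forall q, U q -> F q = c * G q.
Definition eq0 F := forall q, U q -> F q = 0.

Lemma eq0_vder X F : eq0 F -> eq0 (vder X F).
Proof.
move=> F0 q Uq; rewrite (eq_on_vder oU X F0 Uq).
exact (has_vder_val (has_vder_cst oU X 0) Uq).
Qed.

Lemma eqc_vder X F c G : smooth_on U G -> eqc F c G -> eqc (vder X F) c (vder X G).
Proof.
move=> sG FG q Uq; rewrite (eq_on_vder oU X FG Uq).
have hG := has_vder_smooth X sG.
by vder_calc oU Uq; rewrite mul0r add0r.
Qed.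

Variables (p0 : 'rV[R]_5) (eps : R).
Hypotheses (Up0 : U p0)
  (box : forall q : 'rV[R]_5, (forall j, `|q 0 j - p0 0 j| < eps) <-> U q).

(** D is bracket generating: derivatives along Z3, Z4, Z5 are combinations of words in those along
    Z1 and Z2, so every partial derivative of [S] vanishes on the box. *)
Lemma const_of_Z S : smooth_on U S -> eq0 (o1 S) -> eq0 (o2 S) ->
  forall q, U q -> S q = S p0.
Proof.
move=> sS S1 S2.
have S3 : eq0 (vder (Z3 y) S).
  by move=> q Uq; rewrite (vder_Z3 sS Uq) (eq0_vder (Z1 y) S2 Uq) (eq0_vder (Z2 y) S1 Uq) subr0.
have S4 : eq0 (vder (Z4 y) S).
  move=> q Uq; rewrite (vder_Z4 sS Uq) (eq0_vder (Z1 y) (eq0_vder (Z1 y) S2) Uq)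
    (eq0_vder (Z1 y) (eq0_vder (Z2 y) S1) Uq) (eq0_vder (Z2 y) (eq0_vder (Z1 y) S1) Uq).
  by rewrite !mulr0 !addr0.
have S5 : eq0 (vder (Z5 y) S).
  move=> q Uq; rewrite (vder_Z5 sS Uq) (eq0_vder (Z2 y) (eq0_vder (Z1 y) S2) Uq)
    (eq0_vder (Z2 y) (eq0_vder (Z2 y) S1) Uq) (eq0_vder (Z1 y) (eq0_vder (Z2 y) S2) Uq).
  by rewrite !mulr0 !addr0.
move=> q Uq; apply: (@box_const R S p0 eps) => [r /box Ur i|]; last by apply/box.
split; first exact: smooth_derivable sS Ur.
have -> : pder i S r = vder (fun=> delta_mx 0 i) S r by rewrite -grad_vder mxE.
rewrite vder_pair (th_Z uJ (delta_mx 0 i) Ur) -!scaleNr !pairingDr !pairingZr.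
have e1 : pairing (grad S r) (Z1 y r) = 0 by rewrite -vder_pair; exact: S1.
have e2 : pairing (grad S r) (Z2 y r) = 0 by rewrite -vder_pair; exact: S2.
have e3 : pairing (grad S r) (Z3 y r) = 0 by rewrite -vder_pair; exact: S3.
have e4 : pairing (grad S r) (Z4 y r) = 0 by rewrite -vder_pair; exact: S4.
have e5 : pairing (grad S r) (Z5 y r) = 0 by rewrite -vder_pair; exact: S5.
by rewrite e1 e2 e3 e4 e5 !mulr0 !addr0.
Qed.

(** By this, exhibiting one polynomial [P] with the prescribed derivatives along Z1 and Z2
    determines the unknown up to a constant. *)
Lemma integrate S P : smooth_on U S -> smooth_on U P ->
  (forall q, U q -> o1 S q = o1 P q) -> (forall q, U q -> o2 S q = o2 P q) ->
  exists k, forall q, U q -> S q = k + P q.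
Proof.
move=> sS sP S1 S2.
have hS X := has_vder_smooth X sS; have hP X := has_vder_smooth X sP.
have D X q : U q -> vder X (fun r => S r - P r) q = vder X S q - vder X P q.
  move=> Uq; have hS' := hS X; have hP' := hP X; vder_calc oU Uq.
exists (S p0 - P p0) => q Uq.
rewrite -(@const_of_Z (fun r => S r - P r) (smoothB oU sS sP) _ _ q Uq) ?subrK //.
  by move=> r Ur; rewrite (D _ _ Ur) S1 // subrr.
by move=> r Ur; rewrite (D _ _ Ur) S2 // subrr.
Qed.

End Prolongation.

Opaque Z1 Z2.

(** * Closing and integrating the symmetry equations *)

Section Solutions.
Variable R : realType.
(* The unknowns are the prolonged state f, g, h = Z1 f, h_i = Zi h, h_ij = Zi Zj h,
   a = Z1 Z2 Z1 h, b = Z2 Z1 Z2 h, e = Z2 a, e_i = Zi e; each is an integration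
   constant plus the polynomial below, whose Z1- and Z2-derivatives are the
   unknowns already determined. *)
Variables (kf kg kh kh1 kh2 k11 k12 k21 k22 ka kb ke ke1 ke2 u w p t v : R).

Definition sol_e :=
  ke1 * u + ke2 * w.
Definition sol_a :=
  ke * w + ke1 * (2^-1 * u * w + 2^-1 * p) + ke2 * (2^-1 * w ^+ 2).
Definition sol_b :=
  ke * u + ke1 * (2^-1 * u ^+ 2) + ke2 * (2^-1 * u * w - 2^-1 * p).
Definition sol_h11 :=
  ka * (- (3 * w)) + ke * (- ((3 / 2) * w ^+ 2))
  + ke1 * (- (2^-1 * u * w ^+ 2) - w * p - 2^-1 * v) + ke2 * (- (2^-1 * w ^+ 3)).
Definition sol_h12 :=
  ka * (2 * u) + kb * w + ke * ((3 / 2) * u * w - 2^-1 * p)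
  + ke1 * (2^-1 * u ^+ 2 * w + 2^-1 * u * p + 2^-1 * t)
  + ke2 * (2^-1 * u * w ^+ 2 - 2^-1 * w * p).
Definition sol_h21 :=
  ka * u + kb * (2 * w) + ke * ((3 / 2) * u * w + 2^-1 * p)
  + ke1 * (2^-1 * u ^+ 2 * w + 2^-1 * u * p)
  + ke2 * (2^-1 * u * w ^+ 2 - 2^-1 * w * p - 2^-1 * v).
Definition sol_h22 :=
  kb * (- (3 * u)) + ke * (- ((3 / 2) * u ^+ 2)) + ke1 * (- (2^-1 * u ^+ 3))
  + ke2 * (- (2^-1 * u ^+ 2 * w) + u * p + 2^-1 * t).
Definition sol_h1 :=
  k11 * u + k21 * w + ka * (- (u * w) + 2 * p) + kb * (w ^+ 2) + ke * (w * p - 2^-1 * v)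
  + ke1 * (- (2^-1 * u * v) + 2^-1 * p ^+ 2) + ke2 * (- (2^-1 * w * v)).
Definition sol_h2 :=
  k12 * u + k22 * w + ka * (u ^+ 2) + kb * (- (u * w) - 2 * p) + ke * (- (u * p) + 2^-1 * t)
  + ke1 * (2^-1 * u * t) + ke2 * (2^-1 * w * t + 2^-1 * p ^+ 2).
Definition sol_h :=
  kh1 * u + kh2 * w + k11 * (2^-1 * u ^+ 2) + k12 * (2^-1 * u * w + 2^-1 * p)
  + k21 * (2^-1 * u * w - 2^-1 * p) + k22 * (2^-1 * w ^+ 2)
  + ka * ((3 / 2) * u * p + 2^-1 * t) + kb * (- ((3 / 2) * w * p) - 2^-1 * v)
  + ke * (- (2^-1 * u * v) + 2^-1 * w * t - 4^-1 * p ^+ 2)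
  + ke1 * (- (4^-1 * u ^+ 2 * v) + 4^-1 * u * w * t + 4^-1 * u * p ^+ 2 + 4^-1 * p * t)
  + ke2 * (- (4^-1 * u * w * v) + 4^-1 * w ^+ 2 * t + 4^-1 * w * p ^+ 2 + 4^-1 * p * v).
Definition sol_f :=
  kh * u + kh1 * (2^-1 * u ^+ 2) + kh2 * (2^-1 * u * w - 2^-1 * p) + k11 * (6^-1 * u ^+ 3)
  + k12 * (6^-1 * u ^+ 2 * w + 6^-1 * u * p + 3^-1 * t)
  + k21 * (6^-1 * u ^+ 2 * w - 3^-1 * u * p - 6^-1 * t)
  + k22 * (6^-1 * u * w ^+ 2 - 6^-1 * w * p + 6^-1 * v)
  + ka * (2^-1 * u ^+ 2 * p + 2^-1 * u * t)
  + kb * (- (2^-1 * u * w * p) - 2^-1 * u * v + 2^-1 * p ^+ 2)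
  + ke * (- (4^-1 * u ^+ 2 * v) + 4^-1 * u * w * t - 4^-1 * p * t)
  + ke1 * (- (12^-1 * u ^+ 3 * v) + 12^-1 * u ^+ 2 * w * t + 12^-1 * u ^+ 2 * p ^+ 2 + 12^-1 * u * p * t + 12^-1 * t ^+ 2)
  + ke2 * (- (12^-1 * u ^+ 2 * w * v) + 12^-1 * u * w ^+ 2 * t + 12^-1 * u * w * p ^+ 2 + 6^-1 * u * p * v - 12^-1 * w * p * t - 12^-1 * p ^+ 3 + 12^-1 * t * v).
Definition sol_g :=
  kh * w + kh1 * (2^-1 * u * w + 2^-1 * p) + kh2 * (2^-1 * w ^+ 2)
  + k11 * (6^-1 * u ^+ 2 * w + 6^-1 * u * p - 6^-1 * t)
  + k12 * (6^-1 * u * w ^+ 2 + 3^-1 * w * p + 6^-1 * v)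
  + k21 * (6^-1 * u * w ^+ 2 - 6^-1 * w * p - 3^-1 * v) + k22 * (6^-1 * w ^+ 3)
  + ka * (2^-1 * u * w * p + 2^-1 * w * t + 2^-1 * p ^+ 2)
  + kb * (- (2^-1 * w ^+ 2 * p) - 2^-1 * w * v)
  + ke * (- (4^-1 * u * w * v) + 4^-1 * w ^+ 2 * t - 4^-1 * p * v)
  + ke1 * (- (12^-1 * u ^+ 2 * w * v) + 12^-1 * u * w ^+ 2 * t + 12^-1 * u * w * p ^+ 2 - 12^-1 * u * p * v + 6^-1 * w * p * t + 12^-1 * p ^+ 3 + 12^-1 * t * v)
  + ke2 * (- (12^-1 * u * w ^+ 2 * v) + 12^-1 * w ^+ 3 * t + 12^-1 * w ^+ 2 * p ^+ 2 + 12^-1 * w * p * v + 12^-1 * v ^+ 2).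

End Solutions.

Section ProlongedSystem.
Variable R : realType.
Variables (U : set 'rV[R]_5) (y : 'I_5 -> 'rV[R]_5 -> R).
Hypotheses (oU : open U) (sy : forall a, smooth_on U (y a))
  (uJ : forall p, U p -> jac y p \in unitmx).

Local Notation o1 := (vder (Z1 y)).
Local Notation o2 := (vder (Z2 y)).
Local Notation eqc := (eqc U).
Local Notation eq0 := (eq0 U).
Local Notation so1 := (smooth_o1 oU sy uJ).
Local Notation so2 := (smooth_o2 oU sy uJ).
Implicit Types (S F G h : 'rV[R]_5 -> R).

Let V1 F (H : eq0 F) := eq0_vder oU (Z1 y) H.
Let V2 F (H : eq0 F) := eq0_vder oU (Z2 y) H.
Let C1 F c G (sG : smooth_on U G) (H : eqc F c G) := eqc_vder oU (Z1 y) sG H.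
Let C2 F c G (sG : smooth_on U G) (H : eqc F c G) := eqc_vder oU (Z2 y) sG H.

(** Six of the eight third-order words in [h], expressed by the other two, Z1 Z2 Z1 h and Z2 Z1 Z2
    h. *)
Definition third_order h :=
  [/\ eq0 (o1 (o1 (o1 h))), eq0 (o2 (o2 (o2 h))) &
      eqc (o1 (o1 (o2 h))) 2 (o1 (o2 (o1 h)))] /\
  [/\ eqc (o2 (o1 (o1 h))) (-3) (o1 (o2 (o1 h))),
      eqc (o2 (o2 (o1 h))) 2 (o2 (o1 (o2 h))) &
      eqc (o1 (o2 (o2 h))) (-3) (o2 (o1 (o2 h)))].

(** The Serre relations for [F] and for [G] are six linear equations. A word whose first acting
    letter is Z2 vanishes on [F], one whose first acting letter is Z1 vanishes on [G], and all
    others are third-order words in h = Z1 F = Z2 G, so six of these eight words are determined. *)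
Lemma third_order_o1 F G : smooth_on U F -> smooth_on U G ->
  eq0 (o2 F) -> eq0 (o1 G) -> eqc (o2 G) 1 (o1 F) -> third_order (o1 F).
Proof.
move=> sF sG F2 G1 GF.
have sh := so1 sF; have sh1 := so1 sh; have sh2 := so2 sh.
(* The digits spell words in Z1 and Z2 from the outside in: [f1112] stands for Z1 Z1 Z1 Z2 F. *)
have K (h111 h112 h121 h211 h212 h221 h122 h222 f1112 f1122 f1212 f2212 f2122 f1222
     g1112 g1121 g1211 g2111 g2121 g2211 g1122 g1212 g2212 g2221 g2122 g1222 : R) :
    f1112 = 0 -> f1122 = 0 -> f1212 = 0 -> f2212 = 0 -> f2122 = 0 -> f1222 = 0 ->
    g1112 = 1 * h111 -> g1122 = 1 * h112 -> g1212 = 1 * h121 -> g2212 = 1 * h221 ->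
    g2122 = 1 * h212 -> g1222 = 1 * h122 -> g1121 = 0 -> g1211 = 0 -> g2111 = 0 ->
    g2121 = 0 -> g2211 = 0 -> g2221 = 0 ->
    f1112 - 3 * h112 + 3 * h121 - h211 = 0 -> - 2 * h212 + h221 - f1122 + 2 * f1212 = 0 ->
    3 * f2212 - h222 - 3 * f2122 + f1222 = 0 ->
    g1112 - 3 * g1121 + 3 * g1211 - g2111 = 0 ->
    - 2 * g2121 + g2211 - g1122 + 2 * g1212 = 0 ->
    3 * g2212 - g2221 - 3 * g2122 + g1222 = 0 ->
  [/\ h111 = 0, h222 = 0 & h112 = 2 * h121] /\
  [/\ h211 = -3 * h121, h221 = 2 * h212 & h122 = -3 * h212].
  by move=> -> -> -> -> -> -> -> -> -> -> -> -> -> -> -> -> -> -> *; split; split; lra.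
have H q (Uq : U q) : [/\ o1 (o1 (o1 (o1 F))) q = 0, o2 (o2 (o2 (o1 F))) q = 0 &
      o1 (o1 (o2 (o1 F))) q = 2 * o1 (o2 (o1 (o1 F))) q] /\
    [/\ o2 (o1 (o1 (o1 F))) q = -3 * o1 (o2 (o1 (o1 F))) q,
      o2 (o2 (o1 (o1 F))) q = 2 * o2 (o1 (o2 (o1 F))) q &
      o1 (o2 (o2 (o1 F))) q = -3 * o2 (o1 (o2 (o1 F))) q].
  have [f14 f24 f25] := serre_relations oU sy uJ sF Uq.
  have [g14 g24 g25] := serre_relations oU sy uJ sG Uq.
  exact (K _ _ _ _ _ _ _ _ _ _ _ _ _ _ _ _ _ _ _ _ _ _ _ _ _ _
    (V1 (V1 (V1 F2)) Uq) (V1 (V1 (V2 F2)) Uq) (V1 (V2 (V1 F2)) Uq) (V2 (V2 (V1 F2)) Uq)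
    (V2 (V1 (V2 F2)) Uq) (V1 (V2 (V2 F2)) Uq)
    (C1 (so1 sh1) (C1 sh1 (C1 sh GF)) Uq) (C1 (so1 sh2) (C1 sh2 (C2 sh GF)) Uq)
    (C1 (so2 sh1) (C2 sh1 (C1 sh GF)) Uq) (C2 (so2 sh1) (C2 sh1 (C1 sh GF)) Uq)
    (C2 (so1 sh2) (C1 sh2 (C2 sh GF)) Uq) (C1 (so2 sh2) (C2 sh2 (C2 sh GF)) Uq)
    (V1 (V1 (V2 G1)) Uq) (V1 (V2 (V1 G1)) Uq) (V2 (V1 (V1 G1)) Uq)
    (V2 (V1 (V2 G1)) Uq) (V2 (V2 (V1 G1)) Uq) (V2 (V2 (V2 G1)) Uq)
    f14 f24 f25 g14 g24 g25).
split; split=> q Uq; have [[e1 e2 e3] [e4 e5 e6]] := H q Uq.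
- exact e1.
- exact e2.
- exact e3.
- exact e4.
- exact e5.
- exact e6.
Qed.

Definition higher_order h :=
  [/\ eq0 (o1 (o1 (o2 (o1 h)))), eq0 (o2 (o2 (o1 (o2 h)))) &
      eqc (o1 (o2 (o1 (o2 h)))) 1 (o2 (o1 (o2 (o1 h))))] /\
  [/\ eq0 (o1 (o1 (o2 (o1 (o2 (o1 h)))))), eq0 (o2 (o1 (o2 (o1 (o2 (o1 h)))))),
      eq0 (o1 (o2 (o2 (o1 (o2 (o1 h)))))) & eq0 (o2 (o2 (o2 (o1 (o2 (o1 h))))))].

(** Let a = Z1 Z2 Z1 h and b = Z2 Z1 Z2 h. The Serre relations for [h] give Z1 a = 0, Z2 b = 0 and
    Z1 b = Z2 a. Those for Z2 Z1 h and Z1 Z2 h then annihilate every second derivative of e = Z2 a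
    along Z1 and Z2, and the system is closed. *)
Lemma third_order_higher h : smooth_on U h -> third_order h -> higher_order h.
Proof.
move=> sh [[T111 T222 T112] [T211 T221 T122]].
have sh1 := so1 sh; have sh2 := so2 sh; have sh21 := so2 sh1; have sh12 := so1 sh2.
have sa := so1 sh21; have sb := so2 sh12.
have K4 (x b1 z b2 h1112 h1211 h2111 h2211 h1122 h2221 h2122 h1222 : R) :
    h1112 = 2 * x -> h1211 = -3 * x -> h2111 = 0 -> h2211 = -3 * z -> h1122 = -3 * b1 ->
    h2221 = 2 * b2 -> h2122 = -3 * b2 -> h1222 = 0 ->
    h1112 - 3 * x + 3 * h1211 - h2111 = 0 -> - 2 * z + h2211 - h1122 + 2 * b1 = 0 ->
    3 * b2 - h2221 - 3 * h2122 + h1222 = 0 -> [/\ x = 0, b2 = 0 & b1 = 1 * z].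
  by move=> -> -> -> -> -> -> -> -> *; split; lra.
have H4 q (Uq : U q) : [/\ o1 (o1 (o2 (o1 h))) q = 0, o2 (o2 (o1 (o2 h))) q = 0 &
      o1 (o2 (o1 (o2 h))) q = 1 * o2 (o1 (o2 (o1 h))) q].
  have [h14 h24 h25] := serre_relations oU sy uJ sh Uq.
  exact (K4 _ _ _ _ _ _ _ _ _ _ _ _ (C1 sa T112 Uq) (C1 sa T211 Uq) (V2 T111 Uq)
    (C2 sa T211 Uq) (C1 sb T122 Uq) (C2 sb T221 Uq) (C2 sb T122 Uq) (V1 T222 Uq) h14 h24 h25).
have A1 : eq0 (o1 (o1 (o2 (o1 h)))) by move=> q Uq; have [e _ _] := H4 q Uq; exact e.
have B2 : eq0 (o2 (o2 (o1 (o2 h)))) by move=> q Uq; have [_ e _] := H4 q Uq; exact e.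
have B1 : eqc (o1 (o2 (o1 (o2 h)))) 1 (o2 (o1 (o2 (o1 h)))).
  by move=> q Uq; have [_ _ e] := H4 q Uq; exact e.
have se := so2 sa; have se1 := so1 se; have se2 := so2 se.
have K6 (x11 x21 x12 x22 b111 b11 z1 z2 z3 b2 b121 b12 c21 c22 z4 z5 b22 c222 z6 z7 : R) :
    b111 = 2 * b11 -> b11 = 1 * x11 -> z1 = 0 -> z2 = 0 -> z3 = 0 -> b2 = 2 * z4 -> z4 = 0 ->
    b121 = 2 * b12 -> b12 = 1 * x12 -> c21 = 2 * x21 -> c22 = 2 * z5 -> z5 = 0 ->
    b22 = 1 * x22 -> c222 = 2 * x22 -> z6 = 0 -> z7 = 0 ->
    b111 - 3 * x11 + 3 * z1 - z2 = 0 -> - 2 * x21 + z3 - b2 + 2 * b121 = 0 ->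
    - 2 * c21 + c22 - z4 + 2 * b12 = 0 -> 3 * b22 - c222 - 3 * z6 + z7 = 0 ->
    [/\ x11 = 0, x21 = 0, x12 = 0 & x22 = 0].
  by move=> -> -> -> -> -> -> -> -> -> -> -> -> -> -> -> -> *; split; lra.
have H6 q (Uq : U q) : [/\ o1 (o1 (o2 (o1 (o2 (o1 h))))) q = 0,
      o2 (o1 (o2 (o1 (o2 (o1 h))))) q = 0,
      o1 (o2 (o2 (o1 (o2 (o1 h))))) q = 0 & o2 (o2 (o2 (o1 (o2 (o1 h))))) q = 0].
  have [r14 r24 _] := serre_relations oU sy uJ sh21 Uq.
  have [_ t24 t25] := serre_relations oU sy uJ sh12 Uq.
  exact (K6 _ _ _ _ _ _ _ _ _ _ _ _ _ _ _ _ _ _ _ _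
    (C1 (so1 (so1 sb)) (C1 (so1 sb) (C1 sb T221)) Uq) (C1 se1 (C1 se B1) Uq)
    (V1 (V2 A1) Uq) (V2 (V1 A1) Uq) (V2 (V2 A1) Uq)
    (C1 (so1 (so2 sb)) (C1 (so2 sb) (C2 sb T221)) Uq) (V1 (V1 B2) Uq)
    (C1 (so2 (so1 sb)) (C2 (so1 sb) (C1 sb T221)) Uq) (C1 se2 (C2 se B1) Uq)
    (C2 se1 (C1 se (C2 sa T112)) Uq) (C2 (so2 (so1 sa)) (C2 (so1 sa) (C1 sa T112)) Uq)
    (V2 (V2 A1) Uq) (C2 se2 (C2 se B1) Uq) (C2 se2 (C2 se (C2 sa T112)) Uq)
    (V2 (V1 B2) Uq) (V1 (V2 B2) Uq) r14 r24 t24 t25).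
split; first by split; [exact A1|exact B2|exact B1].
split=> q Uq; have [e1 e2 e3 e4] := H6 q Uq.
- exact e1.
- exact e2.
- exact e3.
- exact e4.
Qed.

End ProlongedSystem.

Section Integration.
Variable R : realType.
Variables (U : set 'rV[R]_5) (y : 'I_5 -> 'rV[R]_5 -> R).
Hypotheses (oU : open U) (sy : forall a, smooth_on U (y a))
  (uJ : forall p, U p -> jac y p \in unitmx).

Local Notation yu := (y (ix 0)).
Local Notation yw := (y (ix 1)).
Local Notation yp := (y (ix 2)).
Local Notation yt := (y (ix 3)).
Local Notation yv := (y (ix 4)).
Local Notation o1 := (vder (Z1 y)).
Local Notation o2 := (vder (Z2 y)).
Local Notation eqc := (eqc U).
Local Notation eq0 := (eq0 U).
Local Notation so1 := (smooth_o1 oU sy uJ).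
Local Notation so2 := (smooth_o2 oU sy uJ).
Implicit Types (S F G h : 'rV[R]_5 -> R).

Variables (p0 : 'rV[R]_5) (eps : R).
Hypotheses (box : forall q : 'rV[R]_5, (forall j, `|q 0 j - p0 0 j| < eps) <-> U q).

Lemma eqc_trans F c G q x : eqc F c G -> U q -> G q = x -> F q = c * x.
Proof. by move=> FG Uq <-; exact: FG. Qed.

Ltac stage_tac oU q Uq :=
  vder_calc oU Uq; rewrite /Z1c /Z2c /row5 /=;
  move: (yu q) (yw q) (yp q) (yt q) (yv q) => u w p t v; by field.

(** Integration descends from the constants Z1 e and Z2 e; at each stage both derivatives of the
    next unknown are already known. The values of h, Z1 h and Z2 h are recorded because they supply
    the remaining components of a symmetry. *)
Lemma prolongation F G : smooth_on U F -> smooth_on U G ->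
  eq0 (o2 F) -> eq0 (o1 G) -> eqc (o2 G) 1 (o1 F) ->
  exists kf kg kh kh1 kh2 k11 k12 k21 k22 ka kb ke ke1 ke2 : R, forall q, U q ->
  [/\ F q = kf + sol_f kh kh1 kh2 k11 k12 k21 k22 ka kb ke ke1 ke2 (yu q) (yw q) (yp q) (yt q) (yv q),
      G q = kg + sol_g kh kh1 kh2 k11 k12 k21 k22 ka kb ke ke1 ke2 (yu q) (yw q) (yp q) (yt q) (yv q),
      o1 F q = kh + sol_h kh1 kh2 k11 k12 k21 k22 ka kb ke ke1 ke2 (yu q) (yw q) (yp q) (yt q) (yv q),
      o1 (o1 F) q = kh1 + sol_h1 k11 k21 ka kb ke ke1 ke2 (yu q) (yw q) (yp q) (yv q) &
      o2 (o1 F) q = kh2 + sol_h2 k12 k22 ka kb ke ke1 ke2 (yu q) (yw q) (yp q) (yt q)].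
Proof.
move=> sF sG F2 G1 GF.
have T3 := third_order_o1 oU sy uJ sF sG F2 G1 GF.
have sh := so1 sF; have T4 := third_order_higher oU sy uJ sh T3.
have hZ1 : forall a, has_vder U (Z1 y) (y a) (Z1c y a) := has_vder_chart sy uJ (Z1c y).
have hZ2 : forall a, has_vder U (Z2 y) (y a) (Z2c y a) := has_vder_chart sy uJ (Z2c y).
have I S P sS sP := @integrate R U y oU sy uJ p0 eps box S P sS sP.
move: T3 T4; set h := o1 F; set h1 := o1 h; set h2 := o2 h; set h11 := o1 h1.
set h12 := o1 h2; set h21 := o2 h1; set h22 := o2 h2; set a := o1 h21; set b := o2 h12.
set e := o2 a; set e1 := o1 e; set e2 := o2 e.
move=> [[T111 T222 T112] [T211 T221 T122]] [[A1 B2 B1] [E11 E21 E12 E22]].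
have sh1 : smooth_on U h1 := so1 sh. have sh2 : smooth_on U h2 := so2 sh.
have sh11 : smooth_on U h11 := so1 sh1. have sh12 : smooth_on U h12 := so1 sh2.
have sh21 : smooth_on U h21 := so2 sh1. have sh22 : smooth_on U h22 := so2 sh2.
have sa : smooth_on U a := so1 sh21. have sb : smooth_on U b := so2 sh12.
have se : smooth_on U e := so2 sa. have se1 : smooth_on U e1 := so1 se.
have se2 : smooth_on U e2 := so2 se.
have Ee1 := const_of_Z oU sy uJ box se1 E11 E21.
have Ee2 := const_of_Z oU sy uJ box se2 E12 E22.
move: (e1 p0) (e2 p0) Ee1 Ee2 => ke1 ke2 Ee1 Ee2.
have sP : smooth_on U (fun q : 'rV[R]_5 => sol_e ke1 ke2 (yu q) (yw q)).
  by rewrite /sol_e; smooth_tac oU.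
have [||ke Ee] := I e _ se sP.
- move=> q Uq; refine (etrans (Ee1 q Uq) _); rewrite /sol_e; apply: esym; stage_tac oU q Uq.
- move=> q Uq; refine (etrans (Ee2 q Uq) _); rewrite /sol_e; apply: esym; stage_tac oU q Uq.
clear sP.
have sP : smooth_on U (fun q : 'rV[R]_5 => sol_a ke ke1 ke2 (yu q) (yw q) (yp q)).
  by rewrite /sol_a; smooth_tac oU.
have [||ka Ea] := I a _ sa sP.
- move=> q Uq; refine (etrans (A1 q Uq) _); rewrite /sol_a; apply: esym; stage_tac oU q Uq.
- move=> q Uq; refine (etrans (Ee q Uq) _); rewrite /sol_a /sol_e; apply: esym; stage_tac oU q Uq.
clear sP.
have sP : smooth_on U (fun q : 'rV[R]_5 => sol_b ke ke1 ke2 (yu q) (yw q) (yp q)).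
  by rewrite /sol_b; smooth_tac oU.
have [||kb Eb] := I b _ sb sP.
- move=> q Uq; refine (etrans (eqc_trans B1 Uq (Ee q Uq)) _); rewrite /sol_b /sol_e; apply: esym; stage_tac oU q Uq.
- move=> q Uq; refine (etrans (B2 q Uq) _); rewrite /sol_b; apply: esym; stage_tac oU q Uq.
clear sP.
have sP : smooth_on U (fun q : 'rV[R]_5 => sol_h11 ka ke ke1 ke2 (yu q) (yw q) (yp q) (yv q)).
  by rewrite /sol_h11; smooth_tac oU.
have [||k11 Eh11] := I h11 _ sh11 sP.
- move=> q Uq; refine (etrans (T111 q Uq) _); rewrite /sol_h11; apply: esym; stage_tac oU q Uq.
- move=> q Uq; refine (etrans (eqc_trans T211 Uq (Ea q Uq)) _); rewrite /sol_h11 /sol_a; apply: esym; stage_tac oU q Uq.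
clear sP.
have sP : smooth_on U (fun q : 'rV[R]_5 => sol_h12 ka kb ke ke1 ke2 (yu q) (yw q) (yp q) (yt q)).
  by rewrite /sol_h12; smooth_tac oU.
have [||k12 Eh12] := I h12 _ sh12 sP.
- move=> q Uq; refine (etrans (eqc_trans T112 Uq (Ea q Uq)) _); rewrite /sol_h12 /sol_a; apply: esym; stage_tac oU q Uq.
- move=> q Uq; refine (etrans (Eb q Uq) _); rewrite /sol_h12 /sol_b; apply: esym; stage_tac oU q Uq.
clear sP.
have sP : smooth_on U (fun q : 'rV[R]_5 => sol_h21 ka kb ke ke1 ke2 (yu q) (yw q) (yp q) (yv q)).
  by rewrite /sol_h21; smooth_tac oU.
have [||k21 Eh21] := I h21 _ sh21 sP.
- move=> q Uq; refine (etrans (Ea q Uq) _); rewrite /sol_h21 /sol_a; apply: esym; stage_tac oU q Uq.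
- move=> q Uq; refine (etrans (eqc_trans T221 Uq (Eb q Uq)) _); rewrite /sol_h21 /sol_b; apply: esym; stage_tac oU q Uq.
clear sP.
have sP : smooth_on U (fun q : 'rV[R]_5 => sol_h22 kb ke ke1 ke2 (yu q) (yw q) (yp q) (yt q)).
  by rewrite /sol_h22; smooth_tac oU.
have [||k22 Eh22] := I h22 _ sh22 sP.
- move=> q Uq; refine (etrans (eqc_trans T122 Uq (Eb q Uq)) _); rewrite /sol_h22 /sol_b; apply: esym; stage_tac oU q Uq.
- move=> q Uq; refine (etrans (T222 q Uq) _); rewrite /sol_h22; apply: esym; stage_tac oU q Uq.
clear sP.
have sP : smooth_on U (fun q : 'rV[R]_5 => sol_h1 k11 k21 ka kb ke ke1 ke2 (yu q) (yw q) (yp q) (yv q)).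
  by rewrite /sol_h1; smooth_tac oU.
have [||kh1 Eh1] := I h1 _ sh1 sP.
- move=> q Uq; refine (etrans (Eh11 q Uq) _); rewrite /sol_h1 /sol_h11; apply: esym; stage_tac oU q Uq.
- move=> q Uq; refine (etrans (Eh21 q Uq) _); rewrite /sol_h1 /sol_h21; apply: esym; stage_tac oU q Uq.
clear sP.
have sP : smooth_on U (fun q : 'rV[R]_5 => sol_h2 k12 k22 ka kb ke ke1 ke2 (yu q) (yw q) (yp q) (yt q)).
  by rewrite /sol_h2; smooth_tac oU.
have [||kh2 Eh2] := I h2 _ sh2 sP.
- move=> q Uq; refine (etrans (Eh12 q Uq) _); rewrite /sol_h2 /sol_h12; apply: esym; stage_tac oU q Uq.
- move=> q Uq; refine (etrans (Eh22 q Uq) _); rewrite /sol_h2 /sol_h22; apply: esym; stage_tac oU q Uq.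
clear sP.
have sP : smooth_on U (fun q : 'rV[R]_5 => sol_h kh1 kh2 k11 k12 k21 k22 ka kb ke ke1 ke2 (yu q) (yw q) (yp q) (yt q) (yv q)).
  by rewrite /sol_h; smooth_tac oU.
have [||kh Eh] := I h _ sh sP.
- move=> q Uq; refine (etrans (Eh1 q Uq) _); rewrite /sol_h /sol_h1; apply: esym; stage_tac oU q Uq.
- move=> q Uq; refine (etrans (Eh2 q Uq) _); rewrite /sol_h /sol_h2; apply: esym; stage_tac oU q Uq.
clear sP.
have sP : smooth_on U (fun q : 'rV[R]_5 => sol_f kh kh1 kh2 k11 k12 k21 k22 ka kb ke ke1 ke2 (yu q) (yw q) (yp q) (yt q) (yv q)).
  by rewrite /sol_f; smooth_tac oU.
have [||kf EF] := I F _ sF sP.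
- move=> q Uq; refine (etrans (Eh q Uq) _); rewrite /sol_f /sol_h; apply: esym; stage_tac oU q Uq.
- move=> q Uq; refine (etrans (F2 q Uq) _); rewrite /sol_f; apply: esym; stage_tac oU q Uq.
clear sP.
have sP : smooth_on U (fun q : 'rV[R]_5 => sol_g kh kh1 kh2 k11 k12 k21 k22 ka kb ke ke1 ke2 (yu q) (yw q) (yp q) (yt q) (yv q)).
  by rewrite /sol_g; smooth_tac oU.
have [||kg EG] := I G _ sG sP.
- move=> q Uq; refine (etrans (G1 q Uq) _); rewrite /sol_g; apply: esym; stage_tac oU q Uq.
- move=> q Uq; refine (etrans (eqc_trans GF Uq (Eh q Uq)) _); rewrite /sol_g /sol_h; apply: esym; stage_tac oU q Uq.
clear sP.
exists kf, kg, kh, kh1, kh2, k11, k12, k21, k22, ka, kb, ke, ke1, ke2 => q Uq; split.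
- exact (EF q Uq).
- exact (EG q Uq).
- exact (Eh q Uq).
- exact (Eh1 q Uq).
- exact (Eh2 q Uq).
Qed.

End Integration.

Section SymmetryEquations.
Variable R : realType.
Variables (U : set 'rV[R]_5) (y : 'I_5 -> 'rV[R]_5 -> R) (D : dist R).
Hypotheses (oU : open U) (sy : forall a, smooth_on U (y a))
  (uJ : forall p, U p -> jac y p \in unitmx)
  (HD : forall q, U q -> D q = [set v | [/\ pairing (th1 y q) v = 0,
     pairing (th2 y q) v = 0 & pairing (th3 y q) v = 0]]).

Local Notation yu := (y (ix 0)).
Local Notation yw := (y (ix 1)).
Local Notation yp := (y (ix 2)).
Local Notation yt := (y (ix 3)).
Local Notation yv := (y (ix 4)).
Local Notation o1 := (vder (Z1 y)).
Local Notation o2 := (vder (Z2 y)).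
Local Notation dy a v q := (pairing (grad (y a) q) v).

Variable X : vfield R.
Hypotheses (sX : smooth_vfield U X)
  (X1 : forall q, U q -> D q (lie X (Z1 y) q))
  (X2 : forall q, U q -> D q (lie X (Z2 y) q)).

(* The components of X along Z4, Z5 and - Z3. *)
Definition sym_f q := - (6^-1 * (yu q * yw q - yp q) * vder X yu q
  - 6^-1 * yu q ^+ 2 * vder X yw q + 6^-1 * (2 * yu q) * vder X yp q + 6^-1 * vder X yt q).
Definition sym_g q := - (6^-1 * yw q ^+ 2 * vder X yu q
  - 6^-1 * (yp q + yu q * yw q) * vder X yw q + 6^-1 * (2 * yw q) * vder X yp q
  + 6^-1 * vder X yv q).
Definition sym_h q := 2^-1 * (yu q * vder X yw q - yw q * vder X yu q - vder X yp q).

Lemma smooth_sym : [/\ smooth_on U sym_f, smooth_on U sym_g & smooth_on U sym_h].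
Proof.
have s a : smooth_on U (vder X (y a)) := smooth_vder oU sX (sy a).
have s0 := s (ix 0); have s1 := s (ix 1); have s2 := s (ix 2); have s3 := s (ix 3).
have s4 := s (ix 4).
by split; rewrite /sym_f /sym_g /sym_h; smooth_tac oU.
Qed.

Lemma sym_components q :
  [/\ vder X yp q = - 2 * sym_h q + (yu q * vder X yw q - yw q * vder X yu q),
      vder X yt q = (yp q + yu q * yw q) * vder X yu q - yu q ^+ 2 * vder X yw q
        + 4 * (yu q * sym_h q) - 6 * sym_f q &
      vder X yv q = yw q ^+ 2 * vder X yu q + (yp q - yu q * yw q) * vder X yw q
        + 4 * (yw q * sym_h q) - 6 * sym_g q].
Proof.
rewrite /sym_h /sym_f /sym_g.
move: (yu q) (yw q) (yp q) (vder X yu q) (vder X yw q) (vder X yp q) (vder X yt q) (vder X yv q).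
by move=> u w p c0 c1 c2 c3 c4; split; field.
Qed.

(** Write X = (X u) Z1 + (X w) Z2 - h Z3 + f Z4 + g Z5. The six equations express that the
    coefficients of Z3, Z4 and Z5 vanish in [X, Z1] and in [X, Z2]. *)
Lemma symmetry_equations q : U q ->
  [/\ o1 sym_f q = sym_h q, o2 sym_f q = 0, o1 sym_g q = 0 & o2 sym_g q = sym_h q] /\
  (o1 sym_h q = vder X yw q /\ o2 sym_h q = - vder X yu q).
Proof.
move=> Uq; have [sf sg sh] := smooth_sym.
have [sZ1 sZ2 _ _ _] := smooth_Z oU sy uJ.
have hZ1 : forall a, has_vder U (Z1 y) (y a) (Z1c y a) := has_vder_chart sy uJ (Z1c y).
have hZ2 : forall a, has_vder U (Z2 y) (y a) (Z2c y a) := has_vder_chart sy uJ (Z2c y).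
have hX : forall a, has_vder U X (y a) (vder X (y a)) := fun a => has_vder_smooth X (sy a).
have su1 : smooth_on U (vder X yu) := smooth_vder oU sX (sy _).
have su2 : smooth_on U (vder X yw) := smooth_vder oU sX (sy _).
have cE2 r (_ : U r) := let: And3 e _ _ := sym_components r in e.
have cE3 r (_ : U r) := let: And3 _ e _ := sym_components r in e.
have cE4 r (_ : U r) := let: And3 _ _ e := sym_components r in e.
(* [Z] stands for [Z1] or [Z2], with its derivatives [z0], [z1], [z2] of the
   chart coordinates u, w, p. *)
have dZ (Z : vfield R) (hZ : forall a, smooth_on U (y a) -> has_vder U Z (y a) (vder Z (y a))) :
    [/\ vder Z (vder X yp) q = - 2 * vder Z sym_h q
          + (vder Z yu q * vder X yw q + yu q * vder Z (vder X yw) q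
             - (vder Z yw q * vder X yu q + yw q * vder Z (vder X yu) q)),
        vder Z (vder X yt) q =
          (vder Z yp q + (vder Z yu q * yw q + yu q * vder Z yw q)) * vder X yu q
          + (yp q + yu q * yw q) * vder Z (vder X yu) q
          - (2 * yu q * vder Z yu q * vder X yw q + yu q ^+ 2 * vder Z (vder X yw) q)
          + 4 * (vder Z yu q * sym_h q + yu q * vder Z sym_h q) - 6 * vder Z sym_f q &
        vder Z (vder X yv) q = 2 * yw q * vder Z yw q * vder X yu q
          + yw q ^+ 2 * vder Z (vder X yu) q
          + ((vder Z yp q - (vder Z yu q * yw q + yu q * vder Z yw q)) * vder X yw q
             + (yp q - yu q * yw q) * vder Z (vder X yw) q)
          + 4 * (vder Z yw q * sym_h q + yw q * vder Z sym_h q) - 6 * vder Z sym_g q].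
  have hu := hZ _ (sy (ix 0)); have hw := hZ _ (sy (ix 1)); have hp := hZ _ (sy (ix 2)).
  have h1 := has_vder_smooth Z su1; have h2 := has_vder_smooth Z su2.
  have hh := has_vder_smooth Z sh; have hf := has_vder_smooth Z sf.
  have hg := has_vder_smooth Z sg.
  split; [rewrite (eq_on_vder oU Z cE2 Uq)|rewrite (eq_on_vder oU Z cE3 Uq)
    |rewrite (eq_on_vder oU Z cE4 Uq)]; vder_calc oU Uq;
    generalize (yu q) (yw q) (yp q) (vder Z yu q) (vder Z yw q) (vder Z yp q) (vder X yu q)
      (vder X yw q) (vder Z (vder X yu) q) (vder Z (vder X yw) q) (sym_h q)
      (vder Z sym_h q) (vder Z sym_f q) (vder Z sym_g q); move=> * /=; ring.
have lieE (Z : vfield R) (sZ : smooth_vfield U Z) (c c' : 'I_5 -> 'rV[R]_5 -> R)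
    (hc : forall a, has_vder U X (c a) (c' a)) (cE : forall a r, U r -> vder Z (y a) r = c a r) a :
    dy a (lie X Z q) q = c' a q - vder Z (vder X (y a)) q.
  rewrite -vder_pair (vder_lie oU sX sZ (sy a) Uq) (eq_on_vder oU X (cE a) Uq).
  by rewrite (has_vder_val (hc a) Uq).
have [e2 _ _] := sym_components q.
have [hc1 hc2 _ _ _] := has_vder_Zc oU (hX (ix 0)) (hX (ix 1)) (hX (ix 2)).
have val1 a r (Ur : U r) := has_vder_val (hZ1 a) Ur.
have val2 a r (Ur : U r) := has_vder_val (hZ2 a) Ur.
(* The premises [x0 = 0] and [x1 = 0] reflect that Z1 and Z2 have constant components along u and
   w. *)
have K (u w p z0 z1 z2 c0 c1 h x0 x1 x2 x3 x4 d0 d1 d2 d3 d4 zf zg zh l0 l1 l2 l3 l4 : R) :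
    d2 = - 2 * zh + (z0 * c1 + u * d1 - (z1 * c0 + w * d0)) ->
    d3 = (z2 + (z0 * w + u * z1)) * c0 + (p + u * w) * d0 - (2 * u * z0 * c1 + u ^+ 2 * d1)
         + 4 * (z0 * h + u * zh) - 6 * zf ->
    d4 = 2 * w * z1 * c0 + w ^+ 2 * d0 + ((z2 - (z0 * w + u * z1)) * c1 + (p - u * w) * d1)
         + 4 * (z1 * h + w * zh) - 6 * zg ->
    l0 = x0 - d0 -> l1 = x1 - d1 -> l2 = x2 - d2 -> l3 = x3 - d3 -> l4 = x4 - d4 ->
    [/\ l2 = u * l1 - w * l0, l3 = (p + u * w) * l0 - u ^+ 2 * l1 &
        l4 = w ^+ 2 * l0 + (p - u * w) * l1] ->
    x0 = 0 -> x1 = 0 ->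
    [/\ 2 * zh = z0 * c1 - z1 * c0 - x2,
        6 * zf = (z2 + (z0 * w + u * z1)) * c0 - 2 * u * z0 * c1 + 4 * (z0 * h + u * zh) - x3 &
        6 * zg = 2 * w * z1 * c0 + (z2 - (z0 * w + u * z1)) * c1 + 4 * (z1 * h + w * zh) - x4].
  move=> -> -> -> -> -> -> -> -> [h1 h2 h3] x00 x10; rewrite x00 x10 in h1 h2 h3.
  clear -h1 h2 h3.
  by split; lra.
have gen (Z : vfield R) (sZ : smooth_vfield U Z) (hZ : forall a, smooth_on U (y a) ->
    has_vder U Z (y a) (vder Z (y a))) c c' (hc : forall a, has_vder U X (c a) (c' a))
    (cE : forall a r, U r -> vder Z (y a) r = c a r) (DZ : D q (lie X Z q)) :=
  let: And3 f2 f3 f4 := dZ Z hZ in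
  K _ _ _ _ _ _ _ _ _ _ _ _ _ _ _ _ _ _ _ _ _ _ _ _ _ _ _ f2 f3 f4
    (lieE Z sZ c c' hc cE (ix 0)) (lieE Z sZ c c' hc cE (ix 1)) (lieE Z sZ c c' hc cE (ix 2))
    (lieE Z sZ c c' hc cE (ix 3)) (lieE Z sZ c c' hc cE (ix 4)) ((DP HD _ Uq).1 DZ).
have [e1 e3 e4] := gen _ sZ1 (fun a s => has_vder_smooth _ s) _ _ hc1 val1 (X1 Uq) erefl erefl.
have [g1 g3 g4] := gen _ sZ2 (fun a s => has_vder_smooth _ s) _ _ hc2 val2 (X2 Uq) erefl erefl.
have a0 : o1 yu q = 1 := val1 (ix 0) q Uq. have a1 : o1 yw q = 0 := val1 (ix 1) q Uq.
have a2 : o1 yp q = - yw q := val1 (ix 2) q Uq.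
have b0 : o2 yu q = 0 := val2 (ix 0) q Uq. have b1 : o2 yw q = 1 := val2 (ix 1) q Uq.
have b2 : o2 yp q = yu q := val2 (ix 2) q Uq.
move: e1 e3 e4 g1 g3 g4 e2; rewrite a0 a1 a2 b0 b1 b2 /row5 /=.
have K' (u w c0 c1 c2 h xf yf xg yg xh yh : R) :
    2 * xh = 1 * c1 - 0 * c0 - - c1 ->
    6 * xf = (- w + (1 * w + u * 0)) * c0 - 2 * u * 1 * c1 + 4 * (1 * h + u * xh)
             - (c2 + (c0 * w + u * c1)) ->
    6 * xg = 2 * w * 0 * c0 + (- w - (1 * w + u * 0)) * c1 + 4 * (0 * h + w * xh)
             - 2 * w * c1 ->
    2 * yh = 0 * c1 - 1 * c0 - c0 ->
    6 * yf = (u + (0 * w + u * 1)) * c0 - 2 * u * 0 * c1 + 4 * (0 * h + u * yh)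
             - - (2 * u * c0) ->
    6 * yg = 2 * w * 1 * c0 + (u - (0 * w + u * 1)) * c1 + 4 * (1 * h + w * yh)
             - (c2 - (c0 * w + u * c1)) ->
    c2 = - 2 * h + (u * c1 - w * c0) ->
    [/\ xf = h, yf = 0, xg = 0 & yg = h] /\ (xh = c1 /\ yh = - c0).
  move=> h1 h2 h3 h4 h5 h6 h7; clear -h1 h2 h3 h4 h5 h6 h7.
  have E1 : xh = c1 by lra.
  have E2 : yh = - c0 by lra.
  by rewrite E1 in h2 h3; rewrite E2 in h5 h6; rewrite h7 in h2 h6; split; split=> //; lra.
by apply: K'.
Qed.

End SymmetryEquations.

(** * Split octonions and their derivations *)

Section SplitOctonions.
Variable R : realType.
Local Notation soct := ('M[R]_2 * 'M[R]_2)%type.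

Definition mx2 (a b c d : R) : 'M[R]_2 :=
  \matrix_(i, j) (if i == 0 then if j == 0 then a else b else if j == 0 then c else d).

Lemma mx2_eta (A : 'M[R]_2) : A = mx2 (A 0 0) (A 0 1) (A 1 0) (A 1 1).
Proof.
apply/matrixP => i j; rewrite mxE.
by case: i => [[|[|i]] hi] //; case: j => [[|[|j]] hj] //=; congr (A _ _); exact: val_inj.
Qed.

Lemma mx2_entries a b c d : [/\ mx2 a b c d 0 0 = a, mx2 a b c d 0 1 = b,
  mx2 a b c d 1 0 = c & mx2 a b c d 1 1 = d].
Proof. by split; rewrite mxE. Qed.

Lemma mx2_add a b c d a' b' c' d' :
  mx2 a b c d + mx2 a' b' c' d' = mx2 (a + a') (b + b') (c + c') (d + d').
Proof. by rewrite [LHS]mx2_eta !mxE. Qed.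

Lemma mx2_scale k a b c d : k *: mx2 a b c d = mx2 (k * a) (k * b) (k * c) (k * d).
Proof. by rewrite [LHS]mx2_eta !mxE. Qed.

Lemma mx2_mul a b c d a' b' c' d' : mx2 a b c d *m mx2 a' b' c' d'
  = mx2 (a * a' + b * c') (a * b' + b * d') (c * a' + d * c') (c * b' + d * d').
Proof.
rewrite [LHS]mx2_eta !mxE !big_ord_recl !big_ord0 !addr0.
by rewrite !mxE.
Qed.

Lemma mx2_adj a b c d : \adj (mx2 a b c d) = mx2 d (- b) (- c) a.
Proof.
rewrite [LHS]mx2_eta !mxE /cofactor !det_mx11 !mxE /=.
by rewrite !expr0 !expr1 !sqrrN !expr1n ?mulN1r ?mul1r.
Qed.

Definition mk (a b c d e f g h : R) : soct := (mx2 a b c d, mx2 e f g h).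

Lemma mk_eta (z : soct) :
  z = mk (z.1 0 0) (z.1 0 1) (z.1 1 0) (z.1 1 1) (z.2 0 0) (z.2 0 1) (z.2 1 0) (z.2 1 1).
Proof. by case: z => x y; rewrite /mk -!mx2_eta. Qed.

Lemma mkD a b c d e f g h a' b' c' d' e' f' g' h' :
  mk a b c d e f g h + mk a' b' c' d' e' f' g' h'
  = mk (a + a') (b + b') (c + c') (d + d') (e + e') (f + f') (g + g') (h + h').
Proof. by rewrite /mk -!mx2_add. Qed.

Lemma mkZ k a b c d e f g h : k *: mk a b c d e f g h
  = mk (k * a) (k * b) (k * c) (k * d) (k * e) (k * f) (k * g) (k * h).
Proof. by rewrite /mk -!mx2_scale. Qed.

Lemma mk_inj a b c d e f g h a' b' c' d' e' f' g' h' :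
  mk a b c d e f g h = mk a' b' c' d' e' f' g' h' ->
  [/\ a = a', b = b', c = c' & d = d'] /\ [/\ e = e', f = f', g = g' & h = h'].
Proof.
move=> [/matrixP E1 /matrixP E2].
by split; split; [move: (E1 0 0)|move: (E1 0 1)|move: (E1 1 0)|move: (E1 1 1)
  |move: (E2 0 0)|move: (E2 0 1)|move: (E2 1 0)|move: (E2 1 1)]; rewrite !mxE.
Qed.

Lemma mk0 : 0 = mk 0 0 0 0 0 0 0 0.
Proof. by congr pair; rewrite [LHS]mx2_eta !mxE. Qed.

Lemma soct_mulE a b c d e f g h a' b' c' d' e' f' g' h' :
  soct_mul (mk a b c d e f g h) (mk a' b' c' d' e' f' g' h')
  = mk (a * a' + b * c' + (h' * e - f' * g)) (a * b' + b * d' + (h' * f - f' * h))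
       (c * a' + d * c' + (e' * g - g' * e)) (c * b' + d * d' + (e' * h - g' * f))
       (e' * a + f' * c + (e * d' - f * c')) (e' * b + f' * d + (f * a' - e * b'))
       (g' * a + h' * c + (g * d' - h * c')) (g' * b + h' * d + (h * a' - g * b')).
Proof.
rewrite /soct_mul /mk /= !mx2_adj !mx2_mul !mx2_add.
by congr (mx2 _ _ _ _, mx2 _ _ _ _); rewrite ?mulrN ?mulNr; ring.
Qed.

(* The imaginary null octonions whose [e_r]-coordinate is 1. *)
Definition oh (u w p t v : R) : soct := mk p 1 (- p ^+ 2 - t * w + u * v) (- p) t u v w.
Definition doh (u w p t v du dw dp dt dv : R) : soct :=
  mk dp 0 (- (2 * p * dp) - (dt * w + t * dw) + (du * v + u * dv)) (- dp) dt du dv dw.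

Definition e_p : soct := mk 1 0 0 (-1) 0 0 0 0.
Definition e_r : soct := mk 0 1 0 0 0 0 0 0.
Definition e_s : soct := mk 0 0 1 0 0 0 0 0.
Definition e_t : soct := mk 0 0 0 0 1 0 0 0.
Definition e_u : soct := mk 0 0 0 0 0 1 0 0.
Definition e_v : soct := mk 0 0 0 0 0 0 1 0.
Definition e_w : soct := mk 0 0 0 0 0 0 0 1.

Lemma linear_oh (g : soct -> R) u w p t v :
  (forall a x y, g (a *: x + y) = a * g x + g y) ->
  g (oh u w p t v) = g e_r + (p * g e_p + (- p ^+ 2 - t * w + u * v) * g e_s
    + t * g e_t + u * g e_u + v * g e_v + w * g e_w).
Proof.
move=> lg.
have -> : oh u w p t v = p *: e_p + ((- p ^+ 2 - t * w + u * v) *: e_s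
    + (t *: e_t + (u *: e_u + (v *: e_v + (w *: e_w + e_r))))).
  by rewrite /oh !mkZ !mkD; congr mk; ring.
rewrite !lg; ring.
Qed.

Lemma linear_doh (g : soct -> R) u w p t v du dw dp dt dv :
  (forall a x y, g (a *: x + y) = a * g x + g y) ->
  g (doh u w p t v du dw dp dt dv) = dp * g e_p
    + (- (2 * p * dp) - (dt * w + t * dw) + (du * v + u * dv)) * g e_s
    + dt * g e_t + du * g e_u + dv * g e_v + dw * g e_w.
Proof.
move=> lg.
have g0 : g 0 = 0 by have := lg (-1) 0 0; rewrite scaler0 addr0 mulN1r addNr.
have -> : doh u w p t v du dw dp dt dv = dp *: e_p
    + ((- (2 * p * dp) - (dt * w + t * dw) + (du * v + u * dv)) *: e_s
    + (dt *: e_t + (du *: e_u + (dv *: e_v + (dw *: e_w + 0))))).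
  by rewrite mk0 /doh !mkZ !mkD; congr mk; ring.
rewrite !lg g0; ring.
Qed.

Lemma oh_square u w p t v : soct_mul (oh u w p t v) (oh u w p t v) = 0.
Proof. by rewrite /oh soct_mulE mk0; congr mk; ring. Qed.

(** The equations on the right are those of [th_kernel]: D consists of the tangent vectors of the
    cone that the null octonion at the point annihilates. *)
Lemma oh_doh u w p t v du dw dp dt dv :
  soct_mul (oh u w p t v) (doh u w p t v du dw dp dt dv) = 0 <->
  [/\ dp = u * dw - w * du, dt = (p + u * w) * du - u ^+ 2 * dw &
      dv = w ^+ 2 * du + (p - u * w) * dw].
Proof.
rewrite /oh /doh soct_mulE mk0; split=> [/mk_inj[[_ e1 _ _] [_ e2 _ e3]]|[-> -> ->]].
  have E1 : dp = u * dw - w * du by lra.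
  by rewrite E1 in e2 e3; split; lra.
by congr mk; ring.
Qed.

(** Applying the derivation to z z = 0 shows that d z has no real part, and that it is tangent to
    the null cone. *)
Lemma g2_imaginary (d : 'End(soct)) u w p t v : split_g2 d ->
  let z := d (oh u w p t v) in
  z.1 1 1 = - z.1 0 0 /\
  z.1 1 0 = - (2 * p * z.1 0 0 + w * z.2 0 0 + t * z.2 1 1 - v * z.2 0 1 - u * z.2 1 0
               + (- p ^+ 2 - t * w + u * v) * z.1 0 1).
Proof.
move=> dg z; have := dg (oh u w p t v) (oh u w p t v).
rewrite oh_square linear0 -/z [z]mk_eta /oh !soct_mulE mkD mk0 => /mk_inj[].
move=> [e1 e2 e3 e4] [e5 e6 e7 e8].
have [] := mx2_entries (z.1 0 0) (z.1 0 1) (z.1 1 0) (z.1 1 1).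
have [] := mx2_entries (z.2 0 0) (z.2 0 1) (z.2 1 0) (z.2 1 1).
move=> r1 r2 r3 r4 r5 r6 r7 r8; rewrite /mk /= r1 r2 r3 r4 r5 r6 r7 r8.
have E : z.1 1 1 = - z.1 0 0 by lra.
by split=> //; lra.
Qed.

Section Derivation.
Variables (kf kg kh kh1 kh2 k11 k12 k21 k22 ka kb ke ke1 ke2 : R).

(* The derivation whose vector field on the cone has the state (kf, ..., ke2) of
   [prolongation] at the origin of the chart. *)
Definition der_fun (z : soct) : soct :=
  let a := z.1 0 0 in let b := z.1 0 1 in let c := z.1 1 0 in let d := z.1 1 1 in
  let e := z.2 0 0 in let f := z.2 0 1 in let g := z.2 1 0 in let h := z.2 1 1 in
  mk (2 * kh * b - ke / 2 * c + ka * e + kh1 * f - kb * g + kh2 * h)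
     (ke / 2 * a + (k21 - k12) * b - ke / 2 * d - ke1 / 2 * e - ka * f - ke2 / 2 * g + kb * h)
     (- (2 * kh * a) + (k12 - k21) * c + 2 * kh * d + kh1 * e + 6 * kg * f + kh2 * g - 6 * kf * h)
     (- (2 * kh * b) + ke / 2 * c - ka * e - kh1 * f + kb * g - kh2 * h)
     (- (kh2 * a) + 6 * kf * b - kb * c + kh2 * d + k12 * e + 2 * kh * f + k22 * g)
     (- (kb * a) + kh2 * b - ke2 / 2 * c + kb * d + ke / 2 * e + k21 * f + k22 * h)
     (kh1 * a + 6 * kg * b - ka * c - kh1 * d - k11 * e - k21 * g + 2 * kh * h)
     (- (ka * a) - kh1 * b + ke1 / 2 * c + ka * d - k11 * f + ke / 2 * g - k12 * h).

Lemma der_fun_linear : linear der_fun.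
Proof.
move=> k x y; rewrite /der_fun !mxE /= mkZ mkD.
move: (x.1 0 0) (x.1 0 1) (x.1 1 0) (x.1 1 1) (x.2 0 0) (x.2 0 1) (x.2 1 0) (x.2 1 1)
  (y.1 0 0) (y.1 0 1) (y.1 1 0) (y.1 1 1) (y.2 0 0) (y.2 0 1) (y.2 1 0) (y.2 1 1) => *.
by congr mk; ring.
Qed.

HB.instance Definition _ := GRing.isLinear.Build R soct soct *:%R der_fun der_fun_linear.

Definition der : 'End(soct) := linfun der_fun.

Lemma der_mk a b c d e f g h : der (mk a b c d e f g h) =
  mk (2 * kh * b - ke / 2 * c + ka * e + kh1 * f - kb * g + kh2 * h)
     (ke / 2 * a + (k21 - k12) * b - ke / 2 * d - ke1 / 2 * e - ka * f - ke2 / 2 * g + kb * h)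
     (- (2 * kh * a) + (k12 - k21) * c + 2 * kh * d + kh1 * e + 6 * kg * f + kh2 * g - 6 * kf * h)
     (- (2 * kh * b) + ke / 2 * c - ka * e - kh1 * f + kb * g - kh2 * h)
     (- (kh2 * a) + 6 * kf * b - kb * c + kh2 * d + k12 * e + 2 * kh * f + k22 * g)
     (- (kb * a) + kh2 * b - ke2 / 2 * c + kb * d + ke / 2 * e + k21 * f + k22 * h)
     (kh1 * a + 6 * kg * b - ka * c - kh1 * d - k11 * e - k21 * g + 2 * kh * h)
     (- (ka * a) - kh1 * b + ke1 / 2 * c + ka * d - k11 * f + ke / 2 * g - k12 * h).
Proof.
rewrite lfunE /= /der_fun.
have [-> -> -> ->] := mx2_entries a b c d.
by have [-> -> -> ->] := mx2_entries e f g h.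
Qed.

Lemma der_split_g2 : split_g2 der.
Proof.
move=> x y; rewrite (mk_eta x) (mk_eta y) !soct_mulE !der_mk !soct_mulE mkD.
move: (x.1 0 0) (x.1 0 1) (x.1 1 0) (x.1 1 1) (x.2 0 0) (x.2 0 1) (x.2 1 0) (x.2 1 1)
  (y.1 0 0) (y.1 0 1) (y.1 1 0) (y.1 1 1) (y.2 0 0) (y.2 0 1) (y.2 1 0) (y.2 1 1) => *.
by congr mk; field.
Qed.

End Derivation.

End SplitOctonions.

(** * The action of split g_2 in the chart *)

Section G2Action.
Variable R : realType.
Local Notation soct := ('M[R]_2 * 'M[R]_2)%type.
Variables (U : set 'rV[R]_5) (y : 'I_5 -> 'rV[R]_5 -> R) (D : dist R).
Hypotheses (oU : open U) (sy : forall a, smooth_on U (y a))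
  (uJ : forall p, U p -> jac y p \in unitmx)
  (HD : forall q, U q -> D q = [set v | [/\ pairing (th1 y q) v = 0,
     pairing (th2 y q) v = 0 & pairing (th3 y q) v = 0]]).

Local Notation yu := (y (ix 0)).
Local Notation yw := (y (ix 1)).
Local Notation yp := (y (ix 2)).
Local Notation yt := (y (ix 3)).
Local Notation yv := (y (ix 4)).
Local Notation dy a v q := (pairing (grad (y a) q) v).
Implicit Types (d e : 'End(soct)).

Definition ohat q := oh (yu q) (yw q) (yp q) (yt q) (yv q).
Definition dohat (v : 'rV[R]_5) q := doh (yu q) (yw q) (yp q) (yt q) (yv q)
  (dy (ix 0) v q) (dy (ix 1) v q) (dy (ix 2) v q) (dy (ix 3) v q) (dy (ix 4) v q).

Definition oct_comp (a : 'I_5) (z : soct) : R :=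
  row5 (z.2 0 1) (z.2 1 1) (z.1 0 0) (z.2 0 0) (z.2 1 0) a.
Definition oct_r (z : soct) : R := z.1 0 1.

Lemma oct_comp_lin a k x z : oct_comp a (k *: x + z) = k * oct_comp a x + oct_comp a z.
Proof. by move: a; apply: forall_I5; rewrite /oct_comp /row5 /= !mxE. Qed.

Lemma oct_r_lin k x z : oct_r (k *: x + z) = k * oct_r x + oct_r z.
Proof. by rewrite /oct_r !mxE. Qed.

Lemma oct_comp_end_lin d a k x z : oct_comp a (d (k *: x + z)) = k * oct_comp a (d x) + oct_comp a (d z).
Proof. by rewrite linearP oct_comp_lin. Qed.

Lemma oct_r_end_lin d k x z : oct_r (d (k *: x + z)) = k * oct_r (d x) + oct_r (d z).
Proof. by rewrite linearP oct_r_lin. Qed.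

Lemma oct_comp_end_sub d a k x z : oct_comp a (d (k *: x - z)) = k * oct_comp a (d x) - oct_comp a (d z).
Proof.
rewrite linearB linearZ /=; move: (d x) (d z) => x' z'.
by move: a; apply: forall_I5; rewrite /oct_comp /row5 /= !mxE.
Qed.

Lemma oct_r_end_sub d k x z : oct_r (d (k *: x - z)) = k * oct_r (d x) - oct_r (d z).
Proof. by rewrite linearB linearZ /= /oct_r !mxE. Qed.

Lemma oct_comp_lie_end d e a x : oct_comp a (lie_end d e x) = oct_comp a (d (e x)) - oct_comp a (e (d x)).
Proof.
rewrite /lie_end !lfunE /= !lfunE /= !comp_lfunE; move: (d (e x)) (e (d x)) => x' z'.
by move: a; apply: forall_I5; rewrite /oct_comp /row5 /= !mxE.
Qed.

Lemma oct_r_lie_end d e x : oct_r (lie_end d e x) = oct_r (d (e x)) - oct_r (e (d x)).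
Proof. by rewrite /lie_end !lfunE /= !lfunE /= !comp_lfunE /oct_r !mxE. Qed.

(** [ohat] takes octonion values, so its derivative is tested by an arbitrary linear functional [g].
    Only the e_s-coordinate of [ohat] is nonlinear in the chart functions. *)
Lemma has_vder_ohat X (g : soct -> R) :
  (forall k x z, g (k *: x + z) = k * g x + g z) ->
  has_vder U X (fun q => g (ohat q)) (fun q => g (dohat (X q) q)).
Proof.
move=> lg.
have -> : (fun q => g (ohat q)) = (fun q => g (e_r R) + (yp q * g (e_p R)
    + (- yp q ^+ 2 - yt q * yw q + yu q * yv q) * g (e_s R) + yt q * g (e_t R)
    + yu q * g (e_u R) + yv q * g (e_v R) + yw q * g (e_w R))).
  by apply/funext => q; rewrite /ohat linear_oh.
have hX : forall a, has_vder U X (y a) (vder X (y a)) := fun a => has_vder_smooth X (sy a).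
move: (g (e_r R)) (g (e_p R)) (g (e_s R)) (g (e_t R)) (g (e_u R)) (g (e_v R)) (g (e_w R))
  (fun u w p t v du dw dp dt dv => @linear_doh R g u w p t v du dw dp dt dv lg).
move=> gr gp gs gt gu gv gw E.
apply: has_vder_eq; [has_vder_tac oU|move=> q /=].
rewrite /dohat E -!vder_pair.
move: (yu q) (yw q) (yp q) (yt q) (yv q) (vder X yu q) (vder X yw q) (vder X yp q)
  (vder X yt q) (vder X yv q) => *; ring.
Qed.

(* The field generated by [- d] on the cone, corrected along the cone so that the
   [e_r]-coordinate of [ohat] stays equal to 1. *)
Definition Phi_c d a q := - oct_comp a (d (ohat q)) + y a q * oct_r (d (ohat q)).
Definition Phi d : vfield R := chart_field y (Phi_c d).

Lemma has_vder_Phi_c X d a : has_vder U X (Phi_c d a)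
  (fun q => - oct_comp a (d (dohat (X q) q))
    + (vder X (y a) q * oct_r (d (ohat q)) + y a q * oct_r (d (dohat (X q) q)))).
Proof.
have h1 := has_vder_ohat X (oct_comp_end_lin d a).
have h2 := has_vder_ohat X (oct_r_end_lin d).
have h3 := has_vder_smooth X (sy a).
exact (has_vderD oU (has_vderN oU h1) (has_vderM oU h3 h2)).
Qed.

Lemma smooth_Phi d : smooth_vfield U (Phi d).
Proof.
apply: (smooth_chart_field oU sy uJ) => a.
exact: (has_vder_Phi_c (Z1 y) d a).1.
Qed.

(** [Phi_c] prescribes five coordinates. The real part and the e_s-coordinate agree because d z is
    imaginary and tangent to the cone, and the correction cancels the e_r-coordinate. *)
Lemma dohat_Phi d q : split_g2 d -> U q ->
  dohat (Phi d q) q = oct_r (d (ohat q)) *: ohat q - d (ohat q).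
Proof.
move=> dg Uq; have := g2_imaginary (yu q) (yw q) (yp q) (yt q) (yv q) dg.
rewrite /dohat !(chart_fieldP uJ _ _ Uq) /Phi_c -/(ohat q) => -[e1 e2].
rewrite [X in _ - X]mk_eta -[- mk _ _ _ _ _ _ _ _]scaleN1r e1 e2.
rewrite /oct_r /oct_comp /row5 /ohat /= -/(ohat q) !mkZ mkD.
move: (d (ohat q)).1 (d (ohat q)).2 => z1 z2.
by congr mk; ring.
Qed.

Lemma Phi_comb (c : R) d e q : U q -> Phi (c *: d + e) q = c *: Phi d q + Phi e q.
Proof.
move=> Uq; apply: (chart_inj uJ Uq) => a.
rewrite pairingDr pairingZr !(chart_fieldP uJ _ _ Uq) /Phi_c.
rewrite !lfunE /= !lfunE /= oct_comp_lin oct_r_lin; ring.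
Qed.

(** For the linear fields z -> - d z, the sign makes the bracket of fields correspond to the
    commutator of endomorphisms. The corrections along the cone contribute terms that cancel or
    recombine into the e_r-coordinate of the commutator. *)
Lemma Phi_lie d e q : split_g2 d -> split_g2 e -> U q ->
  Phi (lie_end d e) q = lie (Phi d) (Phi e) q.
Proof.
move=> dg eg Uq; apply/esym; apply: (lie_chart_field oU sy uJ
  (has_vder_Phi_c (Phi e) d) (has_vder_Phi_c (Phi d) e) Uq) => a.
have vd : vder (Phi d) (y a) q = Phi_c d a q by exact: (chart_fieldP uJ _ _ Uq).
have ve : vder (Phi e) (y a) q = Phi_c e a q by exact: (chart_fieldP uJ _ _ Uq).
have K (Ad Ae rd re Ade Aed rde red b vd' ve' : R) :
  vd' = - Ad + b * rd -> ve' = - Ae + b * re ->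
  - (rd * Ae - Aed) + (vd' * re + b * (rd * re - red))
  - (- (re * Ad - Ade) + (ve' * rd + b * (re * rd - rde)))
  = - (Ade - Aed) + b * (rde - red) by move=> -> ->; ring.
have E := K _ _ _ _ (oct_comp a (d (e (ohat q)))) (oct_comp a (e (d (ohat q))))
  (oct_r (d (e (ohat q)))) (oct_r (e (d (ohat q)))) _ _ _ vd ve.
rewrite /Phi_c (dohat_Phi dg Uq) (dohat_Phi eg Uq).
by rewrite !oct_comp_end_sub !oct_r_end_sub oct_comp_lie_end oct_r_lie_end E.
Qed.

End G2Action.

Section G2Symmetries.
Variable R : realType.
Local Notation soct := ('M[R]_2 * 'M[R]_2)%type.
Variables (U : set 'rV[R]_5) (y : 'I_5 -> 'rV[R]_5 -> R) (D : dist R).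
Hypotheses (oU : open U) (sy : forall a, smooth_on U (y a))
  (uJ : forall p, U p -> jac y p \in unitmx)
  (HD : forall q, U q -> D q = [set v | [/\ pairing (th1 y q) v = 0,
     pairing (th2 y q) v = 0 & pairing (th3 y q) v = 0]]).

Local Notation yu := (y (ix 0)).
Local Notation yw := (y (ix 1)).
Local Notation yp := (y (ix 2)).
Local Notation yt := (y (ix 3)).
Local Notation yv := (y (ix 4)).
Local Notation dy a v q := (pairing (grad (y a) q) v).
Implicit Types (d e : 'End(soct)).

(** The real part of d z is linear in z and vanishes at all points [oh], and these span the
    imaginary octonions. *)
Lemma g2_trace d : split_g2 d -> forall u w p t v du dw dp dt dv : R,
  (d (doh u w p t v du dw dp dt dv)).1 1 1 = - (d (doh u w p t v du dw dp dt dv)).1 0 0.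
Proof.
move=> dg u w p t v du dw dp dt dv.
pose g z := (d z).1 0 0 + (d z).1 1 1.
have lg a x z : g (a *: x + z) = a * g x + g z by rewrite /g linearP /= !mxE; ring.
have g0 u' w' p' t' v' : g (oh u' w' p' t' v') = 0.
  by have [e _] := g2_imaginary u' w' p' t' v' dg; rewrite /g e addrN.
have L u' w' p' t' v' := @linear_oh R g u' w' p' t' v' lg.
(* Seven points isolate the seven basis vectors. Both p = 1 and p = -1 are taken to separate e_p
   from e_s, whose coefficient there is - p^2. *)
have h0 := g0 0 0 0 0 0; have hu := g0 1 0 0 0 0; have hw := g0 0 1 0 0 0.
have hp := g0 0 0 1 0 0; have hp' := g0 0 0 (-1) 0 0; have ht := g0 0 0 0 1 0.
have hv := g0 0 0 0 0 1; rewrite !L in h0 hu hw hp hp' ht hv.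
have : g (doh u w p t v du dw dp dt dv) = 0.
  rewrite linear_doh //.
  have K (r q s t' u' v' w' : R) :
      r + (0 * q + (- 0 ^+ 2 - 0 * 0 + 0 * 0) * s + 0 * t' + 0 * u' + 0 * v' + 0 * w') = 0 ->
      r + (0 * q + (- 0 ^+ 2 - 0 * 0 + 1 * 0) * s + 0 * t' + 1 * u' + 0 * v' + 0 * w') = 0 ->
      r + (0 * q + (- 0 ^+ 2 - 0 * 1 + 0 * 0) * s + 0 * t' + 0 * u' + 0 * v' + 1 * w') = 0 ->
      r + (1 * q + (- 1 ^+ 2 - 0 * 0 + 0 * 0) * s + 0 * t' + 0 * u' + 0 * v' + 0 * w') = 0 ->
      r + (-1 * q + (- (-1) ^+ 2 - 0 * 0 + 0 * 0) * s + 0 * t' + 0 * u' + 0 * v' + 0 * w') = 0 ->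
      r + (0 * q + (- 0 ^+ 2 - 1 * 0 + 0 * 0) * s + 1 * t' + 0 * u' + 0 * v' + 0 * w') = 0 ->
      r + (0 * q + (- 0 ^+ 2 - 0 * 0 + 0 * 1) * s + 0 * t' + 0 * u' + 1 * v' + 0 * w') = 0 ->
      [/\ q = 0, s = 0, t' = 0, u' = 0 & v' = 0] /\ w' = 0.
    by move=> *; split; [split|]; lra.
  have [[-> -> -> -> ->] ->] := K _ _ _ _ _ _ _ h0 hu hw hp hp' ht hv.
  by rewrite !mulr0 !addr0.
by rewrite /g => /eqP; rewrite addrC addr_eq0 => /eqP.
Qed.

(** That Y lies in D is the equation z w = 0, with z the point of the cone and w its derivative
    along Y. A derivation yields (d z) w + z (d w) = 0, whose coordinates are the contact equations
    for the bracket of [Phi y d] with Y. *)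
Lemma Phi_symmetry d : split_g2 d -> inf_symmetry U D (Phi y d).
Proof.
move=> dg; split; first exact: smooth_Phi.
move=> W Y oW WU secY q Wq; have Uq := WU q Wq.
have sX : smooth_vfield W (Phi y d).
  by move=> j; exact: (smooth_subset WU (smooth_Phi oU sy uJ d j)).
have syW a : smooth_on W (y a) := smooth_subset WU (sy a).
have XY a r : W r -> vder (Phi y d) (y a) r = Phi_c y d a r.
  by move=> /WU Ur; exact: (chart_fieldP uJ _ _ Ur).
have L a : dy a (lie (Phi y d) Y q) q = vder (Phi y d) (vder Y (y a)) q
    - (- oct_comp a (d (dohat y (Y q) q)) + (vder Y (y a) q * oct_r (d (ohat y q))
       + y a q * oct_r (d (dohat y (Y q) q)))).
  rewrite -vder_pair (vder_lie oW sX secY.1 (syW a) Wq) (eq_on_vder oW Y (XY a) Wq).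
  by rewrite (has_vder_val (has_vder_Phi_c oU sy Y d a) Uq).
have [B2 B3 B4] := vder2_section sy HD oW WU Wq sX secY.
have [c2 c3 c4] := (DP HD (Y q) Uq).1 (secY.2 q Wq).
have E := dg (ohat y q) (dohat y (Y q) q).
have z0 : soct_mul (ohat y q) (dohat y (Y q) q) = 0 by apply/oh_doh.
rewrite z0 linear0 in E.
have tr := g2_trace dg (yu q) (yw q) (yp q) (yt q) (yv q) (dy (ix 0) (Y q) q)
  (dy (ix 1) (Y q) q) (dy (ix 2) (Y q) q) (dy (ix 3) (Y q) q) (dy (ix 4) (Y q) q).
have [itr _] := g2_imaginary (yu q) (yw q) (yp q) (yt q) (yv q) dg.
apply/(DP HD _ Uq).
have K (z b : soct) (u w p t v Y0 Y1 Y2 Y3 Y4 XY0 XY1 X0 X1 X2 A2 A3 A4 l0 l1 l2 l3 l4 : R) :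
    0 = soct_mul z (doh u w p t v Y0 Y1 Y2 Y3 Y4) + soct_mul (oh u w p t v) b ->
    b.1 1 1 = - b.1 0 0 -> z.1 1 1 = - z.1 0 0 ->
    Y2 = u * Y1 - w * Y0 -> Y3 = (p + u * w) * Y0 - u ^+ 2 * Y1 ->
    Y4 = w ^+ 2 * Y0 + (p - u * w) * Y1 ->
    X0 = - oct_comp (ix 0) z + u * oct_r z -> X1 = - oct_comp (ix 1) z + w * oct_r z ->
    X2 = - oct_comp (ix 2) z + p * oct_r z ->
    A2 = X0 * Y1 + u * XY1 - (X1 * Y0 + w * XY0) ->
    A3 = (X2 + (X0 * w + u * X1)) * Y0 + (p + u * w) * XY0
         - (2 * u * X0 * Y1 + u ^+ 2 * XY1) ->
    A4 = 2 * w * X1 * Y0 + w ^+ 2 * XY0 + ((X2 - (X0 * w + u * X1)) * Y1 + (p - u * w) * XY1) ->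
    l0 = XY0 - (- oct_comp (ix 0) b + (Y0 * oct_r z + u * oct_r b)) ->
    l1 = XY1 - (- oct_comp (ix 1) b + (Y1 * oct_r z + w * oct_r b)) ->
    l2 = A2 - (- oct_comp (ix 2) b + (Y2 * oct_r z + p * oct_r b)) ->
    l3 = A3 - (- oct_comp (ix 3) b + (Y3 * oct_r z + t * oct_r b)) ->
    l4 = A4 - (- oct_comp (ix 4) b + (Y4 * oct_r z + v * oct_r b)) ->
    [/\ l2 = u * l1 - w * l0, l3 = (p + u * w) * l0 - u ^+ 2 * l1 &
        l4 = w ^+ 2 * l0 + (p - u * w) * l1].
  move=> H b11 z11; rewrite (mk_eta z) (mk_eta b) b11 z11 in H.
  rewrite /doh /oh !soct_mulE mkD mk0 in H.
  have {H} [[_ E1 _ _] [_ E2 _ E3]] := mk_inj H.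
  rewrite /oct_comp /oct_r /row5 /=; move: E1 E2 E3.
  move: (z.1 0 0) (z.1 0 1) (z.1 1 0) (z.2 0 0) (z.2 0 1) (z.2 1 0) (z.2 1 1).
  move: (b.1 0 0) (b.1 0 1) (b.1 1 0) (b.2 0 0) (b.2 0 1) (b.2 1 0) (b.2 1 1).
  move=> bp br bs bt bu bv bw zp zr zs zt zu zv zw E1 E2 E3 e2 e3 e4 -> -> -> -> -> -> -> -> -> -> ->.
  rewrite e2 in E1 E2 E3 *; rewrite e3 in E2 *; rewrite e4 in E3 *.
  (* The last two contact equations use the relation [E1] multiplied by u and by w; these multiples
     enter the linear arithmetic as separate facts. *)
  have uE1 := congr1 ( *%R u) E1; have wE1 := congr1 ( *%R w) E1.
  clear -E1 E2 E3 uE1 wE1.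
  by split; lra.
exact (K _ _ _ _ _ _ _ _ _ _ _ _ _ _ _ _ _ _ _ _ _ _ _ _ _ E tr itr c2 c3 c4
  (XY (ix 0) q Wq) (XY (ix 1) q Wq) (XY (ix 2) q Wq) B2 B3 B4
  (L (ix 0)) (L (ix 1)) (L (ix 2)) (L (ix 3)) (L (ix 4))).
Qed.

End G2Symmetries.

(** * Injectivity of the action *)

Section G2Isomorphism.
Variable R : realType.
Local Notation soct := ('M[R]_2 * 'M[R]_2)%type.
Variables (U : set 'rV[R]_5) (y : 'I_5 -> 'rV[R]_5 -> R) (D : dist R).
Hypotheses (oU : open U) (sy : forall a, smooth_on U (y a))
  (uJ : forall p, U p -> jac y p \in unitmx)
  (HD : forall q, U q -> D q = [set v | [/\ pairing (th1 y q) v = 0,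
     pairing (th2 y q) v = 0 & pairing (th3 y q) v = 0]]).

Local Notation yu := (y (ix 0)).
Local Notation yw := (y (ix 1)).
Local Notation yp := (y (ix 2)).
Local Notation yt := (y (ix 3)).
Local Notation yv := (y (ix 4)).
Implicit Types (d e : 'End(soct)).

Definition oct_basis (b : 'I_5) : soct := row5 (e_u R) (e_w R) (e_p R) (e_t R) (e_v R) b.
(** The partial derivatives of the e_s-coordinate - p^2 - t w + u v with respect to the chart
    functions. *)
Definition oct_slope (b : 'I_5) : 'rV[R]_5 -> R :=
  row5 yv (fun q => - yt q) (fun q => - (2 * yp q)) (fun q => - yw q) yu b.

Lemma dohat_basis b q : U q ->
  dohat y (chart_basis y b q) q = oct_slope b q *: e_s R + oct_basis b.
Proof.
move=> Uq; rewrite /dohat !(chart_fieldP uJ _ _ Uq); move: b; apply: forall_I5;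
  rewrite /doh /oct_slope /oct_basis /row5 /= /e_s /e_u /e_w /e_p /e_t /e_v mkZ mkD;
  by congr mk; rewrite /= ?(mulr0, mulr1, mul0r, mul1r, addr0, add0r, subr0, oppr0, mulr1n, mulr0n).
Qed.

Section Injectivity.
Variables (d : 'End(soct)) (p0 : 'rV[R]_5).
Hypotheses (dg : split_g2 d) (Up0 : U p0) (Phi0 : forall q, U q -> Phi y d q = 0).

Let lin (g : soct -> R) := forall k x z, g (k *: x + z) = k * g x + g z.
Let rho z := oct_r (d z).

Let rho_lin : lin rho := oct_r_end_lin d.

(** If the field vanishes, [d] moves each point of the cone along its own ray only. The points are
    thus eigenvectors, with the eigenvalue read off from the e_r-coordinate. *)
Lemma eigen_ohat (E : soct -> R) q : lin E -> U q ->
  E (d (ohat y q)) = rho (ohat y q) * E (ohat y q).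
Proof.
move=> lE Uq; have := dohat_Phi uJ dg Uq; rewrite Phi0 // => H.
have p0' (a : 'cV[R]_5) : pairing a 0 = 0 by rewrite /pairing mul0mx mxE.
have Z : dohat y 0 q = 0.
  by rewrite /dohat !p0' /doh mk0 !(mulr0, mul0r, addr0, oppr0).
move: H; rewrite Z => /esym/eqP; rewrite subr_eq0 => /eqP <-.
have := lE (rho (ohat y q)) (ohat y q) 0; rewrite addr0 => ->.
have : E 0 = 0 by have := lE (-1) 0 0; rewrite scaler0 addr0 mulN1r addNr.
by move=> ->; rewrite addr0.
Qed.

(** The eigenvector equation differentiated in the direction of one chart coordinate. *)
Lemma eigen_basis (E : soct -> R) b q : lin E -> U q ->
  oct_slope b q * E (d (e_s R)) + E (d (oct_basis b))
  = (oct_slope b q * rho (e_s R) + rho (oct_basis b)) * E (ohat y q)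
    + rho (ohat y q) * (oct_slope b q * E (e_s R) + E (oct_basis b)).
Proof.
move=> lE Uq.
have lEd : lin (fun z => E (d z)) by move=> k x z; rewrite linearP lE.
have h1 := has_vder_ohat oU sy (chart_basis y b) lEd.
have h2 := has_vderM oU (has_vder_ohat oU sy (chart_basis y b) rho_lin)
  (has_vder_ohat oU sy (chart_basis y b) lE).
have eqE r : U r -> E (d (ohat y r)) = rho (ohat y r) * E (ohat y r).
  by move=> Ur; exact: eigen_ohat.
have := eq_on_vder oU (chart_basis y b) eqE Uq.
rewrite (has_vder_val h1 Uq) (has_vder_val h2 Uq) /= (dohat_basis b Uq).
by rewrite lEd rho_lin lE.
Qed.

Lemma has_vder_basis b E : lin E -> has_vder U (chart_basis y b) (fun q => E (ohat y q))
  (fun q => E (dohat y (chart_basis y b q) q)).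
Proof. by move=> lE; exact: has_vder_ohat. Qed.

Lemma has_vder_basis_y b : forall a,
  has_vder U (chart_basis y b) (y a) (fun=> (a == b)%:R).
Proof. exact: (has_vder_chart sy uJ (fun a _ => (a == b)%:R)). Qed.

(** With [E] the coordinate dual to the direction [b], one more derivative in that direction
    annihilates the left side of [eigen_basis] and leaves twice the derivative of the eigenvalue on
    the right. The direction p is excluded because the e_s-coordinate is quadratic in p but affine
    in each other coordinate. *)
Lemma rho_slope b q : b != ix 2 -> U q ->
  oct_slope b q * rho (e_s R) + rho (oct_basis b) = 0.
Proof.
move=> b2 Uq; pose E := oct_comp (R := R) b.
have lE : lin E by exact: oct_comp_lin.
have hE := has_vder_basis b lE; have hr := has_vder_basis b rho_lin.
have hs : has_vder U (chart_basis y b) (oct_slope b) (fun=> 0).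
  have hy := has_vder_basis_y b; move: b b2 hy {E lE hE hr}; apply: forall_I5 => //= _ hy.
  - exact: (hy (ix 4)).
  - by have := has_vderN oU (hy (ix 3)); rewrite /= oppr0.
  - by have := has_vderN oU (hy (ix 1)); rewrite /= oppr0.
  - exact: (hy (ix 0)).
have Es : E (e_s R) = 0.
  by rewrite /E /oct_comp; move: b b2 {E lE hE hr hs}; apply: forall_I5 => // _; rewrite /row5 /= mxE.
have Eb : E (oct_basis b) = 1.
  by rewrite /E /oct_comp /oct_basis; move: b b2 {E lE hE hr hs Es}; apply: forall_I5 => // _;
    rewrite /row5 /= mxE.
have eqE r : U r -> oct_slope b r * E (d (e_s R)) + E (d (oct_basis b))
  = (oct_slope b r * rho (e_s R) + rho (oct_basis b)) * E (ohat y r) + rho (ohat y r).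
  by move=> Ur; rewrite eigen_basis // Es Eb mulr0 add0r mulr1.
have h1 : has_vder U (chart_basis y b)
    (fun r => oct_slope b r * E (d (e_s R)) + E (d (oct_basis b))) _ :=
  has_vderD oU (has_vderM oU hs (has_vder_cst oU _ _)) (has_vder_cst oU _ _).
have h2 : has_vder U (chart_basis y b) (fun r =>
    (oct_slope b r * rho (e_s R) + rho (oct_basis b)) * E (ohat y r) + rho (ohat y r)) _ :=
  has_vderD oU (has_vderM oU (has_vderD oU (has_vderM oU hs (has_vder_cst oU _ _))
    (has_vder_cst oU _ _)) hE) hr.
have := eq_on_vder oU (chart_basis y b) eqE Uq.
rewrite (has_vder_val h1 Uq) (has_vder_val h2 Uq) /= (dohat_basis b Uq) lE rho_lin Es Eb.
have K (sl rs rb ed z : R) : 0 * ed + sl * 0 + 0 =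
    (0 * rs + sl * 0 + 0) * z + (sl * rs + rb) * (sl * 0 + 1) + (sl * rs + rb) -> sl * rs + rb = 0.
  by lra.
by apply: K.
Qed.

Lemma has_vder_slope_u : has_vder U (chart_basis y (ix 4)) (oct_slope (ix 0)) (fun=> 1).
Proof. exact: (has_vder_basis_y (ix 4) (ix 4)). Qed.

Lemma vder_slope_u (c1 c2 : R) q : U q ->
  vder (chart_basis y (ix 4)) (fun r => oct_slope (ix 0) r * c1 + c2) q = c1.
Proof.
move=> Uq.
have h := has_vderD oU (has_vderM oU has_vder_slope_u
  (has_vder_cst oU (chart_basis y (ix 4)) c1)) (has_vder_cst oU (chart_basis y (ix 4)) c2).
by rewrite (has_vder_val h Uq) mulr0 addr0 mul1r addr0.
Qed.

Lemma vder_cst0 (X : vfield R) (c : R) q : U q -> vder X (fun=> c) q = 0.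
Proof. by move=> Uq; exact: (has_vder_val (has_vder_cst oU X c) Uq). Qed.

(** The slope in direction u is v, and [rho_slope] holds for all values of v on [U], so the
    coefficient of v vanishes. *)
Lemma rho_s : rho (e_s R) = 0.
Proof.
have E0 r : U r -> oct_slope (ix 0) r * rho (e_s R) + rho (oct_basis (ix 0)) = 0.
  by move=> Ur; exact: rho_slope.
by have := eq_on_vder oU (chart_basis y (ix 4)) E0 Up0; rewrite vder_slope_u // vder_cst0.
Qed.

Lemma rho_basis b : b != ix 2 -> rho (oct_basis b) = 0.
Proof. by move=> b2; have := rho_slope b2 Up0; rewrite rho_s mulr0 add0r. Qed.

Lemma rho_ohat_p q : rho (ohat y q) = rho (e_r R) + yp q * rho (e_p R).
Proof.
rewrite /ohat (linear_oh _ _ _ _ _ rho_lin) rho_s.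
rewrite (rho_basis (b := ix 0) isT) (rho_basis (b := ix 1) isT) (rho_basis (b := ix 3) isT).
by rewrite (rho_basis (b := ix 4) isT) !mulr0 !addr0.
Qed.

(** In the u-coordinate of the differentiated equation, p occurs only through the eigenvalue. *)
Lemma rho_p : rho (e_p R) = 0.
Proof.
pose E := oct_comp (R := R) (ix 0); have lE : lin E := oct_comp_lin (ix 0).
have Es : E (e_s R) = 0 by rewrite /E /oct_comp /row5 /= mxE.
have Eb : E (oct_basis (ix 0)) = 1 by rewrite /E /oct_comp /oct_basis /row5 /= mxE.
have E0 r : U r -> yv r * E (d (e_s R)) + E (d (oct_basis (ix 0)))
    = rho (e_r R) + yp r * rho (e_p R).
  move=> Ur; have := eigen_basis (ix 0) lE Ur.
  by rewrite rho_s (rho_basis (b := ix 0) isT) Es Eb !mulr0 !add0r mul0r add0r mulr1 rho_ohat_p.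
have hv := has_vder_basis_y (ix 2) (ix 4); have hp := has_vder_basis_y (ix 2) (ix 2).
have c c0 := has_vder_cst oU (chart_basis y (ix 2)) (c0 : R).
have h1 := has_vderD oU (has_vderM oU hv (c (E (d (e_s R))))) (c (E (d (oct_basis (ix 0))))).
have h2 := has_vderD oU (c (rho (e_r R))) (has_vderM oU hp (c (rho (e_p R)))).
have := eq_on_vder oU (chart_basis y (ix 2)) E0 Up0.
rewrite (has_vder_val h1 Up0) (has_vder_val h2 Up0) /=.
by rewrite !mulr0 !addr0 mul0r mul1r add0r.
Qed.

Let mu := rho (e_r R).

Lemma rho_ohat q : rho (ohat y q) = mu.
Proof. by rewrite rho_ohat_p rho_p mulr0 addr0. Qed.

Lemma eigen_s (E : soct -> R) : lin E -> E (d (e_s R)) = mu * E (e_s R).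
Proof.
move=> lE.
have E0 r : U r -> oct_slope (ix 0) r * E (d (e_s R)) + E (d (oct_basis (ix 0)))
    = oct_slope (ix 0) r * (mu * E (e_s R)) + mu * E (oct_basis (ix 0)).
  move=> Ur; rewrite eigen_basis // rho_s (rho_basis (b := ix 0) isT) rho_ohat.
  by rewrite mulr0 add0r mul0r add0r mulrDr mulrCA.
by have := eq_on_vder oU (chart_basis y (ix 4)) E0 Up0; rewrite !vder_slope_u.
Qed.

Lemma eigen_vec (E : soct -> R) b : lin E -> E (d (oct_basis b)) = mu * E (oct_basis b).
Proof.
move=> lE; have := eigen_basis b lE Up0; rewrite eigen_s // rho_s rho_ohat.
have -> : rho (oct_basis b) = 0.
  by have [->|] := eqVneq b (ix 2); [exact: rho_p|exact: rho_basis].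
move: (oct_slope b p0) (E (e_s R)) (E (d _)) (E (oct_basis b)) (E _) => s x z w o.
by lra.
Qed.

Lemma eigen_r (E : soct -> R) : lin E -> E (d (e_r R)) = mu * E (e_r R).
Proof.
move=> lE; have lEd : lin (fun z => E (d z)) by move=> k x z; rewrite linearP lE.
have := eigen_ohat lE Up0; rewrite rho_ohat /ohat (linear_oh _ _ _ _ _ lEd).
rewrite (linear_oh _ _ _ _ _ lE) eigen_s //.
rewrite (eigen_vec (ix 0) lE) (eigen_vec (ix 1) lE) (eigen_vec (ix 2) lE).
rewrite (eigen_vec (ix 3) lE) (eigen_vec (ix 4) lE) /oct_basis /row5 /=.
move: (E (d (e_r R))) (E (e_r R)) (E (e_s R)) (E (e_u R)) (E (e_w R)) (E (e_p R)) (E (e_t R))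
  (E (e_v R)) => *; lra.
Qed.

Lemma oct_ext (x z : soct) : (forall E : soct -> R, lin E -> E x = E z) -> x = z.
Proof.
move=> H; rewrite (mk_eta x) (mk_eta z).
have H1 i j : x.1 i j = z.1 i j by apply: (H (fun z => z.1 i j)) => k a b; rewrite !mxE.
have H2 i j : x.2 i j = z.2 i j by apply: (H (fun z => z.2 i j)) => k a b; rewrite !mxE.
by rewrite !H1 !H2.
Qed.

Lemma eigen (z : soct) : (forall E : soct -> R, lin E -> E (d z) = mu * E z) -> d z = mu *: z.
Proof.
move=> H; apply: oct_ext => E lE; rewrite H //.
have E0 : E 0 = 0 by have := lE (-1) 0 0; rewrite scaler0 addr0 mulN1r addNr.
by have := lE mu z 0; rewrite addr0 E0 addr0.
Qed.

Lemma Phi_kernel : d = 0.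
Proof.
have er : d (e_r R) = mu *: e_r R by apply: eigen; exact: eigen_r.
have eb b : d (oct_basis b) = mu *: oct_basis b by apply: eigen => E; exact: eigen_vec.
(* Differentiating the product e_p e_r = e_r, whose factors share the eigenvalue, forces mu = 2
   mu. *)
have mu0 : mu = 0.
  have pr : soct_mul (e_p R) (e_r R) = e_r R by rewrite /e_p /e_r soct_mulE; congr mk; ring.
  have := dg (e_p R) (e_r R); rewrite pr er -[e_p R]/(oct_basis (ix 2)) eb /oct_basis /row5 /=.
  by rewrite /e_p /e_r !mkZ !soct_mulE !mkD => /mk_inj[[_ H _ _] _]; lra.
(* The unit completes the imaginary octonions to a basis; a derivation annihilates it since it
   equals its own square. *)
pose one : soct := mk 1 0 0 1 0 0 0 0.
have d1 : d one = 0.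
  have one2 : soct_mul one one = one by rewrite /one soct_mulE; congr mk; ring.
  have := dg one one; rewrite one2 [d one]mk_eta /one !soct_mulE mkD.
  move: (d _).1 (d _).2 => z1 z2 /mk_inj[[h1 h2 h3 h4] [h5 h6 h7 h8]].
  by rewrite mk0; congr mk; lra.
apply/lfunP => z; rewrite zero_lfunE.
have -> : z = ((z.1 0 0 - z.1 1 1) / 2) *: oct_basis (ix 2) + (z.1 0 1 *: e_r R
    + (z.1 1 0 *: e_s R + (((z.1 0 0 + z.1 1 1) / 2) *: one + (z.2 0 0 *: oct_basis (ix 3)
    + (z.2 0 1 *: oct_basis (ix 0) + (z.2 1 0 *: oct_basis (ix 4)
    + z.2 1 1 *: oct_basis (ix 1))))))).
  rewrite [LHS]mk_eta /oct_basis /row5 /= /one !mkZ !mkD.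
  by congr mk; rewrite /=; field.
rewrite !linearD !linearZ /= d1 !eb er (eigen (eigen_s)) mu0.
by rewrite !scale0r !scaler0 !addr0.
Qed.

End Injectivity.

End G2Isomorphism.

(** * Surjectivity of the action *)

Section Surjectivity.
Variable R : realType.
Variables (U : set 'rV[R]_5) (y : 'I_5 -> 'rV[R]_5 -> R) (D : dist R).
Hypotheses (oU : open U) (sy : forall a, smooth_on U (y a))
  (uJ : forall p, U p -> jac y p \in unitmx)
  (HD : forall q, U q -> D q = [set v | [/\ pairing (th1 y q) v = 0,
     pairing (th2 y q) v = 0 & pairing (th3 y q) v = 0]]).
Variables (p0 : 'rV[R]_5) (eps : R).
Hypotheses (eps_gt0 : 0 < eps)
  (box : forall q : 'rV[R]_5, (forall j, `|q 0 j - p0 0 j| < eps) <-> U q).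

Local Notation yu := (y (ix 0)).
Local Notation yw := (y (ix 1)).
Local Notation yp := (y (ix 2)).
Local Notation yt := (y (ix 3)).
Local Notation yv := (y (ix 4)).
Local Notation o1 := (vder (Z1 y)).
Local Notation o2 := (vder (Z2 y)).

Section Coefficients.
Variables (kf kg kh kh1 kh2 k11 k12 k21 k22 ka kb ke ke1 ke2 u w p t v : R).
Let sf := kf + sol_f kh kh1 kh2 k11 k12 k21 k22 ka kb ke ke1 ke2 u w p t v.
Let sg := kg + sol_g kh kh1 kh2 k11 k12 k21 k22 ka kb ke ke1 ke2 u w p t v.
Let sh := kh + sol_h kh1 kh2 k11 k12 k21 k22 ka kb ke ke1 ke2 u w p t v.
Let sh1 := kh1 + sol_h1 k11 k21 ka kb ke ke1 ke2 u w p v.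
Let sh2 := kh2 + sol_h2 k12 k22 ka kb ke ke1 ke2 u w p t.

(** The right side is [sym_components] with X u = - Z2 h, X w = Z1 h and all unknowns replaced by
    their polynomial solutions. This matches the constants of integration with the coefficients of a
    derivation. *)
Lemma der_oh_components (a : 'I_5) :
  let z := der kf kg kh kh1 kh2 k11 k12 k21 k22 ka kb ke ke1 ke2 (oh u w p t v) in
  - oct_comp a z + row5 u w p t v a * oct_r z
  = row5 (- sh2) sh1 (- 2 * sh + (u * sh1 + w * sh2))
      (- ((p + u * w) * sh2) - u ^+ 2 * sh1 + 4 * (u * sh) - 6 * sf)
      (- (w ^+ 2 * sh2) + (p - u * w) * sh1 + 4 * (w * sh) - 6 * sg) a.
Proof.
rewrite /= /oh der_mk /sf /sg /sh /sh1 /sh2; move: a; apply: forall_I5;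
  rewrite /oct_comp /oct_r /row5 /= !mxE /=.
- by rewrite /sol_h2; field.
- by rewrite /sol_h1; field.
- by rewrite /sol_h1 /sol_h2 /sol_h; field.
- by rewrite /sol_h1 /sol_h2 /sol_h /sol_f; field.
- by rewrite /sol_h1 /sol_h2 /sol_h /sol_g; field.
Qed.

End Coefficients.

Lemma symmetry_Phi X : inf_symmetry U D X ->
  exists2 d, split_g2 d & forall q, U q -> X q = Phi y d q.
Proof.
move=> [sX HX].
have X1 q (Uq : U q) := HX U _ oU (fun _ h => h) (section_Z1 oU sy uJ HD) q Uq.
have X2 q (Uq : U q) := HX U _ oU (fun _ h => h) (section_Z2 oU sy uJ HD) q Uq.
have E q (Uq : U q) := symmetry_equations oU sy uJ HD sX X1 X2 Uq.
have [sF sG sH] := smooth_sym oU sy sX.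
have F1 q : U q -> o1 (sym_f y X) q = sym_h y X q by move=> /E[[? _ _ _] _].
have F2 q : U q -> o2 (sym_f y X) q = 0 by move=> /E[[_ ? _ _] _].
have G1 q : U q -> o1 (sym_g y X) q = 0 by move=> /E[[_ _ ? _] _].
have G2 q : U q -> o2 (sym_g y X) q = 1 * o1 (sym_f y X) q.
  by move=> Uq; rewrite mul1r F1 //; have [[_ _ _ ?] _] := E q Uq.
have [kf [kg [kh [kh1 [kh2 [k11 [k12 [k21 [k22 [ka [kb [ke [ke1 [ke2 S]]]]]]]]]]]]]] :=
  prolongation oU sy uJ box sF sG F2 G1 G2.
exists (der kf kg kh kh1 kh2 k11 k12 k21 k22 ka kb ke ke1 ke2); first exact: der_split_g2.
move=> q Uq; apply: (chart_inj uJ Uq) => a; rewrite (chart_fieldP uJ _ _ Uq) -vder_pair.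
have [e1 e2 e3 e4 e5] := S q Uq; have [_ [h1 h2]] := E q Uq.
rewrite (F1 _ Uq) in e3.
rewrite (eq_on_vder oU (Z1 y) F1 Uq) h1 in e4.
rewrite (eq_on_vder oU (Z2 y) F1 Uq) h2 in e5.
have [c2 c3 c4] := sym_components y X q.
have K := der_oh_components kf kg kh kh1 kh2 k11 k12 k21 k22 ka kb ke ke1 ke2
  (yu q) (yw q) (yp q) (yt q) (yv q).
rewrite -e1 -e2 -e3 -e4 -e5 in K.
rewrite /Phi_c /ohat; move: a; apply: forall_I5.
- by refine (etrans _ (esym (K (ix 0)))); rewrite /row5 /= opprK.
- by refine (etrans _ (esym (K (ix 1)))); rewrite /row5 /=.
- by refine (etrans _ (esym (K (ix 2)))); rewrite /row5 /= c2 mulrN.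
- refine (etrans _ (esym (K (ix 3)))); rewrite /row5 /= c3.
  by generalize (yu q) (yw q) (yp q) (vder X yu q) (vder X yw q); move=> *; ring.
- refine (etrans _ (esym (K (ix 4)))); rewrite /row5 /= c4.
  by generalize (yu q) (yw q) (yp q) (vder X yu q) (vder X yw q); move=> *; ring.
Qed.

Lemma g2_iso_chart : g2_symmetry_iso U D (Phi y).
Proof.
have Up0 : U p0 by apply/box => j; rewrite subrr normr0.
split.
- exact: (Phi_symmetry oU sy uJ HD).
- by move=> c d e _ _ q Uq; exact: (Phi_comb uJ).
- by move=> d e dg eg q Uq; exact: (Phi_lie oU sy uJ).
- by move=> d dg H; exact: (Phi_kernel oU sy uJ dg Up0 H).
- exact: symmetry_Phi.
Qed.

End Surjectivity.

(** * The rolling chart *)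

Section EulerQuaternions.
Variable R : realType.
Variables (U : set 'rV[R]_5) (oU : open U).

Definition sinc (c : R) (j : 'I_5) (q : 'rV[R]_5) := sin (c * q 0 j).
Definition cosc (c : R) (j : 'I_5) (q : 'rV[R]_5) := cos (c * q 0 j).

Lemma has_vder_sinc c j X :
  has_vder U X (sinc c j) (fun q => c * cosc c j q * X q 0 j).
Proof.
split=> [|q Uq]; first exact: (smooth_sin oU).
rewrite vderE (bigD1 j) //= big1 => [|i ij]; rewrite /sinc pder_sin; last first.
  by rewrite (negPf ij) mul0r mul0r mulr0.
by rewrite eqxx mul1r addr0 mulrC.
Qed.

Lemma has_vder_cosc c j X :
  has_vder U X (cosc c j) (fun q => - (c * sinc c j q * X q 0 j)).
Proof.
split=> [|q Uq]; first exact: (smooth_cos oU).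
rewrite vderE (bigD1 j) //= big1 => [|i ij]; rewrite /cosc pder_cos; last first.
  by rewrite (negPf ij) mul0r mul0r oppr0 mulr0.
by rewrite eqxx mul1r addr0 mulrN mulrC.
Qed.

(** Addition formulas for z - z / 2, linear in sin z and cos z. They tie the full angles in the
    left-invariant forms to the half angles in the quaternions. *)
Lemma half_angle (z : R) : let c := cos (2^-1 * z) in let s := sin (2^-1 * z) in
  [/\ c ^+ 2 + s ^+ 2 = 1, c * sin z - s * cos z = s & c * cos z + s * sin z = c].
Proof.
move=> c s; have zE : z = 2^-1 * z + 2^-1 * z by field.
have cs : c ^+ 2 + s ^+ 2 = 1 := cos2Dsin2 _.
split=> //; rewrite [in sin z]zE [in cos z]zE sinD cosD -/c -/s.
  by transitivity (s * (c ^+ 2 + s ^+ 2)); [ring|rewrite cs mulr1].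
by transitivity (c * (c ^+ 2 + s ^+ 2)); [ring|rewrite cs mulr1].
Qed.

Local Notation cf := (cosc 2^-1 (ix 2)).
Local Notation sf := (sinc 2^-1 (ix 2)).
Local Notation ct := (cosc 2^-1 (ix 1)).
Local Notation st := (sinc 2^-1 (ix 1)).
Local Notation cp := (cosc 2^-1 (ix 0)).
Local Notation sp := (sinc 2^-1 (ix 0)).

(* The components of exp(phi k / 2) exp(theta j / 2) exp(psi k / 2). *)
Definition quatA0 q := cf q * ct q * cp q - sf q * ct q * sp q.
Definition quatA1 q := - (sf q * st q * cp q) + cf q * st q * sp q.
Definition quatA2 q := cf q * st q * cp q + sf q * st q * sp q.
Definition quatA3 q := sf q * ct q * cp q + cf q * ct q * sp q.

(* The components of twice the left-invariant form A^-1 dA. *)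
Definition al1 (X : vfield R) q := pairing (sigma1 q) (X q).
Definition al2 (X : vfield R) q := pairing (sigma2 q) (X q).
Definition al3 (X : vfield R) q := - pairing (sigma3 q) (X q).

Lemma pairing_delta (i : 'I_5) (v : 'rV[R]_5) : pairing (delta_mx i 0) v = v 0 i.
Proof.
rewrite pairingE (bigD1 i) //= big1 ?addr0 ?mxE ?eqxx ?mulr1 // => j ji.
by rewrite mxE (negPf ji) mulr0.
Qed.

Lemma al_E X (q : 'rV[R]_5) : let sT := sin (q 0 (ix 1)) in let cT := cos (q 0 (ix 1)) in
  let sP := sin (q 0 (ix 0)) in let cP := cos (q 0 (ix 0)) in
  [/\ al1 X q = sP * X q 0 (ix 1) - cP * sT * X q 0 (ix 2),
      al2 X q = cP * X q 0 (ix 1) + sP * sT * X q 0 (ix 2) &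
      al3 X q = X q 0 (ix 0) + cT * X q 0 (ix 2)].
Proof.
rewrite /al1 /al2 /al3 /sigma1 /sigma2 /sigma3 !pairingD !pairingN !pairingZ.
by rewrite !pairing_delta opprD !opprK.
Qed.

Lemma quatA_norm (q : 'rV[R]_5) : quatA0 q ^+ 2 + quatA1 q ^+ 2 + quatA2 q ^+ 2 + quatA3 q ^+ 2 = 1.
Proof.
have E j : cosc 2^-1 j q ^+ 2 + sinc 2^-1 j q ^+ 2 = 1 := cos2Dsin2 _.
transitivity ((cf q ^+ 2 + sf q ^+ 2) * (ct q ^+ 2 + st q ^+ 2) * (cp q ^+ 2 + sp q ^+ 2)).
  rewrite /quatA0 /quatA1 /quatA2 /quatA3.
  move: (cf q) (sf q) (ct q) (st q) (cp q) (sp q) => *; ring.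
by rewrite !E !mulr1.
Qed.

(* The derivative of A along X is A l / 2, with l = l1 i + l2 j + l3 k. *)
Definition quat_flow X (A0 A1 A2 A3 l1 l2 l3 : 'rV[R]_5 -> R) :=
  [/\ has_vder U X A0 (fun q => - 2^-1 * (A1 q * l1 q + A2 q * l2 q + A3 q * l3 q)),
      has_vder U X A1 (fun q => 2^-1 * (A0 q * l1 q + A2 q * l3 q - A3 q * l2 q)),
      has_vder U X A2 (fun q => 2^-1 * (A0 q * l2 q + A3 q * l1 q - A1 q * l3 q)) &
      has_vder U X A3 (fun q => 2^-1 * (A0 q * l3 q + A1 q * l2 q - A2 q * l1 q))].

Lemma quat_flowA X : quat_flow X quatA0 quatA1 quatA2 quatA3 (al1 X) (al2 X) (al3 X).
Proof.
have K (cf sf ct st cp sp sT cT sP cP xp xt xf l1 l2 l3 : R) :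
  ct * sT - st * cT = st -> ct * cT + st * sT = ct ->
  cp * sP - sp * cP = sp -> cp * cP + sp * sP = cp ->
  l1 = sP * xt - cP * sT * xf -> l2 = cP * xt + sP * sT * xf -> l3 = xp + cT * xf ->
  let A0 := cf * ct * cp - sf * ct * sp in let A1 := - (sf * st * cp) + cf * st * sp in
  let A2 := cf * st * cp + sf * st * sp in let A3 := sf * ct * cp + cf * ct * sp in
  let dcf := - (2^-1 * sf * xf) in let dsf := 2^-1 * cf * xf in
  let dct := - (2^-1 * st * xt) in let dst := 2^-1 * ct * xt in
  let dcp := - (2^-1 * sp * xp) in let dsp := 2^-1 * cp * xp in
  [/\ (dcf * ct + cf * dct) * cp + cf * ct * dcp + - ((dsf * ct + sf * dct) * sp + sf * ct * dsp)
      = - 2^-1 * (A1 * l1 + A2 * l2 + A3 * l3),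
   - ((dsf * st + sf * dst) * cp + sf * st * dcp) + ((dcf * st + cf * dst) * sp + cf * st * dsp)
      = 2^-1 * (A0 * l1 + A2 * l3 - A3 * l2),
   (dcf * st + cf * dst) * cp + cf * st * dcp + ((dsf * st + sf * dst) * sp + sf * st * dsp)
      = 2^-1 * (A0 * l2 + A3 * l1 - A1 * l3) &
   (dsf * ct + sf * dct) * cp + sf * ct * dcp + ((dcf * ct + cf * dct) * sp + cf * ct * dsp)
      = 2^-1 * (A0 * l3 + A1 * l2 - A2 * l1)].
  move=> h1 h2 h3 h4 -> -> -> A0 A1 A2 A3 dcf dsf dct dst dcp dsp.
  rewrite /A0 /A1 /A2 /A3 /dcf /dsf /dct /dst /dcp /dsp.
  (* Each claim is a combination of the half-angle relations with monomial coefficients; the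
     required multiples are listed so that linear arithmetic can finish. *)
  have f1 z := congr1 ( *%R z) h1; have f2 z := congr1 ( *%R z) h2.
  have f3 z := congr1 ( *%R z) h3; have f4 z := congr1 ( *%R z) h4.
  move: (f1 (xf * cf * cp)) (f1 (xf * cf * sp)) (f1 (xf * sf * cp)) (f1 (xf * sf * sp)).
  move: (f2 (xf * cf * cp)) (f2 (xf * cf * sp)) (f2 (xf * sf * cp)) (f2 (xf * sf * sp)).
  move: (f3 (xt * cf * ct)) (f3 (xt * cf * st)) (f3 (xt * sf * ct)) (f3 (xt * sf * st)).
  move: (f4 (xt * cf * ct)) (f4 (xt * cf * st)) (f4 (xt * sf * ct)) (f4 (xt * sf * st)).
  move: (f3 (xf * sT * cf * ct)) (f3 (xf * sT * cf * st)) (f3 (xf * sT * sf * ct)) (f3 (xf * sT * sf * st)).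
  move: (f4 (xf * sT * cf * ct)) (f4 (xf * sT * cf * st)) (f4 (xf * sT * sf * ct)) (f4 (xf * sT * sf * st)).
  clear -xf.
  do 24 move=> ?.
  by split; lra.
have hs c j := has_vder_sinc c j X; have hc c j := has_vder_cosc c j X.
have K' (q : 'rV[R]_5) :=
  let: And3 _ h1 h2 := half_angle (q 0 (ix 1)) in let: And3 _ h3 h4 := half_angle (q 0 (ix 0)) in
  let: And3 e1 e2 e3 := al_E X q in
  K (cf q) (sf q) _ _ _ _ _ _ _ _ _ _ _ _ _ _ h1 h2 h3 h4 e1 e2 e3.
have hcf := hc 2^-1 (ix 2). have hsf := hs 2^-1 (ix 2).
have hct := hc 2^-1 (ix 1). have hst := hs 2^-1 (ix 1).
have hcp := hc 2^-1 (ix 0). have hsp := hs 2^-1 (ix 0).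
rewrite /quat_flow; split.
- apply: has_vder_eq; [rewrite /quatA0; has_vder_tac oU|move=> q].
  by have [E _ _ _] := K' q; exact E.
- apply: has_vder_eq; [rewrite /quatA1; has_vder_tac oU|move=> q].
  by have [_ E _ _] := K' q; exact E.
- apply: has_vder_eq; [rewrite /quatA2; has_vder_tac oU|move=> q].
  by have [_ _ E _] := K' q; exact E.
- apply: has_vder_eq; [rewrite /quatA3; has_vder_tac oU|move=> q].
  by have [_ _ _ E] := K' q; exact E.
Qed.

Local Notation cx := (cosc (3 / 2) (ix 3)).
Local Notation sx := (sinc (3 / 2) (ix 3)).
Local Notation cq := (cosc (3 / 2) (ix 4)).
Local Notation sq := (sinc (3 / 2) (ix 4)).

Definition be1 (X : vfield R) (q : 'rV[R]_5) := 3 * cos (3 * q 0 (ix 3)) * X q 0 (ix 4).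
Definition be2 (X : vfield R) (q : 'rV[R]_5) := 3 * X q 0 (ix 3).
Definition be3 (X : vfield R) (q : 'rV[R]_5) := 3 * sin (3 * q 0 (ix 3)) * X q 0 (ix 4).

(* The components of exp(3 q i / 2) exp(3 x j / 2). *)
Definition quatE0 q := cq q * cx q.
Definition quatE1 q := sq q * cx q.
Definition quatE2 q := cq q * sx q.
Definition quatE3 q := sq q * sx q.

Lemma quatE_norm (q : 'rV[R]_5) :
  quatE0 q ^+ 2 + quatE1 q ^+ 2 + quatE2 q ^+ 2 + quatE3 q ^+ 2 = 1.
Proof.
have E j : cosc (3 / 2) j q ^+ 2 + sinc (3 / 2) j q ^+ 2 = 1 := cos2Dsin2 _.
transitivity ((cq q ^+ 2 + sq q ^+ 2) * (cx q ^+ 2 + sx q ^+ 2)).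
  rewrite /quatE0 /quatE1 /quatE2 /quatE3.
  move: (cq q) (sq q) (cx q) (sx q) => *; ring.
by rewrite !E !mulr1.
Qed.

Lemma quat_flowE X : quat_flow X quatE0 quatE1 quatE2 quatE3 (be1 X) (be2 X) (be3 X).
Proof.
have K (cx sx cq sq S C dq dx : R) : cx * S - sx * C = sx -> cx * C + sx * S = cx ->
  let A0 := cq * cx in let A1 := sq * cx in let A2 := cq * sx in let A3 := sq * sx in
  let l1 := 3 * C * dq in let l2 := 3 * dx in let l3 := 3 * S * dq in
  let dcq := - (3 / 2 * sq * dq) in let dsq := 3 / 2 * cq * dq in
  let dcx := - (3 / 2 * sx * dx) in let dsx := 3 / 2 * cx * dx in
  [/\ dcq * cx + cq * dcx = - 2^-1 * (A1 * l1 + A2 * l2 + A3 * l3),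
      dsq * cx + sq * dcx = 2^-1 * (A0 * l1 + A2 * l3 - A3 * l2),
      dcq * sx + cq * dsx = 2^-1 * (A0 * l2 + A3 * l1 - A1 * l3) &
      dsq * sx + sq * dsx = 2^-1 * (A0 * l3 + A1 * l2 - A2 * l1)].
  move=> h1 h2 A0 A1 A2 A3 l1 l2 l3 dcq dsq dcx dsx.
  rewrite /A0 /A1 /A2 /A3 /l1 /l2 /l3 /dcq /dsq /dcx /dsx.
  have f1 z := congr1 ( *%R z) h1; have f2 z := congr1 ( *%R z) h2.
  move: (f1 (dq * cq)) (f1 (dq * sq)) (f2 (dq * cq)) (f2 (dq * sq)).
  clear -cx.
  do 4 move=> ?.
  by split; lra.
have hs c j := has_vder_sinc c j X; have hc c j := has_vder_cosc c j X.
have ang (q : 'rV[R]_5) : cx q * sin (3 * q 0 (ix 3)) - sx q * cos (3 * q 0 (ix 3)) = sx q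
    /\ cx q * cos (3 * q 0 (ix 3)) + sx q * sin (3 * q 0 (ix 3)) = cx q.
  have E : 3 / 2 * q 0 (ix 3) = 2^-1 * (3 * q 0 (ix 3)) by field.
  by rewrite /cosc /sinc E; have [] := half_angle (3 * q 0 (ix 3)).
have K' (q : 'rV[R]_5) := let: conj h1 h2 := ang q in
  K _ _ (cq q) (sq q) _ _ (X q 0 (ix 4)) (X q 0 (ix 3)) h1 h2.
have hcx := hc (3 / 2) (ix 3). have hsx := hs (3 / 2) (ix 3).
have hcq := hc (3 / 2) (ix 4). have hsq := hs (3 / 2) (ix 4).
rewrite /quat_flow; split.
- apply: has_vder_eq; [rewrite /quatE0; has_vder_tac oU|move=> q].
  by have [E _ _ _] := K' q; exact E.
- apply: has_vder_eq; [rewrite /quatE1; has_vder_tac oU|move=> q].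
  by have [_ E _ _] := K' q; exact E.
- apply: has_vder_eq; [rewrite /quatE2; has_vder_tac oU|move=> q].
  by have [_ _ E _] := K' q; exact E.
- apply: has_vder_eq; [rewrite /quatE3; has_vder_tac oU|move=> q].
  by have [_ _ _ E] := K' q; exact E.
Qed.

(** Multiplication on the left by a constant quaternion does not affect the left-invariant form that
    drives the flow. *)
Lemma quat_flow_mull X (E0 E1 E2 E3 l1 l2 l3 : 'rV[R]_5 -> R) (c0 c1 c2 c3 : R) :
  quat_flow X E0 E1 E2 E3 l1 l2 l3 ->
  quat_flow X (fun q => c0 * E0 q - c1 * E1 q - c2 * E2 q - c3 * E3 q)
    (fun q => c0 * E1 q + c1 * E0 q + c2 * E3 q - c3 * E2 q)
    (fun q => c0 * E2 q - c1 * E3 q + c2 * E0 q + c3 * E1 q)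
    (fun q => c0 * E3 q + c1 * E2 q - c2 * E1 q + c3 * E0 q) l1 l2 l3.
Proof.
move=> [h0 h1 h2 h3]; split; (apply: has_vder_eq; [has_vder_tac oU|move=> q /=]);
  move: (E0 q) (E1 q) (E2 q) (E3 q) (l1 q) (l2 q) (l3 q) => *; ring.
Qed.

End EulerQuaternions.

(** * Quaternions and coordinates on the null cone *)

Section Quaternions.
Variable R : realType.

Definition quat : Type := (R * R * R * R)%type.
Implicit Types x z a b : quat.
Definition q0 x := x.1.1.1.
Definition q1 x := x.1.1.2.
Definition q2 x := x.1.2.
Definition q3 x := x.2.

Definition qmul x z : quat :=
  (q0 x * q0 z - q1 x * q1 z - q2 x * q2 z - q3 x * q3 z,
   q0 x * q1 z + q1 x * q0 z + q2 x * q3 z - q3 x * q2 z,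
   q0 x * q2 z - q1 x * q3 z + q2 x * q0 z + q3 x * q1 z,
   q0 x * q3 z + q1 x * q2 z - q2 x * q1 z + q3 x * q0 z).
Definition qconj x : quat := (q0 x, - q1 x, - q2 x, - q3 x).
Definition qdot x z := q0 x * q0 z + q1 x * q1 z + q2 x * q2 z + q3 x * q3 z.
Definition qrot x z := qmul (qmul x z) (qconj x).

Lemma qmulA x z a : qmul x (qmul z a) = qmul (qmul x z) a.
Proof.
case: x z a => [[[x0 x1] x2] x3] [[[z0 z1] z2] z3] [[[a0 a1] a2] a3].
by rewrite /qmul /q0 /q1 /q2 /q3 /=; congr (_, _, _, _); ring.
Qed.

Lemma qdot_mull x z a : qdot (qmul x z) (qmul x a) = qdot x x * qdot z a.
Proof. by rewrite /qdot /qmul /q0 /q1 /q2 /q3 /=; ring. Qed.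

Lemma qdot_mulr x z a : qdot (qmul z x) (qmul a x) = qdot x x * qdot z a.
Proof. by rewrite /qdot /qmul /q0 /q1 /q2 /q3 /=; ring. Qed.

Lemma qdot_conj x : qdot (qconj x) (qconj x) = qdot x x.
Proof. by rewrite /qdot /qconj /q0 /q1 /q2 /q3 /=; ring. Qed.

Lemma qconj_mul x z : qdot x x = 1 -> qmul (qconj x) (qmul x z) = z.
Proof.
move=> xx; rewrite qmulA; case: z => [[[z0 z1] z2] z3].
have -> : qmul (qconj x) x = (qdot x x, 0, 0, 0).
  by rewrite /qmul /qdot /qconj /q0 /q1 /q2 /q3 /=; congr (_, _, _, _); ring.
by rewrite xx /qmul /q0 /q1 /q2 /q3 /=; congr (_, _, _, _); ring.
Qed.

Lemma qdot_rot x z a : qdot x x = 1 -> qdot (qrot x z) (qrot x a) = qdot z a.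
Proof. by move=> xx; rewrite /qrot qdot_mulr qdot_conj qdot_mull xx !mul1r. Qed.

Lemma qrot_mul x z a : qdot x x = 1 -> qmul (qrot x z) (qrot x a) = qrot x (qmul z a).
Proof.
by move=> xx; rewrite /qrot -!qmulA qconj_mul.
Qed.

Lemma qrot_re x z : q0 z = 0 -> q0 (qrot x z) = 0.
Proof.
case: z => [[[z0 z1] z2] z3]; rewrite /qrot /qmul /qconj /q0 /q1 /q2 /q3 /= => ->; ring.
Qed.

(** With s = [q0 b - q3 a], the six functions below satisfy p^2 + r s + t w - u v = |b|^2 - |a|^2
    for imaginary a. Its zero set with r = 1 is the quadric parametrised by [oh]. *)
Definition cone_p a b := q3 b.
Definition cone_r a b := q3 a + q0 b.
Definition cone_t a b := q1 b + q2 a.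
Definition cone_u a b := - (q2 b + q1 a).
Definition cone_v a b := q2 b - q1 a.
Definition cone_w a b := q1 b - q2 a.

(** On vectors normalised by r = 1 the form |da|^2 - |db|^2 is du dv - dt dw - dp^2, since dr = 0
    removes the product dr ds. Dividing by r scales it by r^-2, because every term with dr carries
    |a|^2 - |b|^2 or its differential, and these vanish. *)
Lemma cone_metric a b da db da' db' :
  q0 a = 0 -> q0 da = 0 -> q0 da' = 0 -> qdot a a = qdot b b ->
  qdot a da = qdot b db -> qdot a da' = qdot b db' -> cone_r a b != 0 ->
  let dy (f : quat -> quat -> R) da db :=
    f da db * (cone_r a b)^-1 + f a b * (- (cone_r da db) / cone_r a b ^+ 2) in
  2^-1 * (dy cone_u da db * dy cone_v da' db' + dy cone_v da db * dy cone_u da' db')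
  - 2^-1 * (dy cone_t da db * dy cone_w da' db' + dy cone_w da db * dy cone_t da' db')
  - dy cone_p da db * dy cone_p da' db' = (qdot da da' - qdot db db') / cone_r a b ^+ 2.
Proof.
case: a b da db da' db' => [[[a0 a1] a2] a3] [[[b0 b1] b2] b3] [[[x0 x1] x2] x3]
  [[[y0 y1] y2] y3] [[[z0 z1] z2] z3] [[[w0 w1] w2] w3].
rewrite /qdot /cone_r /cone_u /cone_v /cone_t /cone_w /cone_p /q0 /q1 /q2 /q3 /=.
move=> -> -> ->.
set r := a3 + b0; set dr := x3 + y0; set dr' := z3 + w0.
rewrite !(mul0r, add0r) => N0 N1 N1' r0.
have E k dk dk' : dk * r^-1 + k * (- dk' / r ^+ 2) = (r * dk - k * dk') / r ^+ 2 by field.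
rewrite !E.
have -> : 2^-1 * ((r * - (y2 + x1) - - (b2 + a1) * dr) / r ^+ 2 * ((r * (w2 - z1) - (b2 - a1) * dr') / r ^+ 2)
    + (r * (y2 - x1) - (b2 - a1) * dr) / r ^+ 2 * ((r * - (w2 + z1) - - (b2 + a1) * dr') / r ^+ 2))
  - 2^-1 * ((r * (y1 + x2) - (b1 + a2) * dr) / r ^+ 2 * ((r * (w1 - z2) - (b1 - a2) * dr') / r ^+ 2)
    + (r * (y1 - x2) - (b1 - a2) * dr) / r ^+ 2 * ((r * (w1 + z2) - (b1 + a2) * dr') / r ^+ 2))
  - (r * y3 - b3 * dr) / r ^+ 2 * ((r * w3 - b3 * dr') / r ^+ 2)
  = (r ^+ 2 * ((x1 * z1 + x2 * z2 + x3 * z3) - (y0 * w0 + y1 * w1 + y2 * w2 + y3 * w3))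
     - r * dr' * ((a1 * x1 + a2 * x2 + a3 * x3) - (b0 * y0 + b1 * y1 + b2 * y2 + b3 * y3))
     - r * dr * ((a1 * z1 + a2 * z2 + a3 * z3) - (b0 * w0 + b1 * w1 + b2 * w2 + b3 * w3))
     + dr * dr' * ((a1 * a1 + a2 * a2 + a3 * a3) - (b0 * b0 + b1 * b1 + b2 * b2 + b3 * b3)))
    / r ^+ 4.
  by rewrite /r /dr /dr' in r0 *; field.
by rewrite N0 N1 N1' !subrr !mulr0 !subr0 addr0; field.
Qed.

(** The equations of D in the equivalent form dp = u dw - w du, dt = p du - u dp, dv = p dw - w dp,
    homogenised by r. *)
Lemma cone_contact a b x : q0 a = 0 -> q0 x = 0 -> qdot a a = 1 -> qdot b b = 1 ->
  qdot a x = 0 -> let da := qmul x a in let db := qmul b x in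
  [/\ cone_r a b * cone_p da db - cone_p a b * cone_r da db
      = cone_u a b * cone_w da db - cone_w a b * cone_u da db,
      cone_r a b * cone_t da db - cone_t a b * cone_r da db
      = cone_p a b * cone_u da db - cone_u a b * cone_p da db &
      cone_r a b * cone_v da db - cone_v a b * cone_r da db
      = cone_p a b * cone_w da db - cone_w a b * cone_p da db].
Proof.
case: a b x => [[[a0 a1] a2] a3] [[[b0 b1] b2] b3] [[[x0 x1] x2] x3].
rewrite /qdot /qmul /cone_r /cone_u /cone_v /cone_t /cone_w /cone_p /q0 /q1 /q2 /q3 /=.
move=> -> ->; rewrite !mul0r !add0r => aa bb ax.
have f (k : R) := congr1 ( *%R k) aa; have g (k : R) := congr1 ( *%R k) bb.
have h (k : R) := congr1 ( *%R k) ax.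
move: (f x1) (f x2) (f x3) (g x1) (g x2) (g x3) (h a1) (h a2) (h a3) (h b0) (h b1) (h b2) (h b3).
clear; do 13 move=> ?.
by split; lra.
Qed.

End Quaternions.

Section RollingChart.
Variable R : realType.
Variables (U : set 'rV[R]_5) (oU : open U).
Variables (A0 A1 A2 A3 B0 B1 B2 B3 : 'rV[R]_5 -> R)
  (l1 l2 l3 m1 m2 m3 : vfield R -> 'rV[R]_5 -> R).
Hypotheses (flA : forall X, quat_flow U X A0 A1 A2 A3 (l1 X) (l2 X) (l3 X))
  (flB : forall X, quat_flow U X B0 B1 B2 B3 (m1 X) (m2 X) (m3 X)).

Lemma has_vder_inv X (f f' : 'rV[R]_5 -> R) : has_vder U X f f' ->
  (forall q, U q -> f q != 0) ->
  has_vder U X (fun q => (f q)^-1) (fun q => - f' q / f q ^+ 2).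
Proof.
move=> [sf hf] f0; have sV := smoothV oU sf f0; split=> // q Uq.
have h := has_vderM oU (conj sf hf) (has_vder_smooth X sV).
have E r : U r -> f r * (f r)^-1 = 1 by move=> Ur; rewrite mulfV // f0.
have := eq_on_vder oU X E Uq; rewrite (has_vder_val h Uq).
rewrite (has_vder_val (has_vder_cst oU X 1) Uq).
move: (vder X _ q) (f0 q Uq) => v fq0; move: (f' q) (f q) fq0 => d g g0 H.
have -> : v = g^-1 * (d / g + g * v) - d / g ^+ 2 by field.
by rewrite H mulr0 add0r mulNr.
Qed.

Definition quatA q : quat R := (A0 q, A1 q, A2 q, A3 q).
Definition quatB q : quat R := (B0 q, B1 q, B2 q, B3 q).
Definition roll_a q := qrot (quatA q) (0, 0, 0, 1).
Definition roll_b q := qmul (quatB q) (qconj (quatA q)).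
(** The derivative of A k A^-1 is A [l / 2, k] A^-1 = A (l2 i - l1 j) A^-1, and that of B A^-1 is B
    ((m - l) / 2) A^-1. *)
Definition roll_da X q := qrot (quatA q) (0, l2 X q, - l1 X q, 0).
Definition roll_db X q := qmul (qmul (quatB q)
  (0, 2^-1 * (m1 X q - l1 X q), 2^-1 * (m2 X q - l2 X q), 2^-1 * (m3 X q - l3 X q)))
  (qconj (quatA q)).

Ltac quat_unfold := rewrite /roll_a /roll_b /roll_da /roll_db /qrot /qmul /qconj /quatA /quatB
  /q0 /q1 /q2 /q3 /=.
Ltac gen_atoms X q := move: (A0 q) (A1 q) (A2 q) (A3 q) (B0 q) (B1 q) (B2 q) (B3 q)
  (l1 X q) (l2 X q) (l3 X q) (m1 X q) (m2 X q) (m3 X q) => *.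

Lemma has_vder_roll_a X :
  [/\ has_vder U X (fun q => q1 (roll_a q)) (fun q => q1 (roll_da X q)),
      has_vder U X (fun q => q2 (roll_a q)) (fun q => q2 (roll_da X q)) &
      has_vder U X (fun q => q3 (roll_a q)) (fun q => q3 (roll_da X q))].
Proof.
have [h0 h1 h2 h3] := flA X.
have -> : (fun q => q1 (roll_a q)) = fun q => 2 * (A1 q * A3 q + A0 q * A2 q).
  by apply/funext => q; quat_unfold; ring.
have -> : (fun q => q2 (roll_a q)) = fun q => 2 * (A2 q * A3 q - A0 q * A1 q).
  by apply/funext => q; quat_unfold; ring.
have -> : (fun q => q3 (roll_a q)) = fun q => A0 q ^+ 2 + A3 q ^+ 2 - A1 q ^+ 2 - A2 q ^+ 2.
  by apply/funext => q; quat_unfold; ring.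
by split; (apply: has_vder_eq; [has_vder_tac oU|move=> q; quat_unfold]); 
  move: (A0 q) (A1 q) (A2 q) (A3 q) (l1 X q) (l2 X q) (l3 X q) => *; field.
Qed.

Lemma has_vder_roll_b X :
  [/\ has_vder U X (fun q => q0 (roll_b q)) (fun q => q0 (roll_db X q)),
      has_vder U X (fun q => q1 (roll_b q)) (fun q => q1 (roll_db X q)),
      has_vder U X (fun q => q2 (roll_b q)) (fun q => q2 (roll_db X q)) &
      has_vder U X (fun q => q3 (roll_b q)) (fun q => q3 (roll_db X q))].
Proof.
have [h0 h1 h2 h3] := flA X; have [g0 g1 g2 g3] := flB X.
have -> : (fun q => q0 (roll_b q)) = fun q => B0 q * A0 q + B1 q * A1 q + B2 q * A2 q + B3 q * A3 q.
  by apply/funext => q; quat_unfold; ring.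
have -> : (fun q => q1 (roll_b q)) = fun q => B1 q * A0 q - B0 q * A1 q - B2 q * A3 q + B3 q * A2 q.
  by apply/funext => q; quat_unfold; ring.
have -> : (fun q => q2 (roll_b q)) = fun q => B2 q * A0 q - B0 q * A2 q - B3 q * A1 q + B1 q * A3 q.
  by apply/funext => q; quat_unfold; ring.
have -> : (fun q => q3 (roll_b q)) = fun q => B3 q * A0 q - B0 q * A3 q - B1 q * A2 q + B2 q * A1 q.
  by apply/funext => q; quat_unfold; ring.
by split; (apply: has_vder_eq; [has_vder_tac oU|move=> q; quat_unfold]); gen_atoms X q; field.
Qed.

Definition roll_r q := cone_r (roll_a q) (roll_b q).
Hypotheses (r0 : forall q, U q -> roll_r q != 0)
  (nA : forall q, U q -> qdot (quatA q) (quatA q) = 1)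
  (nB : forall q, U q -> qdot (quatB q) (quatB q) = 1).

Definition affine (f : quat R -> quat R -> R) q := f (roll_a q) (roll_b q) * (roll_r q)^-1.
Definition roll_y : 'I_5 -> 'rV[R]_5 -> R := row5 (affine (@cone_u R)) (affine (@cone_w R))
  (affine (@cone_p R)) (affine (@cone_t R)) (affine (@cone_v R)).

Definition daffine X (f : quat R -> quat R -> R) q :=
  f (roll_da X q) (roll_db X q) * (roll_r q)^-1
  + f (roll_a q) (roll_b q) * (- cone_r (roll_da X q) (roll_db X q) / roll_r q ^+ 2).

Lemma has_vder_roll_y X a : has_vder U X (roll_y a)
  (row5 (daffine X (@cone_u R)) (daffine X (@cone_w R)) (daffine X (@cone_p R))
        (daffine X (@cone_t R)) (daffine X (@cone_v R)) a).
Proof.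
have [a1 a2 a3] := has_vder_roll_a X; have [b0 b1 b2 b3] := has_vder_roll_b X.
have hr : has_vder U X roll_r (fun q => cone_r (roll_da X q) (roll_db X q)) := has_vderD oU a3 b0.
have hV := has_vder_inv hr r0.
have E f : has_vder U X (fun q => f (roll_a q) (roll_b q)) (fun q => f (roll_da X q) (roll_db X q)) ->
    has_vder U X (affine f) (daffine X f) by move=> hf; exact (has_vderM oU hf hV).
move: a; apply: forall_I5; rewrite /roll_y /row5 /=.
- exact (E (@cone_u R) (has_vderN oU (has_vderD oU b2 a1))).
- exact (E (@cone_w R) (has_vderB oU b1 a2)).
- exact (E (@cone_p R) b3).
- exact (E (@cone_t R) (has_vderD oU b1 a2)).
- exact (E (@cone_v R) (has_vderB oU b2 a1)).
Qed.

Lemma smooth_roll_y a : smooth_on U (roll_y a).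
Proof. exact: (has_vder_roll_y (fun=> 0) a).1. Qed.

Lemma roll_dot_dda X q : U q -> qdot (roll_a q) (roll_da X q) = 0 /\
  qdot (roll_b q) (roll_db X q) = 0.
Proof.
move=> Uq; rewrite /roll_a /roll_da qdot_rot ?nA //; split.
  by rewrite /qdot /q0 /q1 /q2 /q3 /=; ring.
rewrite /roll_b /roll_db qdot_mulr qdot_conj nA // mul1r.
by rewrite /qdot /qmul /q0 /q1 /q2 /q3 /=; ring.
Qed.

Lemma roll_dot_metric X X' q : U q ->
  qdot (roll_da X q) (roll_da X' q) - qdot (roll_db X q) (roll_db X' q)
  = l1 X q * l1 X' q + l2 X q * l2 X' q - 4^-1 * ((m1 X q - l1 X q) * (m1 X' q - l1 X' q)
    + (m2 X q - l2 X q) * (m2 X' q - l2 X' q) + (m3 X q - l3 X q) * (m3 X' q - l3 X' q)).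
Proof.
move=> Uq; rewrite /roll_da /roll_db qdot_rot ?nA // qdot_mulr qdot_conj nA // mul1r.
rewrite qdot_mull nB // mul1r /qdot /q0 /q1 /q2 /q3 /=.
move: (l1 X q) (l2 X q) (l3 X q) (m1 X q) (m2 X q) (m3 X q)
  (l1 X' q) (l2 X' q) (l3 X' q) (m1 X' q) (m2 X' q) (m3 X' q) => *; by field.
Qed.

Lemma roll_jac_metric q i j : U q ->
  let X : vfield R := fun=> delta_mx 0 i in let X' : vfield R := fun=> delta_mx 0 j in
  (jac roll_y q *m flat_eta R *m (jac roll_y q)^T) i j
  = (l1 X q * l1 X' q + l2 X q * l2 X' q - 4^-1 * ((m1 X q - l1 X q) * (m1 X' q - l1 X' q)
    + (m2 X q - l2 X q) * (m2 X' q - l2 X' q) + (m3 X q - l3 X q) * (m3 X' q - l3 X' q)))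
    / roll_r q ^+ 2.
Proof.
move=> Uq X X'; rewrite -roll_dot_metric //.
have [aX bX] := roll_dot_dda X Uq; have [aX' bX'] := roll_dot_dda X' Uq.
have N : qdot (roll_a q) (roll_a q) = qdot (roll_b q) (roll_b q).
  rewrite /roll_a /roll_b qdot_rot ?nA // qdot_mulr qdot_conj nA // nB //.
  by rewrite /qdot /q0 /q1 /q2 /q3 /=; ring.
have E := @cone_metric R (roll_a q) (roll_b q) (roll_da X q) (roll_db X q) (roll_da X' q)
  (roll_db X' q) (@qrot_re R _ (0, 0, 0, 1) erefl)
  (@qrot_re R _ (0, l2 X q, - l1 X q, 0) erefl) (@qrot_re R _ (0, l2 X' q, - l1 X' q, 0) erefl) N
  (etrans aX (esym bX)) (etrans aX' (esym bX')) (r0 Uq).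
have E' : 2^-1 * (daffine X (@cone_u R) q * daffine X' (@cone_v R) q
      + daffine X (@cone_v R) q * daffine X' (@cone_u R) q)
    - 2^-1 * (daffine X (@cone_t R) q * daffine X' (@cone_w R) q
      + daffine X (@cone_w R) q * daffine X' (@cone_t R) q)
    - daffine X (@cone_p R) q * daffine X' (@cone_p R) q
    = (qdot (roll_da X q) (roll_da X' q) - qdot (roll_db X q) (roll_db X' q)) / roll_r q ^+ 2.
  exact: E.
refine (etrans _ E').
have -> : (jac roll_y q *m flat_eta R *m (jac roll_y q)^T) i j
  = \sum_b (\sum_a vder X (roll_y a) q * flat_eta R a b) * vder X' (roll_y b) q.
  rewrite !mxE; apply: eq_bigr => b _; rewrite !mxE -grad_vder !mxE; congr (_ * _).
  by apply: eq_bigr => a _; rewrite -grad_vder !mxE.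
have V Z a := has_vder_val (has_vder_roll_y Z a) Uq.
rewrite !sum_I5 !V !mxE /row5 /=.
move: (daffine X) (daffine X') => d d'.
move: (d (@cone_u R) q) (d (@cone_w R) q) (d (@cone_p R) q) (d (@cone_t R) q) (d (@cone_v R) q)
  (d' (@cone_u R) q) (d' (@cone_w R) q) (d' (@cone_p R) q) (d' (@cone_t R) q) (d' (@cone_v R) q) => *.
by ring.
Qed.

Lemma roll_contact X q : U q ->
  m1 X q = 3 * l1 X q -> m2 X q = 3 * l2 X q -> m3 X q = l3 X q ->
  [/\ pairing (th1 roll_y q) (X q) = 0, pairing (th2 roll_y q) (X q) = 0
    & pairing (th3 roll_y q) (X q) = 0].
Proof.
move=> Uq e1 e2 e3.
have aa : qdot (roll_a q) (roll_a q) = 1.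
  by rewrite /roll_a qdot_rot ?nA // /qdot /q0 /q1 /q2 /q3 /=; ring.
have bb : qdot (roll_b q) (roll_b q) = 1.
  by rewrite /roll_b qdot_mulr qdot_conj nA // nB // mulr1.
(* Under the rolling conditions (m - l) / 2 = (l1, l2, 0), so the derivatives take the form (xi a, b
   xi) to which [cone_contact] applies. *)
pose xi := qrot (quatA q) (0, l1 X q, l2 X q, 0).
have ax : qdot (roll_a q) xi = 0.
  by rewrite /roll_a /xi qdot_rot ?nA // /qdot /q0 /q1 /q2 /q3 /=; ring.
have da : roll_da X q = qmul xi (roll_a q).
  rewrite /xi /roll_a qrot_mul ?nA // /roll_da; congr (qrot _ _).
  by rewrite /qmul /q0 /q1 /q2 /q3 /=; congr (_, _, _, _); ring.
have db : roll_db X q = qmul (roll_b q) xi.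
  rewrite /xi /roll_b /qrot -!qmulA qconj_mul ?nA // !qmulA /roll_db e1 e2 e3.
  congr (qmul (qmul _ _) _); congr (_, _, _, _); by field.
have H := @cone_contact R (roll_a q) (roll_b q) xi
  (@qrot_re R _ (0, 0, 0, 1) erefl) (@qrot_re R _ (0, l1 X q, l2 X q, 0) erefl) aa bb ax.
cbv zeta in H; rewrite -da -db in H; have [c1 c2 c3] := H.
have [-> -> -> _ _] := th_pairing roll_y q (X q).
rewrite -!vder_pair; have V a := has_vder_val (has_vder_roll_y X a) Uq.
rewrite !V /roll_y /row5 /= /affine /daffine -/(roll_r q).
have K (r u w p t v dr du dw dp dt dv : R) : r != 0 ->
  r * dp - p * dr = u * dw - w * du -> r * dt - t * dr = p * du - u * dp ->
  r * dv - v * dr = p * dw - w * dp ->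
  let d f df := df * r^-1 + f * (- dr / r ^+ 2) in
  [/\ 6^-1 * ((u * r^-1) * (w * r^-1) - p * r^-1) * d u du - 6^-1 * (u * r^-1) ^+ 2 * d w dw
        + 6^-1 * (2 * (u * r^-1)) * d p dp + 6^-1 * d t dt = 0,
      6^-1 * (w * r^-1) ^+ 2 * d u du - 6^-1 * (p * r^-1 + (u * r^-1) * (w * r^-1)) * d w dw
        + 6^-1 * (2 * (w * r^-1)) * d p dp + 6^-1 * d v dv = 0 &
      2^-1 * ((u * r^-1) * d w dw - (w * r^-1) * d u du - d p dp) = 0].
  move=> r00 h1 h2 h3 d.
  have E f df : d f df = (r * df - f * dr) / r ^+ 2 by rewrite /d; field.
  have hp : dp = (u * dw - w * du + p * dr) / r.
    by rewrite -h1 subrK; field.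
  by rewrite !E h1 h2 h3 hp; split; field.
exact (K _ _ _ _ _ _ _ _ _ _ _ _ (r0 Uq) c1 c2 c3).
Qed.

End RollingChart.

(** * The metric g_R and the rolling vector fields *)

Section RollingMetric.
Variable R : realType.
Implicit Types (p q : 'rV[R]_5) (X : vfield R).

Lemma open_neq0 (V : set 'rV[R]_5) (f : 'rV[R]_5 -> R) : open V -> smooth_on V f ->
  open [set q | V q /\ f q != 0].
Proof.
move=> oV sf; rewrite openE => q [Vq fq0]; have [cf _] := smooth_regular sf Vq.
have h1 : \forall x \near q, V x by exact: open_nbhs_nbhs.
have h2 : \forall x \near q, f x != 0 by exact: (cvgr_neq0 (f q) cf fq0).
by apply: filterS2 h1 h2.
Qed.

Lemma M5_open : open (@M5 R).
Proof.
have -> : @M5 R = [set q | [set: 'rV[R]_5] q /\ sinc 1 (ix 1) q * cosc 3 (ix 3) q != 0].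
  apply/seteqP; split=> q; rewrite /M5 /sinc /cosc /= mul1r mulf_eq0 negb_or.
    by move=> [-> ->].
  by move=> [_ /andP[]].
apply: open_neq0; first exact: openT.
exact (smoothM openT (smooth_sin openT _ _) (smooth_cos openT _ _)).
Qed.

Lemma X1_rolls q : M5 q -> [/\ be1 (@X1 R) q = 3 * al1 (@X1 R) q,
  be2 (@X1 R) q = 3 * al2 (@X1 R) q & be3 (@X1 R) q = al3 (@X1 R) q].
Proof.
move=> [s0 _]; have [-> -> ->] := al_E (@X1 R) q.
rewrite /be1 /be2 /be3 /X1 /E2 !mxE /= !(mulr1n, mulr0n, mulr0, mulr1, add0r, addr0, subr0).
move: s0; rewrite /theta_ /psi_; have := cos2Dsin2 (q 0 (ix 0)).
move: (sin (q 0 (ix 1))) (cos (q 0 (ix 1))) (sin (q 0 (ix 0))) (cos (q 0 (ix 0))) => s c S C CS s0.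
split; [by field| |by field].
by transitivity (3 * (C ^+ 2 + S ^+ 2)); [rewrite CS; ring|field].
Qed.

Lemma X2_rolls q : M5 q -> [/\ be1 (@X2 R) q = 3 * al1 (@X2 R) q,
  be2 (@X2 R) q = 3 * al2 (@X2 R) q & be3 (@X2 R) q = al3 (@X2 R) q].
Proof.
move=> [s0 _]; have [-> -> ->] := al_E (@X2 R) q.
rewrite /be1 /be2 /be3 /X2 /E1 /E3 !mxE /= !(mulr1n, mulr0n, mulr0, mulr1, add0r, addr0, subr0).
move: s0; rewrite /theta_ /psi_ /x_; have := cos2Dsin2 (q 0 (ix 0)).
move: (sin (q 0 (ix 1))) (cos (q 0 (ix 1))) (sin (q 0 (ix 0))) (cos (q 0 (ix 0)))
  (cos (3 * q 0 (ix 3))) (sin (3 * q 0 (ix 3))) => s c S C cx sx CS s0.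
split; [|by field|by field].
by transitivity (3 * cx * (C ^+ 2 + S ^+ 2)); [rewrite CS; ring|field].
Qed.

Lemma free_X12 q : free [:: X1 q; X2 q].
Proof.
apply: (@free_dual _ _ 2 [tuple X1 q; X2 q] (fun j v => v 0 (if j == 0 then ix 3 else ix 4))).
  by move=> j F k; rewrite summxE; apply: eq_bigr => i _; rewrite mxE.
move=> [[|[|i]] hi] [[|[|j]] hj] //=; rewrite /X1 /X2 /E1 /E2 /E3 !mxE /=;
  by rewrite ?(mulr1n, mulr0n, mulr0, mulr1, add0r, addr0, subr0, oppr0).
Qed.

(** Completing squares, with l = 2 alpha and m = 2 beta: l1^2 - (m1 - l1)^2 / 4 = (3 / 4) (l1 + m1 /
    3)^2 - m1^2 / 3, and likewise for the second components. This is where the reversed signs in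
    [ot1], [ot2] and the coefficients 2 and 1 / 2 come from; the third component contributes only
    the square of [ot3]. *)
Lemma g_R_entries q i j :
  let X : vfield R := fun=> delta_mx 0 i in let X' : vfield R := fun=> delta_mx 0 j in
  al1 X q * al1 X' q + al2 X q * al2 X' q - 4^-1 * ((be1 X q - al1 X q) * (be1 X' q - al1 X' q)
    + (be2 X q - al2 X q) * (be2 X' q - al2 X' q) + (be3 X q - al3 X q) * (be3 X' q - al3 X' q))
  = 3 / 2 * g_R q i j.
Proof.
have D (k l : 'I_5) : (delta_mx 0 k : 'rV[R]_5) 0 l = (delta_mx l 0 : 'cV[R]_5) k 0.
  by rewrite !mxE eqxx /= andbT eq_sym.
have P (a : 'cV[R]_5) k : pairing a (delta_mx 0 k) = a k 0.
  rewrite pairingE (bigD1 k) //= big1 ?addr0 => [|l lk]; first by rewrite !mxE !eqxx mul1r.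
  by rewrite mxE (negPf lk) mul0r.
move=> X X'; rewrite /al1 /al2 /al3 /be1 /be2 /be3 /X /X' !P !D -/(d_x R) -/(d_q R).
have E (A B C D' F : 'M[R]_5) : (- 2 *: (A + B) + 2^-1 *: C + 2^-1 *: D' - 6^-1 *: F) i j
  = - 2 * (A i j + B i j) + 2^-1 * C i j + 2^-1 * D' i j - 6^-1 * F i j by rewrite !mxE.
have V (a b : 'cV[R]_5) c k : (a + c *: b) k 0 = a k 0 + c * b k 0 by rewrite !mxE.
have Ad (a b : 'cV[R]_5) k : (a + b) k 0 = a k 0 + b k 0 by rewrite !mxE.
have N (a : 'cV[R]_5) k : (- a) k 0 = - a k 0 by rewrite !mxE.
have S (a : 'cV[R]_5) c k : (c *: a) k 0 = c * a k 0 by rewrite !mxE.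
rewrite /g_R E !sprodE /o4 /o5 /ot1 /ot2 /ot3 !(V, Ad, N, S) /x_.
move: (sigma1 q i 0) (sigma2 q i 0) (sigma3 q i 0) (sigma1 q j 0) (sigma2 q j 0) (sigma3 q j 0)
  (d_x R i 0) (d_x R j 0) (d_q R i 0) (d_q R j 0) (cos (3 * q 0 (ix 3))) (sin (3 * q 0 (ix 3))) => *.
by field.
Qed.

End RollingMetric.

Section FlatRollingChart.
Variable R : realType.
Implicit Types (p q : 'rV[R]_5) (X : vfield R).

Lemma sigma_kernel q (v : 'rV[R]_5) : M5 q -> pairing (sigma1 q) v = 0 ->
  pairing (sigma2 q) v = 0 -> pairing (sigma3 q) v = 0 ->
  [/\ v 0 (ix 0) = 0, v 0 (ix 1) = 0 & v 0 (ix 2) = 0].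
Proof.
move=> [s0 _]; have [] := al_E (fun=> v) q; rewrite /al1 /al2 /al3 => -> -> e3 h1 h2 h3.
rewrite h3 oppr0 in e3; move: e3 h1 h2 s0; rewrite /theta_; have := cos2Dsin2 (q 0 (ix 0)).
move: (v 0 (ix 0)) (v 0 (ix 1)) (v 0 (ix 2)) => x y z.
move: (sin (q 0 (ix 1))) (cos (q 0 (ix 1))) (sin (q 0 (ix 0))) (cos (q 0 (ix 0))).
move=> s c S C CS e3 h1 h2 s0.
have y0 : y = 0.
  transitivity ((C ^+ 2 + S ^+ 2) * y); first by rewrite CS mul1r.
  by transitivity (S * (S * y - C * s * z) + C * (C * y + S * s * z)); [ring|rewrite h1 h2; ring].
have z0 : s * z = 0.
  transitivity ((C ^+ 2 + S ^+ 2) * (s * z)); first by rewrite CS mul1r.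
  by transitivity (S * (C * y + S * s * z) - C * (S * y - C * s * z)); [ring|rewrite h1 h2; ring].
have {}z0 : z = 0 by move/eqP: z0; rewrite mulf_eq0 (negPf s0) /= => /eqP.
by split=> //; rewrite e3 z0; ring.
Qed.

Definition g_coframe q : 'M[R]_5 := \matrix_(i, k)
  row5 (o4 q i 0) (o5 q i 0) (ot1 q i 0) (ot2 q i 0) (ot3 q i 0) k.
Definition g_diag : 'rV[R]_5 := \row_k row5 (- 2) (- 2) 2^-1 2^-1 (- 6^-1) k.

Lemma g_coframe_unit q : M5 q -> g_coframe q \in unitmx.
Proof.
move=> Mq; rewrite -row_free_unit; apply: inj_row_free => v vW.
have H k : pairing (row5 (o4 q) (o5 q) (ot1 q) (ot2 q) (ot3 q) k) v = 0.
  have := congr1 (fun A : 'rV[R]_5 => A 0 k) vW; rewrite !mxE => <-.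
  rewrite pairingE; apply: eq_bigr => i _; rewrite mxE; congr (_ * _).
  by move: k; apply: forall_I5.
have x0 : v 0 (ix 3) = 0.
  by have := H (ix 0); rewrite /row5 /= /o4 pairingN pairing_delta => /eqP; rewrite oppr_eq0 => /eqP.
have q0 : v 0 (ix 4) = 0.
  have := H (ix 1); rewrite /row5 /= /o5 pairingZ pairing_delta => /eqP.
  by rewrite mulf_eq0 (negPf Mq.2) /= => /eqP.
have h1 := H (ix 2); have h2 := H (ix 3); have h3 := H (ix 4).
rewrite /row5 /= /ot1 pairingD pairingZ pairing_delta q0 mulr0 addr0 in h1.
rewrite /row5 /= /ot2 pairingD pairing_delta x0 addr0 in h2.
rewrite /row5 /= /ot3 pairingD pairingZ pairing_delta q0 mulr0 addr0 in h3.
have [v0 v1 v2] := sigma_kernel Mq h1 h2 h3.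
by apply/rowP; apply: forall_I5; rewrite mxE.
Qed.

Lemma g_R_coframe q : g_R q = g_coframe q *m diag_mx g_diag *m (g_coframe q)^T.
Proof.
apply/matrixP => i j.
have E (A B C D' F : 'M[R]_5) : (- 2 *: (A + B) + 2^-1 *: C + 2^-1 *: D' - 6^-1 *: F) i j
  = - 2 * (A i j + B i j) + 2^-1 * C i j + 2^-1 * D' i j - 6^-1 * F i j by rewrite !mxE.
rewrite /g_R E !sprodE [RHS]mxE sum_I5 mul_mx_diag !mxE /row5 /=.
move: (o4 q) (o5 q) (ot1 q) (ot2 q) (ot3 q) => a b c d e.
move: (a i 0) (b i 0) (c i 0) (d i 0) (e i 0) (a j 0) (b j 0) (c j 0) (d j 0) (e j 0) => *.
by field.
Qed.

Lemma g_R_unit q : M5 q -> g_R q \in unitmx.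
Proof.
move=> Mq; rewrite g_R_coframe !unitmx_mul unitmx_tr g_coframe_unit // andbT /=.
rewrite unitmxE det_diag unitfE; apply/prodf_neq0.
have K : forall k : 'I_5, g_diag 0 k != 0.
  by apply: forall_I5; rewrite mxE /row5 /= ?oppr_eq0 ?invr_eq0 pnatr_eq0.
by move=> k _; exact: K.
Qed.

Lemma g_R_sym q : (g_R q)^T = g_R q.
Proof. by rewrite g_R_coframe !trmx_mul trmxK tr_diag_mx mulmxA. Qed.

Lemma smooth_sigma i : [/\ smooth_on setT (fun q => sigma1 q i 0),
  smooth_on setT (fun q => sigma2 q i 0) & smooth_on setT (fun q => sigma3 q i 0)].
Proof.
have oT : open [set: 'rV[R]_5] := openT.
have sS k : smooth_on setT (sinc (R := R) 1 k) := smooth_sin oT 1 k.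
have sC k : smooth_on setT (cosc (R := R) 1 k) := smooth_cos oT 1 k.
split.
- apply: (smooth_eq_on oT (f := fun q => sinc 1 (ix 0) q * d_theta R i 0
    + - (cosc 1 (ix 0) q * sinc 1 (ix 1) q * d_phi R i 0))) => [q _|]; last by smooth_tac oT.
  by rewrite /sinc /cosc !mul1r /sigma1 !mxE.
- apply: (smooth_eq_on oT (f := fun q => cosc 1 (ix 0) q * d_theta R i 0
    + sinc 1 (ix 0) q * sinc 1 (ix 1) q * d_phi R i 0)) => [q _|]; last by smooth_tac oT.
  by rewrite /sinc /cosc !mul1r /sigma2 !mxE.
- apply: (smooth_eq_on oT (f := fun q => - d_psi R i 0 + - (cosc 1 (ix 1) q * d_phi R i 0)))
    => [q _|]; last by smooth_tac oT.
  by rewrite /sinc /cosc !mul1r /sigma3 !mxE.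
Qed.

Lemma smooth_g_R i j : smooth_on setT (fun q => g_R q i j).
Proof.
have oT : open [set: 'rV[R]_5] := openT.
have sS : smooth_on setT (sinc (R := R) 3 (ix 3)) := smooth_sin oT 3 (ix 3).
have sC : smooth_on setT (cosc (R := R) 3 (ix 3)) := smooth_cos oT 3 (ix 3).
have [s1 s2 s3] := smooth_sigma i; have [t1 t2 t3] := smooth_sigma j.
pose F k (q : 'rV[R]_5) := row5 (- d_x R k 0) (cosc 3 (ix 3) q * d_q R k 0)
   (sigma1 q k 0 + cosc 3 (ix 3) q * d_q R k 0) (sigma2 q k 0 + d_x R k 0)
   (sigma3 q k 0 + 3 * sinc 3 (ix 3) q * d_q R k 0).
have FE q k a : F k q a = g_coframe q k a.
  by rewrite /F mxE; move: a; apply: forall_I5;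
    rewrite /row5 /= /o4 /o5 /ot1 /ot2 /ot3 !mxE.
have sF k a : smooth_on setT (fun q => F k q a).
  have [u1 u2 u3] := smooth_sigma k.
  have u1' : smooth_on setT (fun q => sigma1 q k 0 + cosc 3 (ix 3) q * d_q R k 0).
    exact (smoothD oT u1 (smoothM oT sC (smooth_cst oT _))).
  have u2' : smooth_on setT (fun q => sigma2 q k 0 + d_x R k 0).
    exact (smoothD oT u2 (smooth_cst oT _)).
  have u3' : smooth_on setT (fun q => sigma3 q k 0 + 3 * sinc 3 (ix 3) q * d_q R k 0).
    exact (smoothD oT u3 (smoothM oT (smoothM oT (smooth_cst oT 3) sS) (smooth_cst oT _))).
  move: a; apply: forall_I5; rewrite /F /row5 /=.
  - exact (smooth_cst oT _).
  - exact (smoothM oT sC (smooth_cst oT _)).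
  - exact u1'.
  - exact u2'.
  - exact u3'.
apply: (smooth_eq_on oT (f := fun q => \sum_a F i q a * g_diag 0 a * F j q a)) => [q _|].
  rewrite g_R_coframe [RHS]mxE; apply: eq_bigr => a _.
  by rewrite !FE mul_mx_diag !mxE.
apply: (smooth_sum oT) => a.
exact (smoothM oT (smoothM oT (sF i a) (smooth_cst oT _)) (sF j a)).
Qed.

(** The interface between the rolling geometry and the flat model: growth, curvature and symmetries
    are all deduced from these properties. *)
Definition flat_rolling_chart (U : set 'rV[R]_5) (y : 'I_5 -> 'rV[R]_5 -> R) (lam : 'rV[R]_5 -> R) :=
  [/\ forall a, smooth_on U (y a),
      forall q, U q -> jac y q \in unitmx,
      forall q, U q -> D_R q = [set v | [/\ pairing (th1 y q) v = 0,
        pairing (th2 y q) v = 0 & pairing (th3 y q) v = 0]],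
      smooth_on U lam &
      forall q, U q -> 0 < lam q /\ lam q *: g_R q = jac y q *m flat_eta R *m (jac y q)^T].

Lemma kernel_rolling (U : set 'rV[R]_5) y : (forall q, U q -> jac y q \in unitmx) ->
  (forall q, U q -> forall X, X q = X1 q \/ X q = X2 q -> 
     [/\ pairing (th1 y q) (X q) = 0, pairing (th2 y q) (X q) = 0 & pairing (th3 y q) (X q) = 0]) ->
  forall q, U q -> D_R q = [set v | [/\ pairing (th1 y q) v = 0,
        pairing (th2 y q) v = 0 & pairing (th3 y q) v = 0]].
Proof.
move=> uJ H q Uq.
pose K : dist R := fun r => [set v | [/\ pairing (th1 y r) v = 0,
        pairing (th2 y r) v = 0 & pairing (th3 y r) v = 0]].
have sp v : K q v <-> v \in <<[:: Z1 y q; Z2 y q]>>%VS.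
  exact: (@D_span R U y K uJ (fun _ _ => erefl) q v Uq).
have sub : (<<[:: X1 q; X2 q]>> <= <<[:: Z1 y q; Z2 y q]>>)%VS.
  apply/span_subvP => v; rewrite !inE => /orP[]/eqP->; apply/sp.
    by exact: (H q Uq (@X1 R) (or_introl erefl)).
  by exact: (H q Uq (@X2 R) (or_intror erefl)).
have eqV : <<[:: X1 q; X2 q]>>%VS = <<[:: Z1 y q; Z2 y q]>>%VS.
  (* Dimension count: X1 and X2 are independent, and two vectors span at most a plane. *)
  apply/eqP; rewrite eqEdim sub /=.
  have := free_X12 q; rewrite /free => /eqP ->.
  exact: (leq_trans (dim_span _)).
by rewrite /D_R eqV; apply/seteqP; split=> v /= /sp.
Qed.

End FlatRollingChart.

(** * Existence of flat charts *)

Section RollingChartExists.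
Variable R : realType.
Variable p : 'rV[R]_5.

Let qE (q : 'rV[R]_5) : quat R := (quatE0 q, quatE1 q, quatE2 q, quatE3 q).
Let qA := quatA (@quatA0 R) (@quatA1 R) (@quatA2 R) (@quatA3 R).
(* With this left factor B equals A at p, so that r = 1 + cos theta != 0 there. *)
Let c := qmul (qA p) (qconj (qE p)).
Let B0 q := q0 c * quatE0 q - q1 c * quatE1 q - q2 c * quatE2 q - q3 c * quatE3 q.
Let B1 q := q0 c * quatE1 q + q1 c * quatE0 q + q2 c * quatE3 q - q3 c * quatE2 q.
Let B2 q := q0 c * quatE2 q - q1 c * quatE3 q + q2 c * quatE0 q + q3 c * quatE1 q.
Let B3 q := q0 c * quatE3 q + q1 c * quatE2 q - q2 c * quatE1 q + q3 c * quatE0 q.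
Let r := roll_r (@quatA0 R) (@quatA1 R) (@quatA2 R) (@quatA3 R) B0 B1 B2 B3.
Let y := roll_y (@quatA0 R) (@quatA1 R) (@quatA2 R) (@quatA3 R) B0 B1 B2 B3.

Let nA q : qdot (qA q) (qA q) = 1.
Proof. by rewrite -(quatA_norm q) /qdot /q0 /q1 /q2 /q3 /= !expr2. Qed.

Let nE q : qdot (qE q) (qE q) = 1.
Proof. by rewrite -(quatE_norm q) /qdot /q0 /q1 /q2 /q3 /= !expr2. Qed.

Let nB q : qdot (quatB B0 B1 B2 B3 q) (quatB B0 B1 B2 B3 q) = 1.
Proof.
have -> : quatB B0 B1 B2 B3 q = qmul c (qE q) by [].
by rewrite qdot_mull nE mulr1 /c qdot_mulr qdot_conj nE mul1r nA.
Qed.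

Let rp : M5 p -> r p != 0.
Proof.
move=> [s0 _].
have cs : cosc 2^-1 (ix 1) p ^+ 2 + sinc 2^-1 (ix 1) p ^+ 2 = 1 := cos2Dsin2 _.
have cf : cosc 2^-1 (ix 2) p ^+ 2 + sinc 2^-1 (ix 2) p ^+ 2 = 1 := cos2Dsin2 _.
have cp : cosc 2^-1 (ix 0) p ^+ 2 + sinc 2^-1 (ix 0) p ^+ 2 = 1 := cos2Dsin2 _.
have bE : q0 (roll_b (@quatA0 R) (@quatA1 R) (@quatA2 R) (@quatA3 R) B0 B1 B2 B3 p) = 1.
  have adj (x z : quat R) : q0 (qmul x (qconj z)) = qdot x z.
    by rewrite /qmul /qconj /qdot /q0 /q1 /q2 /q3 /=; ring.
  have adj' (x z a : quat R) : qdot (qmul x z) a = qdot x (qmul a (qconj z)).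
    by rewrite /qmul /qconj /qdot /q0 /q1 /q2 /q3 /=; ring.
  rewrite /roll_b -/qA; have -> : quatB B0 B1 B2 B3 p = qmul c (qE p) by [].
  by rewrite adj adj' -/c {1 2}/c qdot_mulr qdot_conj nE mul1r nA.
have aE : q3 (roll_a (@quatA0 R) (@quatA1 R) (@quatA2 R) (@quatA3 R) p)
  = cosc 2^-1 (ix 1) p ^+ 2 - sinc 2^-1 (ix 1) p ^+ 2.
  transitivity ((cosc 2^-1 (ix 1) p ^+ 2 - sinc 2^-1 (ix 1) p ^+ 2)
     * (cosc 2^-1 (ix 2) p ^+ 2 + sinc 2^-1 (ix 2) p ^+ 2)
     * (cosc 2^-1 (ix 0) p ^+ 2 + sinc 2^-1 (ix 0) p ^+ 2)); last by rewrite cf cp !mulr1.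
  rewrite /roll_a /qrot /qmul /qconj /quatA /q0 /q1 /q2 /q3 /= /quatA0 /quatA1 /quatA2 /quatA3.
  move: (cosc _ _ p) (sinc _ _ p) (cosc 2^-1 (ix 1) p) (sinc 2^-1 (ix 1) p)
    (cosc 2^-1 (ix 2) p) (sinc 2^-1 (ix 2) p) => *; ring.
have -> : r p = 2 * cosc 2^-1 (ix 1) p ^+ 2.
  by rewrite /r /roll_r /cone_r aE bE; move: cs; lra.
(* A zero of cos (theta / 2) would be a zero of sin theta. *)
rewrite mulf_neq0 ?pnatr_eq0 // expf_neq0 //; apply: contra s0 => /eqP c0.
rewrite /theta_; have -> : p 0 (ix 1) = 2^-1 * p 0 (ix 1) + 2^-1 * p 0 (ix 1) by field.
by rewrite sinD; rewrite /cosc in c0; rewrite c0 mulr0 mul0r addr0.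
Qed.

Let flA (U : set 'rV[R]_5) (oU : open U) (X : vfield R) := quat_flowA oU X.
Let flB (U : set 'rV[R]_5) (oU : open U) (X : vfield R) :
    quat_flow U X B0 B1 B2 B3 (be1 X) (be2 X) (be3 X) :=
  quat_flow_mull oU (q0 c) (q1 c) (q2 c) (q3 c) (quat_flowE oU X).

Let smooth_r U : open U -> smooth_on U r.
Proof.
move=> oU.
have [_ _ a3] := has_vder_roll_a oU (flA oU) (fun=> 0).
have [b0 _ _ _] := has_vder_roll_b oU (flA oU) (flB oU) (fun=> 0).
exact (smoothD oU a3.1 b0.1).
Qed.

Lemma rolling_chart (V : set 'rV[R]_5) : M5 p -> open V -> V p -> V `<=` @M5 R ->
  exists (y : 'I_5 -> 'rV[R]_5 -> R) (lam : 'rV[R]_5 -> R) (e : R),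
  let U : set 'rV[R]_5 := [set q | forall j, `|q 0 j - p 0 j| < e] in
  [/\ 0 < e, open U, U `<=` V & flat_rolling_chart U y lam].
Proof.
move=> Mp oV Vp VM.
have oW := open_neq0 oV (smooth_r oV).
have [e e0 eW] := open_box oW (conj Vp (rp Mp)).
(* The factor 3 / 2 comes from [g_R_entries], and r^-2 from the normalisation of the cone. *)
exists y, (fun q => 3 / 2 * ((r q)^-1 * (r q)^-1)), e; move=> U.
have oU : open U.
  suff -> : U = ball p e by exact: ball_open.
  by apply/seteqP; split=> q Hq; [exact/boxP|have [_] := (boxP p e q).1 Hq].
have r0 q : U q -> r q != 0 by move=> /eW[].
have UV : U `<=` V by move=> q /eW[].
have gE q : U q -> (3 / 2 * ((r q)^-1 * (r q)^-1)) *: g_R q = jac y q *m flat_eta R *m (jac y q)^T.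
  move=> Uq; apply/matrixP => i j.
  rewrite (roll_jac_metric oU (flA oU) (flB oU) r0 (fun q _ => nA q) (fun q _ => nB q) i j Uq).
  rewrite g_R_entries mxE -/r; move: (r q) (r0 q Uq) (g_R q i j) => z z0 g; by field.
(* J eta J^T is a nonzero multiple of the invertible matrix g_R, so its factor J is invertible. *)
have uJ q : U q -> jac y q \in unitmx.
  move=> Uq; have := g_R_unit (VM _ (UV q Uq)).
  have k0 : 3 / 2 * ((r q)^-1 * (r q)^-1) != 0.
    by rewrite !mulf_neq0 ?invr_eq0 ?pnatr_eq0 // r0.
  have kU : 3 / 2 * ((r q)^-1 * (r q)^-1) \is a GRing.unit by rewrite unitfE.
  rewrite -(unitmxZ _ kU) gE // !unitmx_mul => /andP[/andP[]] //.
split=> //; split.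
- exact: (smooth_roll_y oU (flA oU) (flB oU) r0).
- exact: uJ.
- apply: (kernel_rolling uJ) => q Uq X XE.
  have Mq := VM _ (UV q Uq).
  have al_eq (Z : vfield R) : X q = Z q -> [/\ al1 X q = al1 Z q, al2 X q = al2 Z q,
      al3 X q = al3 Z q, be1 X q = be1 Z q & be2 X q = be2 Z q] /\ be3 X q = be3 Z q.
    by rewrite /al1 /al2 /al3 /be1 /be2 /be3 => ->.
  apply: (roll_contact oU (flA oU) (flB oU) r0 (fun q _ => nA q) (fun q _ => nB q) Uq).
  + case: XE => /al_eq[[e1 e2 e3 e4 e5] e6]; rewrite e1 e4.
      by have [] := X1_rolls Mq.
    by have [] := X2_rolls Mq.
  + case: XE => /al_eq[[e1 e2 e3 e4 e5] e6]; rewrite e2 e5.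
      by have [] := X1_rolls Mq.
    by have [] := X2_rolls Mq.
  + case: XE => /al_eq[[e1 e2 e3 e4 e5] e6]; rewrite e3 e6.
      by have [] := X1_rolls Mq.
    by have [] := X2_rolls Mq.
- have sV := smoothV oU (smooth_r oU) r0.
  exact (smoothM oU (smooth_cst oU _) (smoothM oU sV sV)).
- move=> q Uq; split; last exact: gE.
  have k0 : (0 : R) < 3 / 2 by lra.
  have r2 : 0 < (r q)^-1 * (r q)^-1 by rewrite -expr2 exprn_even_gt0 //= invr_eq0 r0.
  exact: (mulr_gt0 k0 r2).
Qed.

End RollingChartExists.

(** * The theorem *)

Section Conclusion.
Variable R : realType.
Implicit Types (p q : 'rV[R]_5).

Lemma annihilator_Dtilde p : M5 p -> annihilator (@Dtilde_R R) p
  = [set a | a \in <<[:: ot1 p; ot2 p; ot3 p]>>%VS].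
Proof.
move=> Mp; have WU := g_coframe_unit Mp.
apply/seteqP; split=> [a H|a /mem_span3[x [z [w ->]]] v [h1 h2 h3]]; last first.
  by rewrite !pairingD !pairingZ h1 h2 h3 !mulr0 !addr0.
have [c aE] : exists c, a = g_coframe p *m c.
  by exists (invmx (g_coframe p) *m a); rewrite mulKVmx.
have col_k k (v : 'rV[R]_5) : pairing (row5 (o4 p) (o5 p) (ot1 p) (ot2 p) (ot3 p) k) v
    = (v *m g_coframe p) 0 k.
  rewrite pairingE mxE; apply: eq_bigr => i _; rewrite mxE; congr (_ * _).
  by move: k; apply: forall_I5.
(* The vectors dual to [o4] and [o5] in the full coframe lie in the distribution. Evaluating [a] on
   them shows that its coefficients along [o4] and [o5] vanish. *)
have c0 (l : 'I_5) : l != ix 2 -> l != ix 3 -> l != ix 4 -> c l 0 = 0.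
  move=> l2 l3 l4; pose v : 'rV[R]_5 := delta_mx 0 l *m invmx (g_coframe p).
  have vW : v *m g_coframe p = delta_mx 0 l by rewrite /v mulmxKV.
  have ov k : k != l -> pairing (row5 (o4 p) (o5 p) (ot1 p) (ot2 p) (ot3 p) k) v = 0.
    by move=> kl; rewrite col_k vW mxE (negPf kl) andbF.
  have Dv : Dtilde_R p v.
    split; [exact: (ov (ix 2) (ltac:(by rewrite eq_sym)))|exact: (ov (ix 3) (ltac:(by rewrite eq_sym)))
      |exact: (ov (ix 4) (ltac:(by rewrite eq_sym)))].
  by have := H v Dv; rewrite /pairing aE mulmxA vW -rowE mxE.
apply/mem_span3; exists (c (ix 2) 0), (c (ix 3) 0), (c (ix 4) 0).
rewrite {1}aE; apply/colP => i; rewrite mxE sum_I5 !mxE.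
rewrite (c0 (ix 0)) // (c0 (ix 1)) // !mulr0 !add0r /row5 /=.
move: (ot1 p) (ot2 p) (ot3 p) => o1 o2 o3.
by rewrite ![_ * c _ 0]mulrC.
Qed.

Lemma g_R_roll p : M5 p -> g_R p = g_roll p.
Proof.
move=> [s0 c0].
have dh : derive1 (@h_roll R) (x_ p) = - (3 * sin (3 * x_ p)).
  have -> : @h_roll R = (fun x : R => cos (3 * x)) by [].
  rewrite derive1E.
  have H : is_derive (x_ p) (1 : R) (cos \o (3 *: (id : R -> R))) (- (3 * sin (3 * x_ p))).
    by apply: is_derive_eq; rewrite /GRing.scale /=; ring.
  exact: derive_val.
have df : derive1 (@f_roll R) (theta_ p) = - cos (theta_ p).
  rewrite derive1E; have H : is_derive (theta_ p) (1 : R) (@f_roll R) (- cos (theta_ p)).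
    exact: is_deriveN.
  by rewrite derive_val.
apply/matrixP => i j.
have E (A B C D' F : 'M[R]_5) : (- 2 *: (A + B) + 2^-1 *: C + 2^-1 *: D' - 6^-1 *: F) i j
  = - 2 * (A i j + B i j) + 2^-1 * C i j + 2^-1 * D' i j - 6^-1 * F i j by rewrite !mxE.
have E' (A B C D' F G H : 'M[R]_5) :
  (A + B - (C + D') - 2^-1 *: (F + G) - 6^-1 *: H) i j
  = A i j + B i j - (C i j + D' i j) - 2^-1 * (F i j + G i j) - 6^-1 * H i j by rewrite !mxE.
have Ad (a b : 'cV[R]_5) k : (a + b) k 0 = a k 0 + b k 0 by rewrite !mxE.
have N (a : 'cV[R]_5) k : (- a) k 0 = - a k 0 by rewrite !mxE.
have S (a : 'cV[R]_5) c k : (c *: a) k 0 = c * a k 0 by rewrite !mxE.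
rewrite /g_R /g_roll E E' !sprodE /o4 /o5 /ot1 /ot2 /ot3 /omega1 /omega2 /omega3
  /chi1 /chi2 /chi3 /chi4 /sigma1 /sigma2 /sigma3 dh df /h_roll /f_roll !(Ad, N, S).
have := cos2Dsin2 (psi_ p); move: s0 c0.
move: (sin (theta_ p)) (cos (theta_ p)) (sin (psi_ p)) (cos (psi_ p)) (cos (3 * x_ p))
  (sin (3 * x_ p)) => s c S' C cx sx s0 cx0 CS.
have e1 z : - (3 * sx) / cx * (cx * z) = - (3 * sx * z) by field.
have e2 z : - c / - s * (- s * z) = - (c * z) by field.
rewrite !e1 !e2.
move: (d_theta R i 0) (d_theta R j 0) (d_phi R i 0) (d_phi R j 0) (d_psi R i 0) (d_psi R j 0)
  (d_x R i 0) (d_x R j 0) (d_q R i 0) (d_q R j 0) => ti tj fi fj pi pj xi xj qi qj.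
(* The two metrics differ by multiples of sin^2 psi + cos^2 psi = 1, one for each of the squares of
   d theta, sin theta d phi, dx and cos (3 x) dq. *)
have f (k : R) := congr1 ( *%R k) CS.
move: (f (ti * tj)) (f (s ^+ 2 * fi * fj)) (f (xi * xj)) (f (cx ^+ 2 * qi * qj)).
clear; do 4 move=> ?.
by lra.
Qed.

End Conclusion.

Section Globalization.
Variable R : realType.
Variables (M : set 'rV[R]_5) (D : dist R) (U : set 'rV[R]_5) (y : 'I_5 -> 'rV[R]_5 -> R).
Hypotheses (oU : open U) (UM : U `<=` M) (sy : forall a, smooth_on U (y a))
  (uJ : forall p, U p -> jac y p \in unitmx)
  (HD : forall q, U q -> D q = [set v | [/\ pairing (th1 y q) v = 0,
     pairing (th2 y q) v = 0 & pairing (th3 y q) v = 0]]).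

Lemma nurowski_on_chart (g : metric R) (k : 'rV[R]_5 -> R) : smooth_on U k ->
  (forall q, U q -> k q != 0) ->
  (forall q, U q -> g q = k q *: (jac y q *m flat_eta R *m (jac y q)^T)) ->
  nurowski_representative U D g.
Proof.
move=> sk k0 gE p Up; have [c1 c2 c3 c4 c5] := smooth_thc oU sy.
have z0 : smooth_form U (fun=> 0 : 'cV[R]_5).
  move=> i; apply: (smooth_eq_on oU (f := fun=> 0)) => [q _|]; first by rewrite mxE.
  exact: smooth_cst.
exists U, (th1 y), (th2 y), (th3 y), (th4 y), (th5 y).
exists (fun=> 0), (fun=> 0), (fun=> 0), (fun=> 0), (fun=> 0), (fun=> 0), (fun=> 0).
(* The factor - 3 inverts the factor - 1 / 3 of [nurowski_flat]. *)
exists (fun q => - 3 * k q).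
split; first by split.
split; first by split; exact: (smooth_chart_form oU sy).
split; first by split.
split; first by split.
split; first by move=> q Uq; exact: (free_th uJ Uq).
split; first exact: HD.
split; first exact: (cartan_flat oU sy).
split.
- exact (smoothM oU (smooth_cst oU _) sk).
- by move=> q Uq; rewrite mulf_neq0 ?k0 // oppr_eq0 pnatr_eq0.
- move=> q Uq; rewrite nurowski_flat scalerA gE //; congr (_ *: _).
  by move: (k q) => z; field.
Qed.

End Globalization.

Theorem theorem4p3 (R : realType) :
  (forall p, @M5 R p ->
     annihilator (@Dtilde_R R) p
     = [set a | a \in <<[:: ot1 p; ot2 p; ot3 p]>>%VS])
  /\ is_235 (@M5 R) (@D_R R)
  /\ maximally_symmetric (@M5 R) (@D_R R)
  /\ nurowski_representative (@M5 R) (@D_R R) (@g_R R)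
  /\ (forall p, @M5 R p -> g_R p = g_roll p)
  /\ conformally_flat (@M5 R) (@g_R R)
  /\ local_symmetries_split_g2 (@M5 R) (@D_R R).
Proof.
have chart p : M5 p -> exists U y lam, [/\ open U, U p & U `<=` @M5 R] /\ flat_rolling_chart U y lam.
  move=> Mp; have [y [lam [e [e0 oU UM FC]]]] := rolling_chart Mp (@M5_open R) Mp (fun _ h => h).
  exists [set q : 'rV[R]_5 | forall j, `|q 0 j - p 0 j| < e], y, lam; split; last exact: FC.
  by split; [exact: oU|move=> j; rewrite subrr normr0|exact: UM].
have nur_lam U y lam : open U -> flat_rolling_chart U y lam ->
    nurowski_representative U (@D_R R) (fun q => lam q *: g_R q).
  move=> oU [sy uJ HD sl lE]; apply: (nurowski_on_chart oU sy uJ HD (smooth_cst oU 1)).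
    by move=> q _; exact: oner_neq0.
  by move=> q Uq; rewrite scale1r; exact: (lE q Uq).2.
split; first by move=> p Mp; exact: annihilator_Dtilde.
split; last split; last split; last split; last split.
- split.
  + move=> p Mp; have [U [y [lam [[oU Up UM] [sy uJ HD _ _]]]]] := chart p Mp.
    have [s1 s2 _ _ _] := smooth_Z oU sy uJ.
    exists U, [:: Z1 y; Z2 y]; split; first exact (And3 oU Up UM).
    split; first exact: erefl.
      case=> [|[|n]] h; [exact: s1|exact: s2|by exfalso].
    move=> q Uq; split; first exact: (free_Z12 uJ Uq).
    apply/seteqP; split=> v Dv; [exact: (D_span uJ HD _ Uq).1|exact: (D_span uJ HD _ Uq).2].
  + move=> p Mp; have [U [y [lam [[oU Up UM] [sy uJ HD _ _]]]]] := chart p Mp.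
    have [s1 s2 s3 _ _] := smooth_Z oU sy uJ.
    exists U, [:: Z1 y; Z2 y; Z3 y]; split; first exact (And3 oU Up UM).
    split; first exact: erefl.
      case=> [|[|[|n]]] h; [exact: s1|exact: s2|exact: s3|by exfalso].
    move=> q Uq; split; first exact: (free_Z uJ Uq).
    exact: (bracket_distP oU sy uJ HD Uq).
  + move=> p Mp; have [U [y [lam [[oU Up UM] [sy uJ HD _ _]]]]] := chart p Mp.
    exact: (bracket_dist_full oU sy uJ HD Up).
- move=> p Mp; have [U [y [lam [[oU Up UM] FC]]]] := chart p Mp.
  (* The flat rescaling is taken as representative: its whole curvature vanishes, hence so does its
     Weyl tensor. *)
  exists U, (fun q => lam q *: g_R q); split; first exact (And3 oU Up UM).
  split; first exact: (nur_lam _ _ _ oU FC).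
  have [sy uJ HD sl lE] := FC.
  exact: (weyl_zero_on_chart oU sy uJ (flat_eta_sym R) (flat_eta_unit R) (fun q Uq => (lE q Uq).2)).
- move=> p Mp; have [U [y [lam [[oU Up UM] FC]]]] := chart p Mp.
  have [sy uJ HD sl lE] := FC.
  have l0 q : U q -> lam q != 0 by move=> /lE[h _]; exact: lt0r_neq0.
  have N : nurowski_representative U (@D_R R) (@g_R R).
    apply: (nurowski_on_chart oU sy uJ HD (smoothV oU sl l0)).
      by move=> q Uq; rewrite invr_eq0 l0.
    by move=> q Uq; rewrite -(lE q Uq).2 scalerA mulVf ?l0 // scale1r.
  have [W [t1 [t2 [t3 [t4 [t5 [w1 [w2 [w3 [w4 [w5 [w6 [w7 [k [[oW Wp WU] H]]]]]]]]]]]]]]] := N p Up.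
  exists W, t1, t2, t3, t4, t5, w1, w2, w3, w4, w5, w6, w7, k.
  split; last exact: H.
  by split; [exact: oW|exact: Wp|exact: (subset_trans WU UM)].
- by move=> p Mp; exact: g_R_roll.
- split.
    split=> [i j|p Mp]; first exact: (smooth_subset (fun _ _ => I) (smooth_g_R i j)).
    by split; [exact: g_R_sym|exact: g_R_unit].
  move=> p Mp; have [U [y [lam [[oU Up UM] [sy uJ HD sl lE]]]]] := chart p Mp.
  exists U, lam; split; first exact (And3 oU Up UM).
  split; [exact: sl|by move=> q /lE[]|].
  exact: (flat_on_chart oU sy uJ (flat_eta_sym R) (flat_eta_unit R) (fun q Uq => (lE q Uq).2)).
- move=> p V Mp oV Vp VM.
  have [y [lam [e [e0 oU UV [sy uJ HD _ _]]]]] := rolling_chart Mp oV Vp VM.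
  exists [set q : 'rV[R]_5 | forall j, `|q 0 j - p 0 j| < e]; split.
    by split; [exact: oU|move=> j; rewrite subrr normr0|exact: UV].
  exists (Phi y); apply: (g2_iso_chart oU sy uJ HD e0) => q; exact: iff_refl.
Qed.
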